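(* There is an algorithm which, given linear functions $f_1,\dots,f_n:\mathbb{R}\to\mathbb{R}$ among which exactly $k>0$ are monotone decreasing, computes a minimum permutation (and likewise a maximum permutation) for $f_1,\dots,f_n$ in $O(k\,2^k n^6)$ time.
   Context: A linear function is $f(x)=ax+b$ with $a,b\in\mathbb{R}$; it is monotone decreasing if $a<0$. For a permutation $\sigma$ of $[n]$, $f^\sigma=f_{\sigma(n)}\circ\cdots\circ f_{\sigma(1)}$; $\sigma$ is minimum if $f^\sigma(x)\le f^\rho(x)$ for all $x$ and all permutations $\rho$, and maximum if $f^\sigma(x)\ge f^\rho(x)$ for all $x$ and all $\rho$. Running time is measured in a model where arithmetic operations and comparisons on reals cost unit time. *)

(* Defs.v *)
From Stdlib Require Import Reals Lra Lia ZArith Arith List Permutation.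
Import ListNotations.
Open Scope R_scope.

Definition linfun := (R * R)%type.

Definition lf_apply (f : linfun) (x : R) : R := fst f * x + snd f.

Definition decreasingb (f : linfun) : bool :=
  if Rlt_dec (fst f) 0 then true else false.

Definition num_decreasing (fs : list linfun) : nat :=
  length (filter decreasingb fs).

(** A permutation of {0,...,n-1} is represented by the list
    [sigma(0); ...; sigma(n-1)].  [compose fs s] is
    f_{s(n-1)} o ... o f_{s(0)}, i.e. f_{s(0)} is applied first. *)
Definition is_perm (n : nat) (s : list nat) : Prop := Permutation (seq 0 n) s.

Definition compose (fs : list linfun) (s : list nat) (x : R) : R :=
  fold_left (fun acc i => lf_apply (nth i fs (0, 0)) acc) s x.

Definition is_min_perm (fs : list linfun) (s : list nat) : Prop :=
  is_perm (length fs) s /\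
  forall rho, is_perm (length fs) rho ->
    forall x, compose fs s x <= compose fs rho x.

Definition is_max_perm (fs : list linfun) (s : list nat) : Prop :=
  is_perm (length fs) s /\
  forall rho, is_perm (length fs) rho ->
    forall x, compose fs rho x <= compose fs s x.

Inductive instr : Type :=
| NConst (d c : nat)
| NAdd (d i j : nat)
| NSub (d i j : nat)                 (* N[d] := N[i] - N[j] (truncated) *)
| NMul (d i j : nat)
| NLoadInd (d i : nat)
| NStoreInd (i s : nat)
| RConst (d : nat) (z : Z)
| RAdd (d i j : nat)
| RSub (d i j : nat)
| RMul (d i j : nat)
| RDiv (d i j : nat)
| RLoadInd (d i : nat)
| RStoreInd (i s : nat)
| JmpNLe (i j l : nat)
| JmpRLe (i j l : nat)
| Halt.

Definition program := list instr.

Record config : Type := Config {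
  pc : nat;
  nreg : nat -> nat;
  rreg : nat -> R }.

Definition upd {A : Type} (f : nat -> A) (i : nat) (v : A) : nat -> A :=
  fun j => if Nat.eqb j i then v else f j.

Definition step (P : program) (c : config) : option config :=
  let '(Config p N Rg) := c in
  match nth_error P p with
  | None => None
  | Some Halt => None
  | Some ins => Some
    match ins with
    | NConst d v => Config (S p) (upd N d v) Rg
    | NAdd d i j => Config (S p) (upd N d (N i + N j)%nat) Rg
    | NSub d i j => Config (S p) (upd N d (N i - N j)%nat) Rg
    | NMul d i j => Config (S p) (upd N d (N i * N j)%nat) Rg
    | NLoadInd d i => Config (S p) (upd N d (N (N i))) Rg
    | NStoreInd i s => Config (S p) (upd N (N i) (N s)) Rg
    | RConst d z => Config (S p) N (upd Rg d (IZR z))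
    | RAdd d i j => Config (S p) N (upd Rg d (Rg i + Rg j))
    | RSub d i j => Config (S p) N (upd Rg d (Rg i - Rg j))
    | RMul d i j => Config (S p) N (upd Rg d (Rg i * Rg j))
    | RDiv d i j => Config (S p) N (upd Rg d (Rg i / Rg j))
    | RLoadInd d i => Config (S p) N (upd Rg d (Rg (N i)))
    | RStoreInd i s => Config (S p) N (upd Rg (N i) (Rg s))
    | JmpNLe i j l =>
        Config (if Nat.leb (N i) (N j) then l else S p) N Rg
    | JmpRLe i j l =>
        Config (if Rle_dec (Rg i) (Rg j) then l else S p) N Rg
    | Halt => Config p N Rg
    end
  end.

Fixpoint exec (P : program) (t : nat) (c : config) : config :=
  match t with
  | O => c
  | S t' => match step P c with
            | Some c' => exec P t' c'
            | None => c
            end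
  end.

(** Input convention: N[0] = n; Rg[2i] = a_i, Rg[2i+1] = b_i for i < n;
    all other registers are 0 and pc = 0. *)
Definition init_config (fs : list linfun) : config :=
  Config 0
    (fun i => if Nat.eqb i 0 then length fs else 0%nat)
    (fun i => let f := nth (Nat.div2 i) fs (0, 0) in
              if Nat.ltb (Nat.div2 i) (length fs)
              then (if Nat.even i then fst f else snd f) else 0).

Definition output (n : nat) (c : config) : list nat :=
  map (fun i => nreg c (S i)) (seq 0 n).

Definition computes_within (P : program) (fs : list linfun) (t : nat)
    (s : list nat) : Prop :=
  let c := exec P t (init_config fs) in
  step P c = None /\ output (length fs) c = s.

(* Main.v *)
Require Import Defs.
From Stdlib Require Import Reals List Lra Lia ZArith Arith Permutation Sorted Bool FinFun
  FunctionalExtensionality.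
Import ListNotations.
Open Scope R_scope.

(* A composition of linear functions has a slope independent of the order, so only its constant
   term [const] matters.  Attach to a suffix of the order the point (slope, - constant).
   Exchanging two adjacent blocks of an optimal order shows that any three of these points turn
   clockwise or counterclockwise according to the sign of the slope at the middle one.  Hence all of
   them are in convex position: the points with positive slope run clockwise, in order of time,
   along the right half of the polygon, and the others run counterclockwise along the left half.
   The nondecreasing functions are edges of this polygon, and the direction of an edge is that of the
   vector (b, a - 1).  So, sorting the nondecreasing functions by the angle of this vector, an
   optimal order peels some rotation of the sorted list from both ends, decreasing functions being
   inserted anywhere.  Zero slopes, zero vectors and parallel vectors are dealt with by perturbation.
   It remains to minimize the constant term over these orders, by dynamic programming over the
   subset of decreasing functions and the interval of the sorted list that are still to be applied. *)

(** An exchange of neighbours alone gives no sorting criterion: its gain carries the slope of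
    everything applied afterwards, so the comparison of two functions is reversed each time this
    slope changes sign. Attaching points to suffixes absorbs the sign, since the gain times the
    square of a slope is the cross product of two consecutive chords. The convexity argument needs
    nonzero slopes, and the comparison of angles needs nonzero vectors without ties. Perturbed
    functions have both. There are finitely many orders and their constant terms depend continuously
    on the perturbation, so an order strictly better than all candidates would stay better under a
    small one. The perturbation lives in the proof only: the program sorts the given data. The
    dynamic program is sound because all orders of the same functions have the same slope, so the
    best tail is the same whatever is applied before it. It has at most
    [2 ^ k * (n + 1) * (2 * n + 1)] states with at most [k + 2] transitions each; with a quadratic
    sort, the cost is of order [k * 2 ^ k * n ^ 2], within the required bound. *)

Definition slope (a : nat -> R) (s : list nat) : R :=
  fold_right (fun x r => a x * r) 1 s.

(** The head of the list is applied first, so its offset is scaled by the slopes of all the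
    functions behind it. Prepending a function leaves the data of the suffix alone, which is why
    suffixes are tracked rather than prefixes. *)
Fixpoint const (a b : nat -> R) (s : list nat) : R :=
  match s with
  | [] => 0
  | x :: t => slope a t * b x + const a b t
  end.

Lemma slope_cons a x s : slope a (x :: s) = a x * slope a s.
Proof. reflexivity. Qed.

Lemma slope_app a p q : slope a (p ++ q) = slope a p * slope a q.
Proof. induction p as [|x p IH]; cbn [app]; rewrite ?slope_cons, ?IH; [cbn|]; ring. Qed.

Lemma const_app a b p q :
  const a b (p ++ q) = slope a q * const a b p + const a b q.
Proof.
  induction p as [|x p IH]; cbn [app const]; [ring|].
  rewrite IH, slope_app. ring.
Qed.

Lemma slope_perm a s t : Permutation s t -> slope a s = slope a t.
Proof.
  induction 1; rewrite ?slope_cons; try congruence; try ring.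
Qed.

Lemma compose_eq fs s x :
  compose fs s x = slope (fun i => fst (nth i fs (0, 0))) s * x
                   + const (fun i => fst (nth i fs (0, 0))) (fun i => snd (nth i fs (0, 0))) s.
Proof.
  unfold compose. revert x.
  induction s as [|i s IH]; intros x; cbn [fold_left const]; [cbn; ring|].
  rewrite IH, slope_cons. unfold lf_apply. ring.
Qed.

Definition minimal (a b : nat -> R) (n : nat) (s : list nat) : Prop :=
  is_perm n s /\ forall r, is_perm n r -> const a b s <= const a b r.

(** * Permutations as a finite set *)

(** A finite list containing every permutation; the other words in it are harmless. Finiteness
    yields minimizers and lets one size of perturbation serve all orders at once. *)
Fixpoint words (n L : nat) : list (list nat) :=
  match L with
  | O => [[]]
  | S L' => flat_map (fun x => map (cons x) (words n L')) (seq 0 n)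
  end.

Lemma in_words n s : Forall (fun x => (x < n)%nat) s -> In s (words n (length s)).
Proof.
  induction 1 as [|x s Hx _ IH]; cbn [length words]; [now left|].
  apply in_flat_map. exists x. split; [apply in_seq; lia|now apply in_map].
Qed.

Lemma perm_in_words n s : is_perm n s -> In s (words n n).
Proof.
  intros H. assert (Hl : length s = n)
    by (rewrite <- (Permutation_length H); apply length_seq).
  rewrite <- Hl at 2. apply in_words. apply Forall_forall. intros x Hx.
  apply (Permutation_in x (Permutation_sym H)) in Hx. apply in_seq in Hx. lia.
Qed.

Lemma argmin_in {T} (f : T -> R) (P : T -> Prop) (l : list T) :
  (exists s, In s l /\ P s) ->
  exists s, In s l /\ P s /\ forall s', In s' l -> P s' -> f s <= f s'.
Proof.
  induction l as [|x l IH]; intros (s & Hs & Ps); [destruct Hs|].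
  destruct (Classical_Prop.classic (exists s, In s l /\ P s)) as [He|Hn].
  - destruct (IH He) as (m & Hm & Pm & Hmin).
    destruct (Classical_Prop.classic (P x /\ f x <= f m)) as [[Px Hx]|Hx].
    + exists x. split; [now left|split; [easy|]].
      intros s' [<-|Hs'] Ps'; [lra|]. specialize (Hmin s' Hs' Ps'). lra.
    + exists m. split; [now right|split; [easy|]].
      intros s' [<-|Hs'] Ps'; [|auto].
      destruct (Rle_dec (f m) (f x)) as [|Hle]; [easy|]. exfalso. apply Hx. split; [easy|lra].
  - destruct Hs as [->|Hs]; [|exfalso; eauto].
    exists s. split; [now left|split; [easy|]].
    intros s' [<-|Hs'] Ps'; [lra|]. exfalso; eauto.
Qed.

Lemma exists_minimal a b n : exists s, minimal a b n s.
Proof.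
  destruct (argmin_in (const a b) (is_perm n) (words n n)) as (s & _ & Ps & Hmin).
  - exists (seq 0 n). split; [apply perm_in_words|]; apply Permutation_refl.
  - exists s. split; [easy|]. intros r Hr. apply Hmin; [now apply perm_in_words|easy].
Qed.

(** * Convex position of the suffix points *)

(** The cross product of [q - p] and [r - q]: positive for a left turn at [q], negative for a right
    turn. *)
Definition turn (p q r : R * R) : R :=
  (fst q - fst p) * (snd r - snd q) - (fst r - fst q) * (snd q - snd p).

Definition point (a b : nat -> R) (s : list nat) : R * R := (slope a s, - const a b s).

(** Let [A], [B], [C] be the slopes of [t], [q], [p], and [c], [d] the constants of [p], [q].
    Exchanging the blocks shows [A * (c * (B - 1) - d * (C - 1)) <= 0], while the turn equals
    [A * A * B * (c * (B - 1) - d * (C - 1))]. The additional factor [B * A], the slope at the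
    middle point, completes the square of [B * A]. *)
Lemma minimal_turn a b n r p q t :
  minimal a b n (r ++ p ++ q ++ t) ->
  slope a (q ++ t) * turn (point a b (p ++ q ++ t)) (point a b (q ++ t)) (point a b t) <= 0.
Proof.
  intros [Hp Hmin].
  assert (Hle : const a b (r ++ p ++ q ++ t) <= const a b (r ++ q ++ p ++ t)).
  { apply Hmin. unfold is_perm in *. rewrite Hp. apply Permutation_app_head.
    rewrite !app_assoc. apply Permutation_app_tail. apply Permutation_app_comm. }
  rewrite !const_app, !slope_app in Hle.
  unfold turn, point; cbn [fst snd]. rewrite !const_app, !slope_app.
  set (A := slope a t) in *. set (B := slope a q) in *. set (C := slope a p) in *.
  set (c := const a b p) in *. set (d := const a b q) in *. set (e := const a b t) in *.
  assert (Hd : A * (c * (B - 1) - d * (C - 1)) <= 0) by lra.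
  match goal with |- ?x <= 0 => replace x with (Rsqr (B * A) * (A * (c * (B - 1) - d * (C - 1)))) by (unfold Rsqr; ring) end.
  pose proof (Rle_0_sqr (B * A)). nra.
Qed.

Lemma skipn_split {T} (l : list T) i j :
  (i <= j)%nat -> skipn i l = firstn (j - i) (skipn i l) ++ skipn j l.
Proof.
  intros H. rewrite <- (firstn_skipn (j - i) (skipn i l)) at 1. f_equal.
  rewrite skipn_skipn. f_equal. lia.
Qed.

Definition vertex (a b : nat -> R) (s : list nat) (i : nat) : R * R := point a b (skipn i s).

Lemma vertex_turn a b n s i j l :
  minimal a b n s -> (i <= j <= l)%nat ->
  slope a (skipn j s) * turn (vertex a b s i) (vertex a b s j) (vertex a b s l) <= 0.
Proof.
  intros Hm [Hij Hjl]. unfold vertex.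
  rewrite (skipn_split s i j Hij), (skipn_split s j l Hjl).
  apply minimal_turn with (n := n) (r := firstn i s).
  rewrite <- (skipn_split s j l Hjl), <- (skipn_split s i j Hij), firstn_skipn. exact Hm.
Qed.

(* The clockwise rank of a vertex on the convex polygon: vertices of positive abscissa in order
   of time, followed by the others in reverse order of time. *)
Definition rank (a : nat -> R) (s : list nat) (i : nat) : nat :=
  if Rlt_dec 0 (slope a (skipn i s)) then i else (2 * length s + 1 - i)%nat.

Lemma turn_rot p q r : turn p q r = turn q r p.
Proof. unfold turn. ring. Qed.

Lemma turn_swap p q r : turn p q r = - turn p r q.
Proof. unfold turn. ring. Qed.

(** Passing from the order of ranks to the order of time permutes the three vertices. This
    permutation is even if the vertex in the middle of time has positive slope and odd otherwise, so
    the change of sign of [turn] under it cancels the sign in [vertex_turn]. *)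
Lemma rank_turn a b n s i j l :
  minimal a b n s -> (forall i, slope a (skipn i s) <> 0) ->
  (i <= length s)%nat -> (j <= length s)%nat -> (l <= length s)%nat ->
  (rank a s i <= rank a s j <= rank a s l)%nat ->
  turn (vertex a b s i) (vertex a b s j) (vertex a b s l) <= 0.
Proof.
  intros Hm Hn Hi Hj Hl [H1 H2]. unfold rank in *.
  pose (A i := slope a (skipn i s)).
  change (slope a (skipn i s)) with (A i) in *. change (slope a (skipn j s)) with (A j) in *.
  change (slope a (skipn l s)) with (A l) in *.
  assert (Hpos : forall i j l, (i <= j <= l)%nat -> 0 < A j ->
            turn (vertex a b s i) (vertex a b s j) (vertex a b s l) <= 0).
  { intros x y z Ho Ha. pose proof (vertex_turn a b n s x y z Hm Ho). fold (A y) in H. nra. }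
  assert (Hneg : forall i j l, (i <= j <= l)%nat -> ~ 0 < A j ->
            0 <= turn (vertex a b s i) (vertex a b s j) (vertex a b s l)).
  { intros x y z Ho Ha. pose proof (vertex_turn a b n s x y z Hm Ho).
    pose proof (Hn y). fold (A y) in H, H0. nra. }
  set (v := vertex a b s) in *.
  pose proof (turn_swap (v i) (v j) (v l)) as S1.
  pose proof (turn_rot (v i) (v j) (v l)) as S2.
  pose proof (turn_rot (v j) (v l) (v i)) as S3.
  pose proof (turn_rot (v i) (v l) (v j)) as S4.
  pose proof (turn_rot (v l) (v j) (v i)) as S5.
  destruct (Rlt_dec 0 (A i)) as [Ai|Ai], (Rlt_dec 0 (A j)) as [Aj|Aj],
           (Rlt_dec 0 (A l)) as [Al|Al]; try lia.
  - apply Hpos; [lia|easy].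
  - destruct (Nat.le_gt_cases j l); [apply Hpos; [lia|easy]|].
    destruct (Nat.le_gt_cases i l).
    + pose proof (Hneg i l j ltac:(lia) Al). lra.
    + pose proof (Hpos l i j ltac:(lia) Ai). lra.
  - destruct (Nat.le_gt_cases i l).
    + pose proof (Hneg i l j ltac:(lia) Al). lra.
    + destruct (Nat.le_gt_cases i j).
      * pose proof (Hpos l i j ltac:(lia) Ai). lra.
      * pose proof (Hneg l j i ltac:(lia) Aj). lra.
  - pose proof (Hneg l j i ltac:(lia) Aj). lra.
Qed.

(* The distance to the line [p q] cannot have a strict local minimum at a vertex [m] of a clockwise
   convex polygon that has [p q] as an edge. *)
Lemma no_second_bump (p q m x z : R * R) :
  turn z m x <= 0 -> turn p z m <= 0 -> turn q m x <= 0 ->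
  turn p q m <= 0 -> turn p q z < turn p q m -> turn p q x < turn p q m -> False.
Proof.
  intros H1 H2 H3 H4 H5 H6.
  (* A polynomial identity between five points of the plane. Its left side is a product of two
     nonpositive numbers; its right side is negative, since it subtracts the product of two strictly
     negative differences and the other terms are nonpositive. *)
  assert (E : turn p q m * turn z m x
              = (turn p q z - turn p q m) * - turn q m x
                - (turn p q z - turn p q m) * (turn p q x - turn p q m)
                + (turn p q x - turn p q m) * - turn p z m).
  { unfold turn. destruct p, q, m, x, z; cbn [fst snd]. ring. }
  nra.
Qed.

Definition cross (u v : R * R) : R := fst u * snd v - fst v * snd u.

Definition minus (p q : R * R) : R * R := (fst p - fst q, snd p - snd q).

(** Measure distances to the line of the middle edge: they grow strictly along the first edge and
    shrink strictly along the third. Whichever of [px] and [qz] is nearer to the line is therefore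
    strictly nearer than both [qx] and [pz], and it is the forbidden second local minimum. *)
Lemma no_two_left_turns (px qx py qy pz qz : R * R) :
  turn qx pz qz <= 0 -> turn py pz qz <= 0 -> turn qx qy qz <= 0 -> turn py qy qz <= 0 ->
  turn px qx pz <= 0 -> turn px py pz <= 0 -> turn px qx qy <= 0 -> turn px py qy <= 0 ->
  0 < cross (minus qx px) (minus qy py) -> 0 < cross (minus qy py) (minus qz pz) -> False.
Proof.
  intros H1 H2 H3 H4 H5 H6 H7 H8 Hxy Hyz.
  assert (Ex : turn py qy qx < turn py qy px) by (unfold turn, cross, minus in *; cbn [fst snd] in *; nra).
  assert (Ez : turn py qy pz < turn py qy qz) by (unfold turn, cross, minus in *; cbn [fst snd] in *; nra).
  destruct (Rle_dec (turn py qy px) (turn py qy qz)) as [Hle|Hgt].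
  - apply (no_second_bump py qy qz qx pz); try lra.
    + rewrite <- turn_rot; lra.
    + rewrite <- turn_rot; lra.
  - apply (no_second_bump py qy px qx pz); try lra.
    + rewrite turn_rot; lra.
    + rewrite <- turn_rot; lra.
    + rewrite turn_rot; lra.
    + rewrite <- turn_rot; lra.
Qed.

(** * Optimal orders of strictly monotone functions *)

(* The order is governed by the polar angle of this vector: a nonpositive
   cross product for [x] and [y] says that applying [x] just before [y] is no worse than the converse. *)
Definition direction (a b : nat -> R) (x : nat) : R * R := (b x, a x - 1).

(** Edge [i] joins the vertices [i] and [S i]. When its function has positive slope, both ends lie
    on the same half of the polygon. Oriented clockwise, the edge follows time on the right half and
    goes against it on the left half; [source], [target] and [edge_rank] express this
    orientation. *)
Definition forward (a : nat -> R) (s : list nat) (i : nat) : bool :=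
  if Rlt_dec 0 (slope a (skipn (S i) s)) then true else false.

Definition edge_rank (a : nat -> R) (s : list nat) (i : nat) : nat :=
  if forward a s i then i else (2 * length s - i)%nat.

Definition source (a : nat -> R) (s : list nat) (i : nat) : nat :=
  if forward a s i then i else S i.

Definition target (a : nat -> R) (s : list nat) (i : nat) : nat :=
  if forward a s i then S i else i.

Lemma skipn_nth {T} (s : list T) i x :
  nth_error s i = Some x -> skipn i s = x :: skipn (S i) s.
Proof.
  revert i. induction s as [|y s IH]; intros [|i]; cbn; intros H; try discriminate.
  - congruence.
  - now apply IH.
Qed.

Lemma rank_edge a s i x :
  nth_error s i = Some x -> 0 < a x -> (forall i, slope a (skipn i s) <> 0) ->
  rank a s (source a s i) = edge_rank a s i /\ rank a s (target a s i) = S (edge_rank a s i).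
Proof.
  intros Hx Ha Hn.
  assert (Hi : (i < length s)%nat) by (apply nth_error_Some; congruence).
  pose proof (Hn (S i)) as Hn1.
  pose proof (skipn_nth s i x Hx) as E.
  assert (Es : slope a (skipn i s) = a x * slope a (skipn (S i) s)) by (rewrite E; reflexivity).
  unfold rank, edge_rank, source, target, forward.
  destruct (Rlt_dec 0 (slope a (skipn (S i) s))) as [Hp|Hp];
    repeat (match goal with |- context [Rlt_dec ?u ?v] => destruct (Rlt_dec u v) end);
    try nra; split; try lia; rewrite Es in *; nra.
Qed.

(** The oriented edge is [direction] turned by a right angle and scaled by a positive factor. Cross
    products of edges thus have the signs of those of directions, independently of the position in
    the order. *)
Lemma edge_vec a b s i x :
  nth_error s i = Some x ->
  minus (vertex a b s (target a s i)) (vertex a b s (source a s i))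
  = (- Rabs (slope a (skipn (S i) s)) * (a x - 1), Rabs (slope a (skipn (S i) s)) * b x).
Proof.
  intros Hx. pose proof (skipn_nth s i x Hx) as E.
  unfold minus, vertex, point, source, target, forward.
  destruct (Rlt_dec 0 (slope a (skipn (S i) s))) as [Hp|Hp].
  - rewrite Rabs_pos_eq by lra. rewrite E. cbn [fst snd const]. rewrite slope_cons. f_equal; ring.
  - rewrite Rabs_left1 by lra. rewrite E. cbn [fst snd const]. rewrite slope_cons. f_equal; ring.
Qed.

Lemma edge_cross a b s i j x y :
  nth_error s i = Some x -> nth_error s j = Some y ->
  (forall i, slope a (skipn i s) <> 0) -> 0 < cross (direction a b x) (direction a b y) ->
  0 < cross (minus (vertex a b s (target a s i)) (vertex a b s (source a s i)))
            (minus (vertex a b s (target a s j)) (vertex a b s (source a s j))).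
Proof.
  intros Hx Hy Hn Hc. rewrite (edge_vec _ _ _ _ _ Hx), (edge_vec _ _ _ _ _ Hy).
  pose proof (Rabs_pos_lt _ (Hn (S i))) as H1. pose proof (Rabs_pos_lt _ (Hn (S j))) as H2.
  set (u := Rabs _) in *. set (v := Rabs (slope a (skipn (S j) s))) in *.
  unfold cross, direction in *; cbn [fst snd] in *.
  replace (_ - _) with ((u * v) * (b x * (a y - 1) - b y * (a x - 1))) by ring.
  apply Rmult_lt_0_compat; [now apply Rmult_lt_0_compat|easy].
Qed.

(** Clockwise convexity is invariant under a cyclic shift of the three edges, so each of the three
    claims is an instance of [no_two_left_turns] with another edge in the middle. *)
Lemma minimal_edges a b n s i j l x y z :
  minimal a b n s -> (forall i, slope a (skipn i s) <> 0) ->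
  nth_error s i = Some x -> nth_error s j = Some y -> nth_error s l = Some z ->
  0 < a x -> 0 < a y -> 0 < a z ->
  (edge_rank a s i < edge_rank a s j < edge_rank a s l)%nat ->
  ~ (0 < cross (direction a b x) (direction a b y) /\ 0 < cross (direction a b y) (direction a b z)) /\
  ~ (0 < cross (direction a b y) (direction a b z) /\ 0 < cross (direction a b z) (direction a b x)) /\
  ~ (0 < cross (direction a b z) (direction a b x) /\ 0 < cross (direction a b x) (direction a b y)).
Proof.
  intros Hm Hn Hx Hy Hz Px Py Pz Ho.
  destruct (rank_edge a s i x Hx Px Hn) as [Si Ti].
  destruct (rank_edge a s j y Hy Py Hn) as [Sj Tj].
  destruct (rank_edge a s l z Hz Pz Hn) as [Sl Tl].
  assert (Bi : forall i x, nth_error s i = Some x ->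
             (source a s i <= length s)%nat /\ (target a s i <= length s)%nat).
  { intros i' x' Hi. assert (i' < length s)%nat by (apply nth_error_Some; congruence).
    unfold source, target. destruct (forward a s i'); lia. }
  destruct (Bi _ _ Hx) as [Bi1 Bi2]. destruct (Bi _ _ Hy) as [Bj1 Bj2].
  destruct (Bi _ _ Hz) as [Bl1 Bl2]. clear Bi.
  assert (T : forall i j l, (i <= length s)%nat -> (j <= length s)%nat -> (l <= length s)%nat ->
     (rank a s i <= rank a s j <= rank a s l)%nat ->
     turn (vertex a b s i) (vertex a b s j) (vertex a b s l) <= 0)
    by (intros; now apply rank_turn with (n := n)).
  assert (T' : forall i j l, (i <= length s)%nat -> (j <= length s)%nat -> (l <= length s)%nat ->
     (rank a s j <= rank a s l <= rank a s i)%nat ->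
     turn (vertex a b s i) (vertex a b s j) (vertex a b s l) <= 0)
    by (intros; rewrite turn_rot; now apply T).
  assert (T'' : forall i j l, (i <= length s)%nat -> (j <= length s)%nat -> (l <= length s)%nat ->
     (rank a s l <= rank a s i <= rank a s j)%nat ->
     turn (vertex a b s i) (vertex a b s j) (vertex a b s l) <= 0)
    by (intros; rewrite turn_rot; now apply T').
  split; [|split]; intros [C1 C2];
    [ pose proof (edge_cross _ _ _ _ _ _ _ Hx Hy Hn C1) as D1;
      pose proof (edge_cross _ _ _ _ _ _ _ Hy Hz Hn C2) as D2
    | pose proof (edge_cross _ _ _ _ _ _ _ Hy Hz Hn C1) as D1;
      pose proof (edge_cross _ _ _ _ _ _ _ Hz Hx Hn C2) as D2
    | pose proof (edge_cross _ _ _ _ _ _ _ Hz Hx Hn C1) as D1;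
      pose proof (edge_cross _ _ _ _ _ _ _ Hx Hy Hn C2) as D2 ];
    refine (no_two_left_turns _ _ _ _ _ _ _ _ _ _ _ _ _ _ D1 D2);
    first [apply T; lia|apply T'; lia|apply T''; lia].
Qed.

(** * Peeling a rotation from both ends *)

Inductive peels (dec : nat -> bool) : list nat -> list nat -> Prop :=
| peels_nil : peels dec [] []
| peels_dec l x s : dec x = true -> peels dec l s -> peels dec l (x :: s)
| peels_front l x s : dec x = false -> peels dec l s -> peels dec (x :: l) (x :: s)
| peels_back l x s : dec x = false -> peels dec l s -> peels dec (l ++ [x]) (x :: s).

(* The edges of the convex polygon in clockwise order. *)
Fixpoint clockwise (dec : nat -> bool) (a : nat -> R) (s : list nat) : list nat :=
  match s with
  | [] => []
  | x :: t => if dec x then clockwise dec a t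
              else if Rlt_dec 0 (slope a t) then x :: clockwise dec a t
              else clockwise dec a t ++ [x]
  end.

Lemma clockwise_peels dec a s : peels dec (clockwise dec a s) s.
Proof.
  induction s as [|x s IH]; cbn; [constructor|].
  destruct (dec x) eqn:E; [|destruct (Rlt_dec 0 (slope a s))]; now constructor.
Qed.

Lemma peels_perm dec l s : peels dec l s -> Permutation l (filter (fun x => negb (dec x)) s).
Proof.
  induction 1 as [|l x s E _ IH|l x s E _ IH|l x s E _ IH]; cbn; rewrite ?E; cbn; auto.
  rewrite Permutation_app_comm. cbn. auto.
Qed.

Fixpoint index (x : nat) (s : list nat) : nat :=
  match s with
  | [] => O
  | y :: t => if Nat.eqb x y then O else S (index x t)
  end.

Lemma nth_error_index x s : In x s -> nth_error s (index x s) = Some x.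
Proof.
  induction s as [|y s IH]; cbn; [easy|].
  destruct (Nat.eqb_spec x y) as [->|Hn]; [reflexivity|].
  intros [->|H]; [congruence|]. now apply IH.
Qed.

Lemma index_app_notin x p s : ~ In x p -> index x (p ++ s) = (length p + index x s)%nat.
Proof.
  induction p as [|y p IH]; cbn; [easy|]. intros H.
  destruct (Nat.eqb_spec x y) as [->|Hn]; [exfalso; auto|].
  rewrite IH; auto.
Qed.

Lemma index_lt x s : In x s -> (index x s < length s)%nat.
Proof. intros H. apply nth_error_Some. now rewrite (nth_error_index _ _ H). Qed.

(** The edge of the head [x] of [s] has rank [length p] or [2 * length (p ++ s) - length p], and all
    later edges have ranks strictly in between. Hence [x] belongs at one end of the list, as
    [clockwise] places it. The prefix [p] is carried along because ranks refer to the whole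
    order. *)
Lemma clockwise_sorted dec a s p :
  NoDup (p ++ s) ->
  StronglySorted (fun x y => edge_rank a (p ++ s) (index x (p ++ s))
                             < edge_rank a (p ++ s) (index y (p ++ s)))%nat
                 (clockwise dec a s).
Proof.
  revert p. induction s as [|x s IH]; intros p Hd; cbn; [constructor|].
  specialize (IH (p ++ [x])). rewrite <- app_assoc in IH. cbn in IH. specialize (IH Hd).
  destruct (dec x) eqn:E; [easy|].
  assert (Hx : ~ In x p).
  { apply NoDup_remove_2 in Hd. rewrite in_app_iff in Hd. auto. }
  assert (Ix : index x (p ++ x :: s) = length p).
  { rewrite index_app_notin by easy. cbn. rewrite Nat.eqb_refl. lia. }
  assert (Iy : forall y, In y (clockwise dec a s) ->
     (length p < edge_rank a (p ++ x :: s) (index y (p ++ x :: s))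
      < 2 * length (p ++ x :: s) - length p)%nat).
  { intros y Hy.
    apply (Permutation_in _ (peels_perm _ _ _ (clockwise_peels dec a s))) in Hy.
    apply filter_In in Hy. destruct Hy as [Hy _].
    assert (Hyp : ~ In y (p ++ [x])).
    { intros Hin. change (x :: s) with ([x] ++ s) in Hd. rewrite app_assoc in Hd.
      revert Hin Hy. clear -Hd. induction (p ++ [x]) as [|z l IHl]; cbn; [easy|].
      inversion Hd as [|? ? Hz Hd' Eq]; subst. intros [->|Hin] Hy; [|now apply IHl].
      apply Hz. apply in_or_app. now right. }
    assert (In y (p ++ x :: s)) as Hin by (apply in_or_app; cbn; auto).
    pose proof (index_lt _ _ Hin) as Hlt.
    change (x :: s) with ([x] ++ s) in *. rewrite app_assoc in *.
    rewrite (index_app_notin y (p ++ [x])) in * by easy.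
    rewrite !length_app in *. cbn in *. unfold edge_rank. rewrite !length_app. cbn.
    destruct (forward _ _ _); lia. }
  assert (Sx : skipn (S (length p)) (p ++ x :: s) = s).
  { change (x :: s) with ([x] ++ s). rewrite app_assoc.
    replace (S (length p)) with (length (p ++ [x])) by (rewrite length_app; cbn; lia).
    now rewrite skipn_app, skipn_all, Nat.sub_diag. }
  assert (Rx : edge_rank a (p ++ x :: s) (index x (p ++ x :: s))
     = if Rlt_dec 0 (slope a s) then length p else (2 * length (p ++ x :: s) - length p)%nat).
  { rewrite Ix. unfold edge_rank, forward. rewrite Sx. now destruct (Rlt_dec 0 (slope a s)). }
  destruct (Rlt_dec 0 (slope a s)) as [Hp|Hp].
  - constructor; [easy|]. apply Forall_forall. intros y Hy. rewrite Rx. now apply Iy.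
  - clear -IH Rx Iy. induction (clockwise dec a s) as [|y l IHl]; cbn; [repeat constructor|].
    inversion IH as [|? ? H1 H2]; subst. constructor; [apply IHl; auto; intros; apply Iy; now right|].
    apply Forall_app. split; [easy|]. constructor; [|constructor]. rewrite Rx.
    apply Iy. now left.
Qed.

Lemma sorted_perm_unique {T} (f : T -> R) (l l' : list T) :
  StronglySorted (fun x y => f x < f y) l -> StronglySorted (fun x y => f x < f y) l' ->
  Permutation l l' -> l = l'.
Proof.
  revert l'. induction l as [|x l IH]; intros l' Hl Hl' Hp.
  - now apply Permutation_nil in Hp.
  - destruct l' as [|y l']; [now apply Permutation_sym, Permutation_nil in Hp|].
    inversion Hl as [|? ? Hs Hf]; inversion Hl' as [|? ? Hs' Hf']; subst.
    rewrite Forall_forall in Hf, Hf'.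
    assert (x = y) as ->.
    { assert (Hx : In x (y :: l')) by (apply (Permutation_in _ Hp); now left).
      assert (Hy : In y (x :: l)) by (apply (Permutation_in _ (Permutation_sym Hp)); now left).
      destruct Hx as [|Hx], Hy as [|Hy]; auto. apply Hf in Hy. apply Hf' in Hx. lra. }
    f_equal. apply IH; auto. now apply Permutation_cons_inv in Hp.
Qed.

Definition anticyclic (f : nat -> R) (x y z : nat) : Prop :=
  f x < f z < f y \/ f z < f y < f x \/ f y < f x < f z.

Lemma sorted_app_inv {T} (P : T -> T -> Prop) l1 l2 :
  StronglySorted P (l1 ++ l2) ->
  StronglySorted P l1 /\ StronglySorted P l2 /\ forall x y, In x l1 -> In y l2 -> P x y.
Proof.
  induction l1 as [|x l1 IH]; cbn; intros H.
  - split; [constructor|split; [easy|easy]].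
  - inversion H as [|? ? Hs Hf]; subst. destruct (IH Hs) as (S1 & S2 & S3).
    apply Forall_app in Hf. destruct Hf as [F1 F2]. split; [now constructor|split; [easy|]].
    intros y z [<-|Hy] Hz; [|auto]. rewrite Forall_forall in F2. auto.
Qed.

Lemma sorted_app {T} (P : T -> T -> Prop) l1 l2 :
  StronglySorted P l1 -> StronglySorted P l2 -> (forall x y, In x l1 -> In y l2 -> P x y) ->
  StronglySorted P (l1 ++ l2).
Proof.
  induction 1 as [|x l1 Hs IH Hf]; cbn; intros H2 H; [easy|].
  constructor; [apply IH; auto|]. apply Forall_app. split; [easy|].
  apply Forall_forall. auto.
Qed.

Lemma sorted_mono {T} (P Q : T -> T -> Prop) l :
  (forall x y, In x l -> In y l -> P x y -> Q x y) -> StronglySorted P l -> StronglySorted Q l.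
Proof.
  intros H Hs. induction Hs as [|x l Hs IH Hf]; constructor.
  - apply IH. intros; apply H; auto; now right.
  - rewrite Forall_forall in *. intros y Hy. apply H; [now left|now right|auto].
Qed.

(** Cut [l] at the element [m] of least [f], as [l1 ++ m :: l2]. Two elements of [l2 ++ l1] in the
    wrong order of [f] would form, together with [m], a triple in reverse cyclic order. So
    [m :: l2 ++ l1] is sorted and equals [o]. *)
Lemma cyclic_rotation (f : nat -> R) (g : nat -> nat) (l o : list nat) :
  Permutation l o -> StronglySorted (fun x y => f x < f y) o ->
  StronglySorted (fun x y => g x < g y)%nat l ->
  (forall x y z, In x l -> In y l -> In z l -> (g x < g y < g z)%nat -> ~ anticyclic f x y z) ->
  exists r, (r <= length o)%nat /\ l = skipn r o ++ firstn r o.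
Proof.
  intros Hp Ho Hl Hc. destruct o as [|m o].
  { exists O. apply Permutation_sym, Permutation_nil in Hp. now subst. }
  assert (Hm : In m l) by (apply (Permutation_in _ (Permutation_sym Hp)); now left).
  apply in_split in Hm. destruct Hm as (l1 & l2 & ->).
  assert (Hp' : Permutation (l2 ++ l1) o).
  { apply Permutation_cons_inv with (a := m). rewrite <- Hp.
    rewrite (Permutation_app_comm l1). reflexivity. }
  inversion Ho as [|? ? Hs Hf]; subst. rewrite Forall_forall in Hf.
  destruct (sorted_app_inv _ _ _ Hl) as (S1 & S2 & S12).
  inversion S2 as [|? ? S3 F3]; subst. rewrite Forall_forall in F3.
  assert (Fm : forall y, In y (l2 ++ l1) -> f m < f y)
    by (intros y Hy; apply Hf; now apply (Permutation_in _ Hp')).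
  assert (Hinj : forall x y, In x (m :: o) -> In y (m :: o) -> f x = f y -> x = y).
  { clear -Ho. induction Ho as [|x l Hs IH Hf]; [easy|]. rewrite Forall_forall in Hf.
    intros y z [<-|Hy] [<-|Hz] E; auto.
    - apply Hf in Hz. lra.
    - apply Hf in Hy. lra. }
  assert (In1 : forall y, In y l1 -> In y (l1 ++ m :: l2)) by (intros; apply in_or_app; auto).
  assert (In2 : forall y, In y l2 -> In y (l1 ++ m :: l2)) by (intros; apply in_or_app; cbn; auto).
  assert (Inm : In m (l1 ++ m :: l2)) by (apply in_or_app; cbn; auto).
  assert (Tri : forall y z, In y (l1 ++ m :: l2) -> In z (l1 ++ m :: l2) -> y <> z ->
             ~ (f z < f y) -> f y < f z).
  { intros y z Hy Hz Hn H. destruct (Rle_lt_or_eq_dec (f y) (f z)) as [|E]; [lra|easy|].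
    exfalso. apply Hn. apply Hinj; auto; now apply (Permutation_in _ Hp). }
  assert (Eq : l2 ++ l1 = o).
  { apply (sorted_perm_unique f); auto. apply sorted_app.
    - apply (sorted_mono _ (fun y z => f y < f z)) in S3; [easy|].
      intros y z Hy Hz Hg. apply Tri; auto; [intros ->; lia|]. intros Hlt.
      apply (Hc m y z); auto. left. split; [|easy]. apply Fm, in_or_app; auto.
    - apply (sorted_mono _ (fun y z => f y < f z)) in S1; [easy|].
      intros y z Hy Hz Hg. apply Tri; auto; [intros ->; lia|]. intros Hlt.
      apply (Hc y z m); auto; [split; [easy|apply S12; cbn; auto]|].
      right; left. split; [|easy]. apply Fm, in_or_app; auto.
    - intros y z Hy Hz. assert (Hg : (g z < g m < g y)%nat)
        by (split; [apply S12; cbn; auto|auto]).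
      apply Tri; auto; [intros ->; lia|]. intros Hlt.
      apply (Hc z m y); auto. right; right. split; [|easy]. apply Fm, in_or_app; auto. }
  exists (S (length l2)). rewrite <- Eq. cbn. rewrite length_app. split; [lia|].
  rewrite skipn_app, firstn_app, skipn_all, firstn_all, Nat.sub_diag. cbn.
  now rewrite app_nil_r.
Qed.

(** For three distinct directions met in this order during one clockwise turn, at most one of the
    three cyclic gaps reaches a half turn. The other two give negative cross products. *)
Definition clockwise_triple (a b : nat -> R) (x y z : nat) : Prop :=
  let c (u v : nat) := cross (direction a b u) (direction a b v) in
  (c x y < 0 /\ c y z < 0) \/ (c y z < 0 /\ c z x < 0) \/ (c z x < 0 /\ c x y < 0).

Lemma cross_opp (u v : R * R) : cross u v = - cross v u.
Proof. unfold cross. ring. Qed.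

(** If three edges in clockwise order had their angles in reverse cyclic order, then
    [clockwise_triple] for the reversed triple, with the cross products negated, would give two left
    turns on the polygon, against [minimal_edges]. So [cyclic_rotation] applies to the ranks of the
    edges and the angles [f]. *)
Lemma minimal_peels_rotation a b n (dec : nat -> bool) s f o :
  minimal a b n s ->
  (forall x, (x < n)%nat -> if dec x then a x < 0 else 0 < a x) ->
  Permutation o (filter (fun x => negb (dec x)) (seq 0 n)) ->
  StronglySorted (fun x y => f x < f y) o ->
  (forall x y z, In x o -> In y o -> In z o -> f x < f y < f z -> clockwise_triple a b x y z) ->
  exists r, (r <= length o)%nat /\ peels dec (skipn r o ++ firstn r o) s.
Proof.
  intros Hm Ha Hp Ho Hc. destruct (Hm) as [Hs _]. unfold is_perm in Hs.
  assert (Hd : NoDup s) by (apply (Permutation_NoDup Hs), seq_NoDup).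
  assert (Hlt : forall x, In x s -> (x < n)%nat).
  { intros x Hx. apply (Permutation_in _ (Permutation_sym Hs)), in_seq in Hx. lia. }
  assert (Hnz : forall i, slope a (skipn i s) <> 0).
  { intros i. assert (Hi : forall x, In x (skipn i s) -> In x s).
    { intros x Hx. rewrite <- (firstn_skipn i s). apply in_or_app. now right. }
    induction (skipn i s) as [|x t IH]; [cbn; lra|]. rewrite slope_cons.
    apply Rmult_integral_contrapositive_currified.
    - specialize (Ha x (Hlt x (Hi x (or_introl eq_refl)))). destruct (dec x); lra.
    - apply IH. intros y Hy. apply Hi. now right. }
  assert (Hpc : Permutation (clockwise dec a s) o).
  { rewrite (peels_perm _ _ _ (clockwise_peels dec a s)), Hp.
    clear -Hs. symmetry. induction Hs; cbn; auto.
    - destruct (dec x); cbn; auto.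
    - destruct (dec x), (dec y); cbn; auto. constructor.
    - now rewrite IHHs1. }
  pose proof (clockwise_sorted dec a s [] Hd) as Hcs. cbn [app] in Hcs.
  destruct (cyclic_rotation f _ _ _ Hpc Ho Hcs) as (r & Hr & Er).
  - intros x y z Hx Hy Hz Hg Han.
    assert (Hin : forall x, In x (clockwise dec a s) ->
               In x s /\ 0 < a x /\ In x o).
    { intros w Hw. pose proof (Permutation_in _ Hpc Hw) as Hwo.
      apply (Permutation_in _ (peels_perm _ _ _ (clockwise_peels dec a s))), filter_In in Hw.
      destruct Hw as [Hw Hwd]. split; [easy|split; [|easy]].
      specialize (Ha w (Hlt w Hw)). now destruct (dec w). }
    destruct (Hin x Hx) as (Ix & Ax & Ox). destruct (Hin y Hy) as (Iy & Ay & Oy).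
    destruct (Hin z Hz) as (Iz & Az & Oz).
    destruct (minimal_edges a b n s _ _ _ x y z Hm Hnz (nth_error_index _ _ Ix)
                (nth_error_index _ _ Iy) (nth_error_index _ _ Iz) Ax Ay Az Hg) as (N1 & N2 & N3).
    assert (Hct : clockwise_triple a b x z y).
    { destruct Han as [H|[H|H]].
      - now apply Hc.
      - pose proof (Hc z y x Oz Oy Ox H) as T. unfold clockwise_triple in *. tauto.
      - pose proof (Hc y x z Oy Ox Oz H) as T. unfold clockwise_triple in *. tauto. }
    unfold clockwise_triple in Hct.
    rewrite (cross_opp (direction a b x) (direction a b z)), (cross_opp (direction a b z) (direction a b y)),
      (cross_opp (direction a b y) (direction a b x)) in Hct.
    destruct Hct as [[? ?]|[[? ?]|[? ?]]]; [apply N2|apply N1|apply N3]; split; lra.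
  - exists r. split; [easy|]. rewrite <- Er. apply clockwise_peels.
Qed.

(** * Removing the degeneracies by perturbation *)

(* Increases from -1 to 3 along a clockwise turn starting at (-1, 0).
   The zero vector gets 0 since [0 / 0 = 0]: it is treated as pointing to (0, 1). *)
Definition pseudo_angle (u v : R) : R :=
  if Rle_dec 0 v then u / (Rabs u + Rabs v) else 2 - u / (Rabs u + Rabs v).

(** The inverse of [pseudo_angle]: it runs clockwise along the unit circle of the norm
    [Rabs u + Rabs v], through (-1, 0), (0, 1), (1, 0), (0, -1) at -1, 0, 1, 2. A half turn measures
    2 and a full turn 4. Absolute values, rather than cases, make continuity immediate. *)
Definition ray (k : R) : R * R := (1 - Rabs (k - 1), k - Rabs k + Rabs (k - 2) - 1).

Lemma Rabs_zero_eq u : Rabs u = 0 -> u = 0.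
Proof. intros H. destruct (Req_dec u 0) as [|Hn]; [easy|]. pose proof (Rabs_pos_lt u Hn). lra. Qed.

Lemma quotient_bounds u v : 0 < Rabs u + Rabs v ->
  exists q, u / (Rabs u + Rabs v) = q /\ u = q * (Rabs u + Rabs v) /\ -1 <= q <= 1 /\
            Rabs v = (1 - Rabs q) * (Rabs u + Rabs v).
Proof.
  intros Hs. set (s := Rabs u + Rabs v) in *. exists (u / s).
  assert (E : u = u / s * s) by (field; lra).
  pose proof (Rabs_pos v) as Hv.
  assert (Hu : Rabs u = Rabs (u / s) * s).
  { rewrite E at 1. rewrite Rabs_mult, (Rabs_pos_eq s) by lra. reflexivity. }
  split; [reflexivity|split; [exact E|]]. set (q := u / s) in *.
  assert (Hq : Rabs q <= 1) by (unfold s in *; nra).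
  split; [|unfold s in *; nra]. unfold Rabs in Hq. destruct (Rcase_abs q); lra.
Qed.

Lemma pseudo_angle_range u v : -1 <= pseudo_angle u v < 3.
Proof.
  pose proof (Rabs_pos u). pose proof (Rabs_pos v). unfold pseudo_angle.
  destruct (Rle_lt_or_eq_dec 0 (Rabs u + Rabs v)) as [Hs|Hs]; [lra| |].
  - destruct (quotient_bounds u v Hs) as (q & -> & E & Hq & Ev).
    destruct (Rle_dec 0 v) as [Hv|Hv]; [lra|]. split; [lra|].
    assert (q <> -1); [|lra]. intros ->. rewrite (Rabs_left1 (-1)) in Ev by lra.
    pose proof (Rabs_pos_lt v). lra.
  - assert (u = 0) as -> by (apply Rabs_zero_eq; lra).
    replace (0 / (Rabs 0 + Rabs v)) with 0 by (unfold Rdiv; ring).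
    assert (v = 0) as -> by (apply Rabs_zero_eq; lra).
    destruct (Rle_dec 0 0); lra.
Qed.

(** A polar decomposition for the norm [Rabs u + Rabs v]. It also holds for the zero vector, whose
    length is 0. *)
Lemma pseudo_angle_ray u v :
  (Rabs u + Rabs v) * fst (ray (pseudo_angle u v)) = u /\
  (Rabs u + Rabs v) * snd (ray (pseudo_angle u v)) = v.
Proof.
  pose proof (Rabs_pos u). pose proof (Rabs_pos v).
  destruct (Rle_lt_or_eq_dec 0 (Rabs u + Rabs v)) as [Hs|Hs]; [lra| |].
  - unfold pseudo_angle. destruct (quotient_bounds u v Hs) as (q & -> & E & Hq & Ev).
    set (s := Rabs u + Rabs v) in *. unfold ray; cbn [fst snd].
    destruct (Rle_dec 0 v) as [Hv|Hv].
    + rewrite (Rabs_left1 (q - 1)), (Rabs_left1 (q - 2)) by lra.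
      rewrite (Rabs_pos_eq v) in Ev by lra. split; lra.
    + rewrite (Rabs_pos_eq (2 - q - 1)), (Rabs_pos_eq (2 - q)) by lra.
      replace (2 - q - 2) with (- q) by ring. rewrite Rabs_Ropp.
      rewrite (Rabs_left1 v) in Ev by lra. split; lra.
  - rewrite <- Hs. assert (u = 0) as -> by (apply Rabs_zero_eq; lra).
    assert (v = 0) as -> by (apply Rabs_zero_eq; lra). split; ring.
Qed.

(** In both cases the clockwise gap from [k] to [l], namely [l - k] or [l - k + 4], lies strictly
    between 0 and a half turn. On each pair of quadrants the cross product is a quadratic
    polynomial, and the positive products in [Hd] express the condition on the gap. *)
Lemma ray_cross k l : -1 <= k < 3 -> -1 <= l < 3 ->
  0 < l - k < 2 \/ l - k < -2 -> cross (ray k) (ray l) < 0.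
Proof.
  intros Hk Hl H. unfold cross, ray; cbn [fst snd].
  assert (Hd : 0 < (l - k) * (2 - (l - k)) \/ 0 < (l - k + 4) * (- 2 - (l - k)))
    by (destruct H; [left|right]; apply Rmult_lt_0_compat; lra).
  pose proof (Rle_0_sqr (k + l)) as S0. pose proof (Rle_0_sqr (k + l - 2)) as S2.
  pose proof (Rle_0_sqr (k + l - 4)) as S4. unfold Rsqr in *.
  destruct (Rle_dec k 0), (Rle_dec k 1), (Rle_dec k 2), (Rle_dec l 0), (Rle_dec l 1), (Rle_dec l 2);
    try lra;
    repeat match goal with |- context [Rabs ?x] =>
      first [rewrite (Rabs_left1 x) by lra | rewrite (Rabs_pos_eq x) by lra] end;
    destruct H, Hd; try lra; nra.
Qed.

(** A crude Lipschitz bound: each of the three terms in [k] moves by at most [d]. *)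
Lemma ray_snd_lower k d : 0 <= d -> snd (ray k) - 3 * d <= snd (ray (k + d)).
Proof.
  intros Hd. unfold ray; cbn [snd]. unfold Rabs.
  repeat match goal with |- context [Rcase_abs ?x] => destruct (Rcase_abs x) end; lra.
Qed.

Lemma ray_snd_ge k : -1 <= k -> -1 <= snd (ray k).
Proof.
  intros H. unfold ray; cbn [snd]. unfold Rabs.
  repeat match goal with |- context [Rcase_abs ?x] => destruct (Rcase_abs x) end; lra.
Qed.

(** Three perturbations at once. The term with [index] separates equal angles in accordance with
    [o]; the summand [e * e] of [shifted_length] gives a length to zero vectors; the factor [1 - e]
    pulls every slope towards 1, which makes zero slopes positive. The first two are of second order
    in [e], lest they undo the gain of the third, which is of first order. *)
Definition shifted_angle (a b : nat -> R) (o : list nat) (e : R) (x : nat) : R :=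
  pseudo_angle (b x) (a x - 1) + e * e * INR (index x o).

Definition shifted_length (a b : nat -> R) (e : R) (x : nat) : R :=
  (1 - e) * (Rabs (b x) + Rabs (a x - 1)) + e * e.

Definition shift_a (dec : nat -> bool) (a b : nat -> R) (o : list nat) (e : R) (x : nat) : R :=
  if dec x then a x
  else 1 + shifted_length a b e x * snd (ray (shifted_angle a b o e x)).

Definition shift_b (dec : nat -> bool) (a b : nat -> R) (o : list nat) (e : R) (x : nat) : R :=
  if dec x then b x
  else shifted_length a b e x * fst (ray (shifted_angle a b o e x)).

Definition near_zero (P : R -> Prop) : Prop := exists d, 0 < d /\ forall e, 0 < e < d -> P e.

Lemma near_zero_and P Q : near_zero P -> near_zero Q -> near_zero (fun e => P e /\ Q e).
Proof.
  intros (d & Hd & H) (d' & Hd' & H'). exists (Rmin d d'). split; [now apply Rmin_glb_lt|].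
  intros e He. pose proof (Rmin_l d d'). pose proof (Rmin_r d d').
  split; [apply H|apply H']; lra.
Qed.

Lemma near_zero_all {T} (P : T -> R -> Prop) (l : list T) :
  (forall x, In x l -> near_zero (P x)) -> near_zero (fun e => forall x, In x l -> P x e).
Proof.
  induction l as [|x l IH]; intros H.
  - exists 1. split; [lra|easy].
  - destruct (near_zero_and _ _ (H x (or_introl eq_refl)) (IH (fun y Hy => H y (or_intror Hy))))
      as (d & Hd & Hp).
    exists d. split; [easy|]. intros e He. destruct (Hp e He) as [H1 H2].
    intros y [<-|Hy]; auto.
Qed.

Lemma near_zero_small c : 0 < c -> near_zero (fun e => e < c).
Proof. intros H. exists c. split; [easy|]. intros e He. lra. Qed.

(** For [a x >= 0] the factor [1 - e] alone leaves [1 + (1 - e) * (a x - 1) >= e], and the other two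
    perturbations lower this by at most a multiple of [e * e]. *)
Lemma shift_a_pos dec a b o x :
  dec x = false -> 0 <= a x -> near_zero (fun e => 0 < shift_a dec a b o e x).
Proof.
  intros Hd Ha. set (s := Rabs (b x) + Rabs (a x - 1)).
  assert (Hs : 0 <= s) by (pose proof (Rabs_pos (b x)); pose proof (Rabs_pos (a x - 1)); unfold s; lra).
  set (i := INR (index x o)). assert (Hi : 0 <= i) by apply pos_INR.
  (* [3 * s * i] bounds the loss due to the shift of the angle, by [ray_snd_lower]; the 1 bounds the
     loss due to the additional length, by [ray_snd_ge]. *)
  set (c := 3 * s * i + 1). assert (Hc : 1 <= c) by (unfold c; nra).
  destruct (near_zero_and _ _ (near_zero_small 1 ltac:(lra)) (near_zero_small (/ c) ltac:(apply Rinv_0_lt_compat; lra)))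
    as (d & Hd' & H).
  exists d. split; [easy|]. intros e He. destruct (H e He) as [H1 H2].
  unfold shift_a. rewrite Hd. unfold shifted_length, shifted_angle. fold s i.
  pose proof (pseudo_angle_range (b x) (a x - 1)) as Hr.
  destruct (pseudo_angle_ray (b x) (a x - 1)) as [_ Ev]. fold s in Ev.
  set (k := pseudo_angle _ _) in *.
  assert (Hei : 0 <= e * e * i) by nra.
  pose proof (ray_snd_lower k (e * e * i) Hei) as L1.
  pose proof (ray_snd_ge (k + e * e * i) ltac:(lra)) as L2.
  set (w := snd (ray (k + e * e * i))) in *. set (w0 := snd (ray k)) in *.
  assert (L3 : (1 - e) * s * w >= (1 - e) * (a x - 1) - (1 - e) * s * (3 * (e * e * i))).
  { assert ((1 - e) * s * w >= (1 - e) * s * (w0 - 3 * (e * e * i))); [|nra].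
    apply Rle_ge, Rmult_le_compat_l; [nra|lra]. }
  assert (L4 : (1 - e) * s * (3 * (e * e * i)) <= 3 * s * i * (e * e)).
  { assert (0 <= s * (e * e * i)) by (apply Rmult_le_pos; lra).
    assert (0 <= e * (s * (e * e * i))) by (apply Rmult_le_pos; lra). lra. }
  assert (L5 : e * c < 1).
  { apply Rmult_lt_compat_r with (r := c) in H2; [|lra]. rewrite Rinv_l in H2; lra. }
  assert (L6 : e * e * c < e) by nra.
  unfold c in L6. nra.
Qed.

Lemma continuity_pt_const_list (f g : R -> nat -> R) (s : list nat) :
  (forall x, continuity_pt (fun e => f e x) 0) -> (forall x, continuity_pt (fun e => g e x) 0) ->
  continuity_pt (fun e => slope (f e) s) 0 /\ continuity_pt (fun e => const (f e) (g e) s) 0.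
Proof.
  intros Hf Hg. induction s as [|x s [IH1 IH2]].
  - split; apply continuity_pt_const; intros ? ?; reflexivity.
  - split.
    + exact (continuity_pt_mult (fun e => f e x) (fun e => slope (f e) s) 0 (Hf x) IH1).
    + exact (continuity_pt_plus (fun e => slope (f e) s * g e x) (fun e => const (f e) (g e) s) 0
        (continuity_pt_mult (fun e => slope (f e) s) (fun e => g e x) 0 IH1 (Hg x)) IH2).
Qed.

Lemma continuity_pt_near (h : R -> R) d :
  0 < d -> continuity_pt h 0 -> near_zero (fun e => Rabs (h e - h 0) < d).
Proof.
  intros Hd Hc. destruct (Hc d Hd) as (r & Hr & H). exists r. split; [easy|].
  intros e He. apply (H e). split; [split; [exact I|lra]|].
  cbn. unfold Rdist. rewrite Rabs_pos_eq; lra.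
Qed.

Lemma shift_continuous dec a b o x :
  continuity_pt (fun e => shift_a dec a b o e x) 0 /\ continuity_pt (fun e => shift_b dec a b o e x) 0.
Proof.
  unfold shift_a, shift_b. destruct (dec x);
    [split; apply continuity_pt_const; intros ? ?; reflexivity|].
  unfold shifted_length, shifted_angle, ray; cbn [fst snd].
  set (k := pseudo_angle _ _). set (i := INR _). set (s := Rabs _ + _).
  assert (C : forall c, continuity_pt (fun e => Rabs (k + e * e * i - c)) 0).
  { intros c. apply (continuity_pt_comp (fun e => k + e * e * i - c) Rabs).
    - reg.
    - apply Rcontinuity_abs. }
  assert (C0 : continuity_pt (fun e => Rabs (k + e * e * i)) 0).
  { apply (continuity_pt_comp (fun e => k + e * e * i) Rabs); [reg|apply Rcontinuity_abs]. }
  assert (K : forall c, continuity_pt (fun _ : R => c) 0)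
    by (intros c; apply continuity_pt_const; intros ? ?; reflexivity).
  assert (L : continuity_pt (fun e => (1 - e) * s + e * e) 0) by reg.
  assert (A : continuity_pt (fun e => k + e * e * i) 0) by reg.
  split.
  - apply (continuity_pt_plus (fun _ => 1) (fun e => ((1 - e) * s + e * e) *
       (k + e * e * i - Rabs (k + e * e * i) + Rabs (k + e * e * i - 2) - 1))); [easy|].
    apply (continuity_pt_mult (fun e => (1 - e) * s + e * e)); [easy|].
    apply (continuity_pt_minus (fun e => k + e * e * i - Rabs (k + e * e * i) + Rabs (k + e * e * i - 2))); [|easy].
    apply (continuity_pt_plus (fun e => k + e * e * i - Rabs (k + e * e * i))); [|apply C].
    now apply (continuity_pt_minus (fun e => k + e * e * i)).
  - apply (continuity_pt_mult (fun e => (1 - e) * s + e * e)); [easy|].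
    apply (continuity_pt_minus (fun _ => 1)); [easy|apply C].
Qed.

Lemma shift_zero dec a b o x :
  shift_a dec a b o 0 x = a x /\ shift_b dec a b o 0 x = b x.
Proof.
  unfold shift_a, shift_b, shifted_length, shifted_angle.
  destruct (pseudo_angle_ray (b x) (a x - 1)) as [E1 E2].
  replace (pseudo_angle (b x) (a x - 1) + 0 * 0 * INR (index x o))
    with (pseudo_angle (b x) (a x - 1)) by ring.
  destruct (dec x); [easy|]. split; lra.
Qed.

Lemma const_ext_in a b a' b' s :
  (forall x, In x s -> a x = a' x /\ b x = b' x) ->
  slope a s = slope a' s /\ const a b s = const a' b' s.
Proof.
  induction s as [|x s IH]; intros H; [easy|].
  destruct (H x (or_introl eq_refl)) as [Ha Hb].
  destruct (IH (fun y Hy => H y (or_intror Hy))) as [IH1 IH2].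
  cbn [const]. rewrite !slope_cons, Ha, Hb, IH1, IH2. easy.
Qed.

Lemma shifted_triple dec a b o e x y z :
  0 < e < 1 -> dec x = false -> dec y = false -> dec z = false ->
  let f := shifted_angle a b o e in
  f x < 3 -> f y < 3 -> f z < 3 -> f x < f y < f z ->
  clockwise_triple (shift_a dec a b o e) (shift_b dec a b o e) x y z.
Proof.
  intros He Dx Dy Dz f Fx Fy Fz Hlt.
  assert (Hlen : forall w, 0 < shifted_length a b e w).
  { intros w. unfold shifted_length. pose proof (Rabs_pos (b w)). pose proof (Rabs_pos (a w - 1)). nra. }
  assert (Hf : forall w, -1 <= f w).
  { intros w. unfold f, shifted_angle. pose proof (pseudo_angle_range (b w) (a w - 1)).
    pose proof (pos_INR (index w o)). assert (0 <= e * e * INR (index w o)) by nra. lra. }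
  assert (G : forall u v, dec u = false -> dec v = false -> f u < 3 -> f v < 3 ->
     0 < f v - f u < 2 \/ f v - f u < -2 ->
     cross (direction (shift_a dec a b o e) (shift_b dec a b o e) u)
           (direction (shift_a dec a b o e) (shift_b dec a b o e) v) < 0).
  { intros u v Du Dv Fu Fv H.
    pose proof (ray_cross (f u) (f v) ltac:(split; [apply Hf|easy]) ltac:(split; [apply Hf|easy]) H) as Hc.
    unfold direction, shift_a, shift_b, cross in *. rewrite Du, Dv. cbn [fst snd] in *.
    fold f. pose proof (Rmult_lt_0_compat _ _ (Hlen u) (Hlen v)). fold (f u) (f v). nra. }
  unfold clockwise_triple. cbv zeta. pose proof (Hf x) as Hfx.
  destruct (Rlt_dec (f y - f x) 2), (Rlt_dec (f z - f y) 2).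
  - left. split; apply G; auto; lra.
  - right; right. split; apply G; auto; lra.
  - right; left. split; apply G; auto; lra.
  - lra.
Qed.

Lemma sorted_index (P : nat -> nat -> Prop) o x y :
  StronglySorted P o -> In x o -> In y o -> (index x o < index y o)%nat -> P x y.
Proof.
  induction 1 as [|z o Hs IH Hf]; cbn; [easy|]. rewrite Forall_forall in Hf.
  destruct (Nat.eqb_spec x z) as [->|Hx], (Nat.eqb_spec y z) as [->|Hy]; intros Ix Iy; try lia.
  - intros _. destruct Iy as [->|Iy]; [easy|auto].
  - intros H. apply IH; [destruct Ix; congruence|destruct Iy; congruence|lia].
Qed.

(** Suppose that [t] beats [s] by [d], and perturb so little that every constant term moves by less
    than [d / 2]. A minimizer of the perturbed problem peels a rotation of [o], so for the original
    data it is no better than [s]. Yet it is at least as good as [t] for the perturbed data, a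
    contradiction. *)
Lemma peels_rotation_optimal a b n (dec : nat -> bool) o s :
  (forall x, (x < n)%nat -> if dec x then a x < 0 else 0 <= a x) ->
  Permutation o (filter (fun x => negb (dec x)) (seq 0 n)) ->
  StronglySorted (fun x y => pseudo_angle (b x) (a x - 1) <= pseudo_angle (b y) (a y - 1)) o ->
  (forall r t, (r <= length o)%nat -> is_perm n t -> peels dec (skipn r o ++ firstn r o) t ->
     const a b s <= const a b t) ->
  forall t, is_perm n t -> const a b s <= const a b t.
Proof.
  intros Ha Hp Ho Hs t Ht. destruct (Rle_dec (const a b s) (const a b t)) as [|Hlt]; [easy|exfalso].
  set (d := const a b s - const a b t).
  set (pa := shift_a dec a b o). set (pb := shift_b dec a b o).
  assert (Hn : near_zero (fun e => forall w, In w (words n n) ->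
            Rabs (const (pa e) (pb e) w - const a b w) < d / 2)).
  { apply near_zero_all. intros w _.
    replace (const a b w) with (const (pa 0) (pb 0) w)
      by (apply const_ext_in; intros x _; apply shift_zero).
    apply (continuity_pt_near (fun e => const (pa e) (pb e) w)); [unfold d; lra|].
    apply continuity_pt_const_list; intros x; apply shift_continuous. }
  assert (Ho' : forall x, In x o -> (x < n)%nat /\ dec x = false).
  { intros x Hx. apply (Permutation_in _ Hp), filter_In in Hx. destruct Hx as [Hx Hd].
    apply in_seq in Hx. split; [lia|]. now destruct (dec x). }
  assert (Hpos : near_zero (fun e => forall x, In x o -> 0 < pa e x)).
  { apply near_zero_all. intros x Hx. destruct (Ho' x Hx) as [Hx1 Hx2].
    apply shift_a_pos; [easy|]. specialize (Ha x Hx1). now rewrite Hx2 in Ha. }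
  (* An angle shifted beyond 3 would start a second turn and disturb the cyclic order; the strict
     bound in [pseudo_angle_range] leaves room for the shift. *)
  assert (Hang : near_zero (fun e => forall x, In x o -> shifted_angle a b o e x < 3)).
  { apply near_zero_all. intros x _. unfold shifted_angle.
    pose proof (pseudo_angle_range (b x) (a x - 1)) as Hr. set (k := pseudo_angle _ _) in *.
    pose proof (pos_INR (index x o)) as Hi. set (i := INR _) in *.
    destruct (near_zero_and _ _ (near_zero_small 1 ltac:(lra))
      (near_zero_small ((3 - k) / (i + 1)) ltac:(apply Rdiv_lt_0_compat; lra))) as (c & Hc & H).
    exists c. split; [easy|]. intros e He. destruct (H e He) as [H1 H2].
    apply Rmult_lt_compat_r with (r := i + 1) in H2; [|lra].
    replace ((3 - k) / (i + 1) * (i + 1)) with (3 - k) in H2 by (field; lra).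
    assert (0 <= e * i * (1 - e)) by (apply Rmult_le_pos; [apply Rmult_le_pos|]; lra). lra. }
  destruct (near_zero_and _ _ (near_zero_small 1 ltac:(lra))
    (near_zero_and _ _ Hn (near_zero_and _ _ Hpos Hang))) as (c & Hc & H).
  destruct (H (c / 2) ltac:(lra)) as (E1 & E2 & E3 & E4). clear H Hn Hpos Hang.
  set (e := c / 2) in *. assert (He : 0 < e < 1) by (unfold e in *; lra).
  destruct (exists_minimal (pa e) (pb e) n) as (m & Hm).
  destruct (minimal_peels_rotation (pa e) (pb e) n dec m (shifted_angle a b o e) o Hm)
    as (r & Hr & Hpeel).
  - intros x Hx. pose proof (Ha x Hx) as Hax. destruct (dec x) eqn:Ed.
    + unfold pa, shift_a. now rewrite Ed.
    + apply E3. apply (Permutation_in _ (Permutation_sym Hp)), filter_In.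
      rewrite Ed. split; [apply in_seq; lia|reflexivity].
  - exact Hp.
  - assert (Hd : NoDup o).
    { apply (Permutation_NoDup (Permutation_sym Hp)). apply NoDup_filter, seq_NoDup. }
    (* Along [o] the angles increase weakly and the shifts strictly. *)
    clear -Ho Hd He. unfold shifted_angle.
    assert (G : forall p l, o = p ++ l -> StronglySorted (fun x y =>
       pseudo_angle (b x) (a x - 1) + e * e * INR (index x o) <
       pseudo_angle (b y) (a y - 1) + e * e * INR (index y o)) l).
    { intros p l. revert p. induction l as [|x l IH]; intros p E; [constructor|].
      assert (E' : o = (p ++ [x]) ++ l) by (now rewrite <- app_assoc).
      constructor; [now apply (IH (p ++ [x]))|]. apply Forall_forall. intros y Hy.
      assert (Hix : (index x o < index y o)%nat).
      { assert (Hxp : ~ In x p).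
        { rewrite E in Hd. apply NoDup_remove_2 in Hd. rewrite in_app_iff in Hd. auto. }
        rewrite E, !index_app_notin; auto.
        - cbn. rewrite Nat.eqb_refl. destruct (Nat.eqb_spec y x) as [->|]; [|lia].
          exfalso. rewrite E in Hd. apply NoDup_remove_2 in Hd. apply Hd, in_or_app. auto.
        - intros Hyp. rewrite E in Hd. clear -Hd Hyp Hy.
          induction p as [|z p IHp]; cbn in *; [easy|].
          inversion Hd as [|? ? Hz Hd']; subst. destruct Hyp as [->|Hyp]; [|auto].
          apply Hz, in_or_app. right. now right. }
      pose proof (sorted_index _ o x y Ho
        ltac:(rewrite E; apply in_or_app; cbn; auto)
        ltac:(rewrite E; apply in_or_app; cbn; auto) Hix) as Hle. cbn in Hle.
      apply lt_INR in Hix. assert (0 < e * e) by nra. nra. }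
    now apply (G []).
  - intros x y z Hx Hy Hz Hf. apply shifted_triple; auto; now apply Ho'.
  (* The minimizer [m] depends on [e], but [E2] bounds the errors of all words for this [e], so
     those of [m] and [t] add up to less than [d]. *)
  - destruct Hm as [Hmp Hmin].
    pose proof (Hs r m Hr Hmp Hpeel) as H1. pose proof (Hmin t Ht) as H2.
    pose proof (E2 m (perm_in_words _ _ Hmp)) as H3. pose proof (E2 t (perm_in_words _ _ Ht)) as H4.
    apply Rabs_def2 in H3, H4. unfold d in *. lra.
Qed.

Open Scope nat_scope.

(** * A language with arrays, compiled to the machine *)

(** Every name denotes an unbounded array; a scalar variable is the cell 0 of its array. *)
Inductive nname : Type :=
| Size | NumDec | NumInc | Starts | Lengths | Subsets | Width
| I | J | K | D | Rest | Place | Here | Prev | Elem | Found | Cursor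
| Inc | Dec | Order | Pow | Choice | Next | Out.

Inductive rname : Type := Input | Angle | Slope | Offset | Value | Sum.

Scheme Equality for nname.
Scheme Equality for rname.

Record store : Type := Store {
  nat_at : nname -> nat -> nat;
  real_at : rname -> nat -> R }.

Inductive nexp : Type :=
| NLit (c : nat)
| NCell (x : nname) (e : nexp)
| NPlus (e1 e2 : nexp)
| NMinus (e1 e2 : nexp)
| NTimes (e1 e2 : nexp).

Inductive rexp : Type :=
| RLit (z : Z)
| RCell (x : rname) (e : nexp)
| RPlus (e1 e2 : rexp)
| RMinus (e1 e2 : rexp)
| RTimes (e1 e2 : rexp)
| RQuot (e1 e2 : rexp).

Inductive cond : Type :=
| NLe (e1 e2 : nexp)
| RLe (e1 e2 : rexp).

Inductive cmd : Type :=
| Skip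
| NSet (x : nname) (e v : nexp)
| RSet (x : rname) (e : nexp) (v : rexp)
| Seq (c1 c2 : cmd)
| If (b : cond) (c1 c2 : cmd)
| For (x b : nname) (c : cmd).

Definition NVar (x : nname) : nexp := NCell x (NLit 0).
Definition RVar (x : rname) : rexp := RCell x (NLit 0).

Fixpoint neval (e : nexp) (s : store) : nat :=
  match e with
  | NLit c => c
  | NCell x e => nat_at s x (neval e s)
  | NPlus e1 e2 => neval e1 s + neval e2 s
  | NMinus e1 e2 => neval e1 s - neval e2 s
  | NTimes e1 e2 => neval e1 s * neval e2 s
  end.

Fixpoint reval (e : rexp) (s : store) : R :=
  match e with
  | RLit z => IZR z
  | RCell x e => real_at s x (neval e s)
  | RPlus e1 e2 => reval e1 s + reval e2 s
  | RMinus e1 e2 => reval e1 s - reval e2 s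
  | RTimes e1 e2 => reval e1 s * reval e2 s
  | RQuot e1 e2 => reval e1 s / reval e2 s
  end%R.

Definition ceval (b : cond) (s : store) : bool :=
  match b with
  | NLe e1 e2 => neval e1 s <=? neval e2 s
  | RLe e1 e2 => if Rle_dec (reval e1 s) (reval e2 s) then true else false
  end.

Definition set_nat (s : store) (x : nname) (i v : nat) : store :=
  Store (fun y => if nname_beq y x then upd (nat_at s y) i v else nat_at s y) (real_at s).

Definition set_real (s : store) (x : rname) (i : nat) (v : R) : store :=
  Store (nat_at s) (fun y => if rname_beq y x then upd (real_at s y) i v else real_at s y).

(** The number of iterations is fixed on entry and the counter is kept outside the store, so every
    command terminates and assigning the loop variable in the body cannot disturb the loop. *)
Fixpoint for_loop (f : nat -> store -> store) (n : nat) (s : store) : store :=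
  match n with
  | O => s
  | S n' => f n' (for_loop f n' s)
  end.

Fixpoint run (c : cmd) (s : store) : store :=
  match c with
  | Skip => s
  | NSet x e v => set_nat s x (neval e s) (neval v s)
  | RSet x e v => set_real s x (neval e s) (reval v s)
  | Seq c1 c2 => run c2 (run c1 s)
  | If b c1 c2 => if ceval b s then run c1 s else run c2 s
  | For x b c => for_loop (fun i s' => run c (set_nat s' x 0 i)) (nat_at s b 0) s
  end.

Lemma for_loop_inv (Inv : nat -> store -> Prop) f n s :
  Inv 0 s -> (forall i s', i < n -> Inv i s' -> Inv (S i) (f i s')) -> Inv n (for_loop f n s).
Proof.
  intros H0 HS. induction n as [|n IH]; cbn; [easy|].
  apply HS; [lia|]. apply IH. intros i s' Hi. apply HS. lia.
Qed.

(** [P] marks names that the command never writes. Since every loop bound has to be marked, the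
    bounds are constants of the execution and a bound on the time can be read off the syntax. *)
Fixpoint stable (P : nname -> bool) (c : cmd) : bool :=
  match c with
  | Skip | RSet _ _ _ => true
  | NSet x _ _ => negb (P x)
  | Seq c1 c2 | If _ c1 c2 => stable P c1 && stable P c2
  | For x b c => negb (P x) && P b && stable P c
  end.

Lemma set_nat_other s x i v y : y <> x -> nat_at (set_nat s x i v) y = nat_at s y.
Proof.
  intros H. cbn. destruct (nname_beq y x) eqn:E; [|reflexivity].
  now apply internal_nname_dec_bl in E.
Qed.

Lemma run_stable P c s y : stable P c = true -> P y = true -> nat_at (run c s) y = nat_at s y.
Proof.
  revert s. induction c as [|x e v|x e v|c1 IH1 c2 IH2|b c1 IH1 c2 IH2|x b c IH];
    intros s Hc Hy; cbn [stable run] in *; try reflexivity.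
  - apply set_nat_other. intros ->. now rewrite Hy in Hc.
  - apply andb_prop in Hc. destruct Hc. rewrite IH2, IH1; auto.
  - apply andb_prop in Hc. destruct Hc. destruct (ceval b s); auto.
  - apply andb_prop in Hc. destruct Hc as [Hc Hb]. apply andb_prop in Hc. destruct Hc as [Hx _].
    apply (for_loop_inv (fun _ s' => nat_at s' y = nat_at s y)); [reflexivity|].
    intros i s' _ H. rewrite IH by auto. rewrite set_nat_other; [easy|].
    intros ->. now rewrite Hy in Hx.
Qed.

(** * Memory layout and code generation *)

Definition mem : Type := ((nat -> nat) * (nat -> R))%type.

Definition conf (p : nat) (m : mem) : config := Config p (fst m) (snd m).

Definition nnum (x : nname) : nat :=
  match x with
  | Size => 0 | NumDec => 1 | NumInc => 2 | Starts => 3 | Lengths => 4 | Subsets => 5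
  | Width => 6 | I => 7 | J => 8 | K => 9 | D => 10 | Rest => 11 | Place => 12 | Here => 13
  | Prev => 14 | Elem => 15 | Found => 16 | Cursor => 17 | Inc => 18 | Dec => 19 | Order => 20
  | Pow => 21 | Choice => 22 | Next => 23 | Out => 24
  end.

Definition rnum (x : rname) : nat :=
  match x with
  | Input => 0 | Angle => 1 | Slope => 2 | Offset => 3 | Value => 4 | Sum => 5
  end.

(* Registers are interleaved modulo 32: temporaries, loop counters, and one residue class per name. *)
Definition tmp (t : nat) : nat := 32 * t.
Definition hid (h : nat) : nat := 32 * h + 1.
Definition naddr (x : nname) (i : nat) : nat := 32 * i + (2 + nnum x).
Definition raddr (x : rname) (i : nat) : nat := 32 * i + (2 + rnum x).

Arguments tmp : simpl never.
Arguments hid : simpl never.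
Arguments naddr : simpl never.
Arguments raddr : simpl never.

Definition view (m : mem) : store :=
  Store (fun x i => fst m (naddr x i)) (fun x i => snd m (raddr x i)).

Lemma nnum_lt x : nnum x < 30.
Proof. destruct x; cbn; lia. Qed.

Lemma rnum_lt x : rnum x < 30.
Proof. destruct x; cbn; lia. Qed.

Lemma nnum_inj x y : nnum x = nnum y -> x = y.
Proof. destruct x, y; cbn; intros H; try reflexivity; discriminate. Qed.

Lemma rnum_inj x y : rnum x = rnum y -> x = y.
Proof. destruct x, y; cbn; intros H; try reflexivity; discriminate. Qed.

Definition straight (ins : instr) : bool :=
  match ins with JmpNLe _ _ _ | JmpRLe _ _ _ | Halt => false | _ => true end.

Definition act (ins : instr) (m : mem) : mem :=
  let '(N, Rg) := m in
  match ins with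
  | NConst d v => (upd N d v, Rg)
  | NAdd d i j => (upd N d (N i + N j), Rg)
  | NSub d i j => (upd N d (N i - N j), Rg)
  | NMul d i j => (upd N d (N i * N j), Rg)
  | NLoadInd d i => (upd N d (N (N i)), Rg)
  | NStoreInd i s => (upd N (N i) (N s), Rg)
  | RConst d z => (N, upd Rg d (IZR z))
  | RAdd d i j => (N, upd Rg d (Rg i + Rg j)%R)
  | RSub d i j => (N, upd Rg d (Rg i - Rg j)%R)
  | RMul d i j => (N, upd Rg d (Rg i * Rg j)%R)
  | RDiv d i j => (N, upd Rg d (Rg i / Rg j)%R)
  | RLoadInd d i => (N, upd Rg d (Rg (N i)))
  | RStoreInd i s => (N, upd Rg (N i) (Rg s))
  | _ => m
  end.

Definition acts (l : list instr) (m : mem) : mem := fold_left (fun m ins => act ins m) l m.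

Lemma acts_app l1 l2 m : acts (l1 ++ l2) m = acts l2 (acts l1 m).
Proof. apply fold_left_app. Qed.

Fixpoint reach (P : program) (t : nat) (c c' : config) : Prop :=
  match t with
  | O => c = c'
  | S t' => exists c1, step P c = Some c1 /\ reach P t' c1 c'
  end.

Lemma reach_trans P t1 t2 c1 c2 c3 :
  reach P t1 c1 c2 -> reach P t2 c2 c3 -> reach P (t1 + t2) c1 c3.
Proof.
  revert c1. induction t1 as [|t1 IH]; cbn; intros c1 H1 H2; [now subst|].
  destruct H1 as (c & Hc & H1). eauto.
Qed.

Lemma reach_exec P t c c' : reach P t c c' -> exec P t c = c'.
Proof.
  revert c. induction t as [|t IH]; cbn; intros c H; [easy|].
  destruct H as (c1 & -> & H). auto.
Qed.

Definition code_at (P : program) (p : nat) (l : list instr) : Prop :=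
  forall i ins, nth_error l i = Some ins -> nth_error P (p + i) = Some ins.

Lemma code_at_app P p l1 l2 :
  code_at P p (l1 ++ l2) -> code_at P p l1 /\ code_at P (p + length l1) l2.
Proof.
  intros H. split; intros i ins Hi.
  - apply H. rewrite nth_error_app1; [easy|]. apply nth_error_Some. congruence.
  - rewrite <- Nat.add_assoc. apply H. rewrite nth_error_app2 by lia.
    now replace (length l1 + i - length l1) with i by lia.
Qed.

Lemma code_at_head P p ins l : code_at P p (ins :: l) -> nth_error P p = Some ins.
Proof. intros H. specialize (H 0 ins eq_refl). now rewrite Nat.add_0_r in H. Qed.

Lemma code_at_whole (l1 l2 l3 : list instr) : code_at (l1 ++ l2 ++ l3) (length l1) l2.
Proof.
  intros i ins Hi. rewrite nth_error_app2 by lia.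
  replace (length l1 + i - length l1) with i by lia.
  rewrite nth_error_app1; [easy|]. apply nth_error_Some. congruence.
Qed.

Lemma reach_straight P p l m :
  code_at P p l -> forallb straight l = true ->
  reach P (length l) (conf p m) (conf (p + length l) (acts l m)).
Proof.
  revert p m. induction l as [|ins l IH]; intros p m Hc Hs; cbn [length].
  - cbn. now rewrite Nat.add_0_r.
  - cbn in Hs. apply andb_prop in Hs. destruct Hs as [Hi Hs].
    exists (conf (S p) (act ins m)). split.
    + pose proof (code_at_head _ _ _ _ Hc) as Hn. unfold conf, step. rewrite Hn.
      destruct ins, m; try discriminate; reflexivity.
    + replace (p + S (length l)) with (S p + length l) by lia. apply IH; [|easy].
      change (ins :: l) with ([ins] ++ l) in Hc. apply code_at_app in Hc.
      now rewrite Nat.add_1_r in Hc.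
Qed.

Definition to_address (t c : nat) : list instr :=
  [NConst (tmp (S t)) 32; NMul (tmp t) (tmp t) (tmp (S t));
   NConst (tmp (S t)) c; NAdd (tmp t) (tmp t) (tmp (S t))].

Fixpoint ncode (e : nexp) (t : nat) : list instr :=
  match e with
  | NLit c => [NConst (tmp t) c]
  | NCell x e => ncode e t ++ to_address t (2 + nnum x) ++ [NLoadInd (tmp t) (tmp t)]
  | NPlus e1 e2 => ncode e1 t ++ ncode e2 (S t) ++ [NAdd (tmp t) (tmp t) (tmp (S t))]
  | NMinus e1 e2 => ncode e1 t ++ ncode e2 (S t) ++ [NSub (tmp t) (tmp t) (tmp (S t))]
  | NTimes e1 e2 => ncode e1 t ++ ncode e2 (S t) ++ [NMul (tmp t) (tmp t) (tmp (S t))]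
  end.

(* [t] is the first free natural temporary, [r] the real temporary that receives the value. *)
Fixpoint rcode (e : rexp) (t r : nat) : list instr :=
  match e with
  | RLit z => [RConst (tmp r) z]
  | RCell x e => ncode e t ++ to_address t (2 + rnum x) ++ [RLoadInd (tmp r) (tmp t)]
  | RPlus e1 e2 => rcode e1 t r ++ rcode e2 t (S r) ++ [RAdd (tmp r) (tmp r) (tmp (S r))]
  | RMinus e1 e2 => rcode e1 t r ++ rcode e2 t (S r) ++ [RSub (tmp r) (tmp r) (tmp (S r))]
  | RTimes e1 e2 => rcode e1 t r ++ rcode e2 t (S r) ++ [RMul (tmp r) (tmp r) (tmp (S r))]
  | RQuot e1 e2 => rcode e1 t r ++ rcode e2 t (S r) ++ [RDiv (tmp r) (tmp r) (tmp (S r))]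
  end.

Lemma forallb_cat {T} (f : T -> bool) l1 l2 :
  forallb f l1 = true -> forallb f l2 = true -> forallb f (l1 ++ l2) = true.
Proof. intros H1 H2. now rewrite List.forallb_app, H1, H2. Qed.

Lemma ncode_straight e t : forallb straight (ncode e t) = true.
Proof.
  revert t. induction e; intros t; cbn [ncode]; repeat apply forallb_cat; auto.
Qed.

Lemma rcode_straight e t r : forallb straight (rcode e t r) = true.
Proof.
  revert r. induction e; intros r; cbn [rcode]; repeat apply forallb_cat; auto using ncode_straight.
Qed.

(** Agreement everywhere except on the temporaries numbered [t] or more. Code generated at level [t]
    may overwrite these but preserves the pending operands, which sit in lower temporaries. *)
Definition same_above {T} (t : nat) (f g : nat -> T) : Prop :=
  forall a, (forall u, t <= u -> a <> tmp u) -> f a = g a.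

Lemma same_above_refl {T} t (f : nat -> T) : same_above t f f.
Proof. easy. Qed.

Lemma same_above_trans {T} t u (f g h : nat -> T) :
  t <= u -> same_above t f g -> same_above u g h -> same_above t f h.
Proof.
  intros Htu H1 H2 a Ha. rewrite (H1 a Ha). apply H2. intros v Hv. apply Ha. lia.
Qed.

Lemma same_above_upd {T} t u (f : nat -> T) v : t <= u -> same_above t f (upd f (tmp u) v).
Proof.
  intros Htu a Ha. unfold upd. destruct (Nat.eqb_spec a (tmp u)); [|easy].
  now apply Ha in Htu.
Qed.

Lemma same_above_upd2 {T} t (f g h : nat -> T) v :
  same_above t f g -> same_above (S t) g h -> same_above t f (upd h (tmp t) v).
Proof.
  intros H1 H2. apply (same_above_trans t t f g); [lia|easy|].
  intros a Ha. unfold upd. destruct (Nat.eqb_spec a (tmp t)) as [->|]; [|apply H2; auto with arith].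
  exfalso. now apply (Ha t).
Qed.

Lemma upd_same {T} (f : nat -> T) i v : upd f i v i = v.
Proof. unfold upd. now rewrite Nat.eqb_refl. Qed.

Lemma upd_other {T} (f : nat -> T) i v j : j <> i -> upd f i v j = f j.
Proof. intros H. unfold upd. now apply Nat.eqb_neq in H as ->. Qed.

Lemma naddr_not_tmp x i u : naddr x i <> tmp u.
Proof. pose proof (nnum_lt x). unfold naddr, tmp. lia. Qed.

Lemma raddr_not_tmp x i u : raddr x i <> tmp u.
Proof. pose proof (rnum_lt x). unfold raddr, tmp. lia. Qed.

Lemma view_same N N' Rg Rg' t r :
  same_above t N N' -> same_above r Rg Rg' -> view (N', Rg') = view (N, Rg).
Proof.
  intros H1 H2. unfold view. f_equal; extensionality x; extensionality i; cbn.
  - symmetry. apply H1. intros u _. apply naddr_not_tmp.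
  - symmetry. apply H2. intros u _. apply raddr_not_tmp.
Qed.

Lemma same_above_keep {T} t (f g : nat -> T) u : same_above t f g -> u < t -> g (tmp u) = f (tmp u).
Proof. intros H Hu. symmetry. apply H. intros v Hv. unfold tmp. lia. Qed.

Lemma to_address_ok t c N Rg :
  exists N', acts (to_address t c) (N, Rg) = (N', Rg) /\
    N' (tmp t) = 32 * N (tmp t) + c /\ same_above t N N'.
Proof.
  eexists. split; [reflexivity|]. split.
  - repeat rewrite ?upd_same, ?(upd_other _ (tmp (S t)) _ (tmp t)) by (unfold tmp; lia). lia.
  - repeat (eapply same_above_trans; [apply Nat.le_refl| |apply same_above_upd; lia]).
    apply same_above_refl.
Qed.

Lemma nbinary_ok t c c' u (v : store -> nat) (op : nat -> nat -> nat) ins N Rg :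
  (forall N, act ins (N, Rg) = (upd N (tmp t) (op (N (tmp t)) (N (tmp (S t)))), Rg)) ->
  (exists N', acts c (N, Rg) = (N', Rg) /\ N' (tmp t) = u /\ same_above t N N') ->
  (forall N, exists N', acts c' (N, Rg) = (N', Rg) /\
     N' (tmp (S t)) = v (view (N, Rg)) /\ same_above (S t) N N') ->
  exists N', acts (c ++ c' ++ [ins]) (N, Rg) = (N', Rg) /\
    N' (tmp t) = op u (v (view (N, Rg))) /\ same_above t N N'.
Proof.
  intros Hop (N1 & E1 & V1 & S1) H2. destruct (H2 N1) as (N2 & E2 & V2 & S2).
  rewrite !acts_app, E1, E2. cbn [acts fold_left]. rewrite Hop. eexists. split; [reflexivity|].
  rewrite (view_same N N1 Rg Rg t 0) in V2 by easy.
  split; [now rewrite upd_same, V2, (same_above_keep _ _ _ t S2), V1 by lia|].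
  now apply (same_above_upd2 t N N1).
Qed.

Lemma ncode_ok e t N Rg :
  exists N', acts (ncode e t) (N, Rg) = (N', Rg) /\
    N' (tmp t) = neval e (view (N, Rg)) /\ same_above t N N'.
Proof.
  revert t N. induction e as [c|x e IH|e1 IH1 e2 IH2|e1 IH1 e2 IH2|e1 IH1 e2 IH2]; intros t N;
    cbn [ncode neval].
  - eexists. split; [reflexivity|]. split; [apply upd_same|now apply same_above_upd].
  - destruct (IH t N) as (N1 & E1 & V1 & S1).
    destruct (to_address_ok t (2 + nnum x) N1 Rg) as (N2 & E2 & V2 & S2).
    rewrite !acts_app, E1, E2. eexists. split; [reflexivity|].
    assert (S12 : same_above t N N2) by (now apply (same_above_trans t t N N1 N2)).
    split.
    + rewrite upd_same, V2, V1. symmetry. apply S12. intros u _. apply naddr_not_tmp.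
    + eapply same_above_trans; [|exact S12|now apply same_above_upd]; lia.
  - eapply nbinary_ok; [reflexivity|exact (IH1 t N)|exact (IH2 (S t))].
  - eapply nbinary_ok; [reflexivity|exact (IH1 t N)|exact (IH2 (S t))].
  - eapply nbinary_ok; [reflexivity|exact (IH1 t N)|exact (IH2 (S t))].
Qed.

Lemma binary_ok t (c : nat -> list instr) (c' : nat -> list instr) (v v' : store -> R)
    (op : R -> R -> R) ins r :
  (forall N Rg, act ins (N, Rg) = (N, upd Rg (tmp r) (op (Rg (tmp r)) (Rg (tmp (S r)))))) ->
  (forall r N Rg, exists N' Rg', acts (c r) (N, Rg) = (N', Rg') /\
    Rg' (tmp r) = v (view (N, Rg)) /\ same_above t N N' /\ same_above r Rg Rg') ->
  (forall r N Rg, exists N' Rg', acts (c' r) (N, Rg) = (N', Rg') /\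
    Rg' (tmp r) = v' (view (N, Rg)) /\ same_above t N N' /\ same_above r Rg Rg') ->
  forall N Rg, exists N' Rg', acts (c r ++ c' (S r) ++ [ins]) (N, Rg) = (N', Rg') /\
    Rg' (tmp r) = op (v (view (N, Rg))) (v' (view (N, Rg))) /\
    same_above t N N' /\ same_above r Rg Rg'.
Proof.
  intros Hop H1 H2 N Rg.
  destruct (H1 r N Rg) as (N1 & G1 & E1 & V1 & S1 & T1).
  destruct (H2 (S r) N1 G1) as (N2 & G2 & E2 & V2 & S2 & T2).
  rewrite !acts_app, E1, E2. cbn [acts fold_left]. rewrite Hop.
  exists N2. eexists. split; [reflexivity|].
  rewrite (view_same N N1 Rg G1 t r) in V2 by easy.
  split; [now rewrite upd_same, V2, (same_above_keep _ _ _ r T2), V1 by lia|].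
  split; [now apply (same_above_trans t t N N1 N2)|].
  now apply (same_above_upd2 r Rg G1).
Qed.

Lemma rcode_ok e t r N Rg :
  exists N' Rg', acts (rcode e t r) (N, Rg) = (N', Rg') /\
    Rg' (tmp r) = reval e (view (N, Rg)) /\ same_above t N N' /\ same_above r Rg Rg'.
Proof.
  revert r N Rg.
  induction e as [z|x e|e1 IH1 e2 IH2|e1 IH1 e2 IH2|e1 IH1 e2 IH2|e1 IH1 e2 IH2]; intros r N Rg;
    cbn [rcode reval].
  - do 2 eexists. split; [reflexivity|]. split; [apply upd_same|].
    split; [apply same_above_refl|now apply same_above_upd].
  - destruct (ncode_ok e t N Rg) as (N1 & E1 & V1 & S1).
    destruct (to_address_ok t (2 + rnum x) N1 Rg) as (N2 & E2 & V2 & S2).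
    rewrite !acts_app, E1, E2. do 2 eexists. split; [reflexivity|].
    split; [now rewrite upd_same, V2, V1|].
    split; [now apply (same_above_trans t t N N1 N2)|now apply same_above_upd].
  - now apply (binary_ok t (rcode e1 t) (rcode e2 t) (reval e1) (reval e2) Rplus).
  - now apply (binary_ok t (rcode e1 t) (rcode e2 t) (reval e1) (reval e2) Rminus).
  - now apply (binary_ok t (rcode e1 t) (rcode e2 t) (reval e1) (reval e2) Rmult).
  - now apply (binary_ok t (rcode e1 t) (rcode e2 t) (reval e1) (reval e2) Rdiv).
Qed.

Definition condcode (b : cond) : list instr :=
  match b with
  | NLe e1 e2 => ncode e1 0 ++ ncode e2 1
  | RLe e1 e2 => rcode e1 0 0 ++ rcode e2 0 1
  end.

Definition condjump (b : cond) (l : nat) : instr :=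
  match b with
  | NLe _ _ => JmpNLe (tmp 0) (tmp 1) l
  | RLe _ _ => JmpRLe (tmp 0) (tmp 1) l
  end.

(* [p] is the address of the first instruction; the hidden registers below [h] are in use. *)
Fixpoint ccode (c : cmd) (p h : nat) : list instr :=
  match c with
  | Skip => []
  | NSet x e v =>
      ncode e 0 ++ to_address 0 (2 + nnum x) ++ ncode v 1 ++ [NStoreInd (tmp 0) (tmp 1)]
  | RSet x e v =>
      ncode e 0 ++ to_address 0 (2 + rnum x) ++ rcode v 1 0 ++ [RStoreInd (tmp 0) (tmp 0)]
  | Seq c1 c2 => ccode c1 p h ++ ccode c2 (p + length (ccode c1 p h)) h
  | If b c1 c2 =>
      let p2 := p + length (condcode b) + 1 in
      let k2 := ccode c2 p2 h in
      let p1 := p2 + length k2 + 1 in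
      let k1 := ccode c1 p1 h in
      condcode b ++ [condjump b p1] ++ k2 ++ [JmpNLe (tmp 0) (tmp 0) (p1 + length k1)] ++ k1
  | For x b c =>
      let init := ncode (NVar b) 0 ++
                  [NConst (tmp 1) 0; NAdd (hid h) (tmp 0) (tmp 1); NConst (hid (S h)) 0] in
      let test := p + length init in
      let k := ccode c (test + 3) (S (S h)) in
      init ++ [JmpNLe (hid h) (hid (S h)) (test + 3 + length k + 3)] ++
      [NConst (tmp 0) 0; NAdd (naddr x 0) (hid (S h)) (tmp 0)] ++ k ++
      [NConst (tmp 0) 1; NAdd (hid (S h)) (hid (S h)) (tmp 0); JmpNLe (tmp 0) (tmp 0) test]
  end.

(** An upper bound on the number of machine steps, given the values [B] of the loop bounds. Both
    branches of a conditional are charged, so that it does not depend on the store. *)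
Fixpoint ctime (B : nname -> nat) (c : cmd) : nat :=
  match c with
  | Skip => 0
  | NSet x e v => length (ncode e 0) + length (ncode v 1) + 5
  | RSet x e v => length (ncode e 0) + length (rcode v 1 0) + 5
  | Seq c1 c2 => ctime B c1 + ctime B c2
  | If b c1 c2 => length (condcode b) + 2 + (ctime B c1 + ctime B c2)
  | For x b c => length (ncode (NVar b) 0) + 4 + B b * (ctime B c + 6)
  end.

Lemma condcode_straight b : forallb straight (condcode b) = true.
Proof. destruct b; apply forallb_cat; auto using ncode_straight, rcode_straight. Qed.

Lemma hid_not_tmp h u : hid h <> tmp u.
Proof. unfold hid, tmp. lia. Qed.

Lemma naddr_not_hid x i h : naddr x i <> hid h.
Proof. pose proof (nnum_lt x). unfold naddr, hid. lia. Qed.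

Lemma naddr_inj x i y j : naddr x i = naddr y j -> x = y /\ i = j.
Proof.
  pose proof (nnum_lt x). pose proof (nnum_lt y). unfold naddr. intros E.
  split; [apply nnum_inj; lia|lia].
Qed.

Lemma raddr_inj x i y j : raddr x i = raddr y j -> x = y /\ i = j.
Proof.
  pose proof (rnum_lt x). pose proof (rnum_lt y). unfold raddr. intros E.
  split; [apply rnum_inj; lia|lia].
Qed.

Lemma view_upd_name N Rg x i v :
  view (upd N (naddr x i) v, Rg) = set_nat (view (N, Rg)) x i v.
Proof.
  unfold view, set_nat; cbn. f_equal. extensionality y. extensionality j.
  destruct (nname_beq y x) eqn:E.
  - apply internal_nname_dec_bl in E. subst y. unfold upd.
    destruct (Nat.eqb_spec (naddr x j) (naddr x i)) as [Ha|Ha], (Nat.eqb_spec j i) as [Hj|Hj];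
      try reflexivity.
    + apply naddr_inj in Ha. destruct Ha. congruence.
    + subst j. congruence.
  - rewrite upd_other; [reflexivity|]. intros Ha. apply naddr_inj in Ha. destruct Ha as [-> _].
    now rewrite internal_nname_dec_lb in E.
Qed.

Lemma view_upd_real N Rg x i v :
  view (N, upd Rg (raddr x i) v) = set_real (view (N, Rg)) x i v.
Proof.
  unfold view, set_real; cbn. f_equal. extensionality y. extensionality j.
  destruct (rname_beq y x) eqn:E.
  - apply internal_rname_dec_bl in E. subst y. unfold upd.
    destruct (Nat.eqb_spec (raddr x j) (raddr x i)) as [Ha|Ha], (Nat.eqb_spec j i) as [Hj|Hj];
      try reflexivity.
    + apply raddr_inj in Ha. destruct Ha. congruence.
    + subst j. congruence.
  - rewrite upd_other; [reflexivity|]. intros Ha. apply raddr_inj in Ha. destruct Ha as [-> _].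
    now rewrite internal_rname_dec_lb in E.
Qed.

Lemma view_upd_hid N Rg h v : view (upd N (hid h) v, Rg) = view (N, Rg).
Proof.
  unfold view; cbn. f_equal. extensionality y. extensionality j.
  rewrite upd_other; [reflexivity|apply naddr_not_hid].
Qed.

Lemma view_upd_tmp N Rg u v : view (upd N (tmp u) v, Rg) = view (N, Rg).
Proof.
  apply view_same with (t := 0) (r := 0); [apply same_above_upd; lia|apply same_above_refl].
Qed.

Lemma condcode_ok b m :
  exists m', acts (condcode b) m = m' /\ view m' = view m /\
    (forall h, fst m' (hid h) = fst m (hid h)) /\
    forall P p l, nth_error P p = Some (condjump b l) ->
      step P (conf p m') = Some (conf (if ceval b (view m) then l else S p) m').
Proof.
  destruct m as [N Rg], b as [e1 e2|e1 e2]; cbn [condcode condjump ceval]; rewrite acts_app.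
  - destruct (ncode_ok e1 0 N Rg) as (N1 & E1 & V1 & S1).
    destruct (ncode_ok e2 1 N1 Rg) as (N2 & E2 & V2 & S2). rewrite E1, E2.
    eexists. split; [reflexivity|].
    assert (S12 : same_above 0 N N2) by (apply (same_above_trans 0 1 N N1 N2); auto).
    split; [now apply view_same with (t := 0) (r := 0)|]. cbn [fst].
    split; [intros h; symmetry; apply S12; intros; apply hid_not_tmp|].
    intros P p l Hn. unfold conf, step. cbn [fst snd]. rewrite Hn.
    rewrite V2, (same_above_keep _ _ _ 0 S2), V1 by lia.
    rewrite (view_same N N1 Rg Rg 0 0) by easy. reflexivity.
  - destruct (rcode_ok e1 0 0 N Rg) as (N1 & G1 & E1 & V1 & S1 & T1).
    destruct (rcode_ok e2 0 1 N1 G1) as (N2 & G2 & E2 & V2 & S2 & T2). rewrite E1, E2.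
    eexists. split; [reflexivity|].
    assert (S12 : same_above 0 N N2) by (apply (same_above_trans 0 0 N N1 N2); auto).
    split; [apply view_same with (t := 0) (r := 0); [easy|now apply (same_above_trans 0 1 Rg G1 G2); auto]|].
    cbn [fst].
    split; [intros h; symmetry; apply S12; intros; apply hid_not_tmp|].
    intros P p l Hn. unfold conf, step. cbn [fst snd]. rewrite Hn.
    rewrite V2, (same_above_keep _ _ _ 0 T2), V1 by lia.
    rewrite (view_same N N1 Rg G1 0 0) by easy.
    destruct (Rle_dec _ _); reflexivity.
Qed.

Lemma view_step_jump P p N Rg i j l :
  nth_error P p = Some (JmpNLe i j l) ->
  step P (conf p (N, Rg)) = Some (conf (if N i <=? N j then l else S p) (N, Rg)).
Proof. intros H. unfold conf, step. cbn [fst snd]. now rewrite H. Qed.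

(** The last clause protects the bounds and counters of the enclosing loops, which occupy the hidden
    registers below [h]. *)
Definition simulates (P : program) (p q h T : nat) (m m' : mem) : Prop :=
  exists t, t <= T /\ reach P t (conf p m) (conf q m') /\
    forall j, j < h -> fst m' (hid j) = fst m (hid j).

Lemma simulates_trans P p q r h h' T T' m m' m'' :
  h <= h' -> simulates P p q h T m m' -> simulates P q r h' T' m' m'' ->
  simulates P p r h (T + T') m m''.
Proof.
  intros Hh (t & Ht & Hr & Hk) (t' & Ht' & Hr' & Hk'). exists (t + t').
  split; [lia|split; [eapply reach_trans; eassumption|]].
  intros j Hj. rewrite Hk' by lia. now apply Hk.
Qed.

Lemma simulates_straight P p h l m :
  code_at P p l -> forallb straight l = true ->
  (forall j, j < h -> fst (acts l m) (hid j) = fst m (hid j)) ->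
  simulates P p (p + length l) h (length l) m (acts l m).
Proof. intros Hc Hs Hk. exists (length l). split; [lia|split; [now apply reach_straight|easy]]. Qed.

Lemma simulates_jump P p h N Rg i j l :
  nth_error P p = Some (JmpNLe i j l) ->
  simulates P p (if N i <=? N j then l else S p) h 1 (N, Rg) (N, Rg).
Proof.
  intros H. exists 1. split; [lia|split; [|easy]].
  eexists. split; [exact (view_step_jump _ _ _ _ _ _ _ H)|reflexivity].
Qed.

Lemma simulates_weaken P p q h T T' m m' :
  T <= T' -> simulates P p q h T m m' -> simulates P p q h T' m m'.
Proof. intros H (t & Ht & Hr & Hk). exists t. split; [lia|easy]. Qed.

Lemma simulates_eq P p q q' h T m m' :
  q = q' -> simulates P p q h T m m' -> simulates P p q' h T m m'.
Proof. now intros ->. Qed.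

Lemma ccode_ok F B P c : stable F c = true ->
  forall p h m, code_at P p (ccode c p h) ->
  (forall x, F x = true -> nat_at (view m) x 0 = B x) ->
  exists m', simulates P p (p + length (ccode c p h)) h (ctime B c) m m' /\
    view m' = run c (view m).
Proof.
  induction c as [|x e v|x e v|c1 IH1 c2 IH2|b c1 IH1 c2 IH2|x b c IH];
    intros Hst p h m Hc HB; cbn [ccode ctime run] in *.
  - exists m. split; [|reflexivity]. exists 0. split; [lia|split; [|easy]].
    cbn. now rewrite Nat.add_0_r.
  - destruct m as [N Rg].
    assert (Hs : forallb straight (ncode e 0 ++ to_address 0 (2 + nnum x) ++ ncode v 1 ++
                   [NStoreInd (tmp 0) (tmp 1)]) = true)
      by (repeat apply forallb_cat; auto using ncode_straight).
    destruct (ncode_ok e 0 N Rg) as (N1 & E1 & V1 & S1).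
    destruct (to_address_ok 0 (2 + nnum x) N1 Rg) as (N2 & E2 & V2 & S2).
    destruct (ncode_ok v 1 N2 Rg) as (N3 & E3 & V3 & S3).
    assert (S13 : same_above 0 N N2) by (now apply (same_above_trans 0 0 N N1 N2)).
    assert (S14 : same_above 0 N N3) by (apply (same_above_trans 0 1 N N2 N3); auto).
    eexists. split.
    + eapply simulates_weaken; [|apply simulates_straight; [exact Hc|exact Hs|]].
      * rewrite !length_app. cbn. lia.
      * intros j _. rewrite !acts_app, E1, E2, E3. cbn.
        rewrite (same_above_keep _ _ _ 0 S3), V2 by lia.
        rewrite upd_other; [symmetry; apply S14; intros; apply hid_not_tmp|].
        intros E. symmetry in E. now apply (naddr_not_hid x (N1 (tmp 0)) j).
    + rewrite !acts_app, E1, E2, E3. cbn [acts fold_left act].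
      rewrite V3, (same_above_keep _ _ _ 0 S3), V2, V1 by lia.
      change (32 * ?i + (2 + nnum x)) with (naddr x i). rewrite view_upd_name.
      now rewrite (view_same N N3 Rg Rg 0 0), (view_same N N2 Rg Rg 0 0).
  - destruct m as [N Rg].
    assert (Hs : forallb straight (ncode e 0 ++ to_address 0 (2 + rnum x) ++ rcode v 1 0 ++
                   [RStoreInd (tmp 0) (tmp 0)]) = true)
      by (repeat apply forallb_cat; auto using ncode_straight, rcode_straight).
    destruct (ncode_ok e 0 N Rg) as (N1 & E1 & V1 & S1).
    destruct (to_address_ok 0 (2 + rnum x) N1 Rg) as (N2 & E2 & V2 & S2).
    destruct (rcode_ok v 1 0 N2 Rg) as (N3 & G3 & E3 & V3 & S3 & T3).
    assert (S13 : same_above 0 N N2) by (now apply (same_above_trans 0 0 N N1 N2)).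
    assert (S14 : same_above 0 N N3) by (apply (same_above_trans 0 1 N N2 N3); auto).
    eexists. split.
    + eapply simulates_weaken; [|apply simulates_straight; [exact Hc|exact Hs|]].
      * rewrite !length_app. cbn. lia.
      * intros j _. rewrite !acts_app, E1, E2, E3. cbn.
        symmetry; apply S14; intros; apply hid_not_tmp.
    + rewrite !acts_app, E1, E2, E3. cbn [acts fold_left act].
      rewrite V3, (same_above_keep _ _ _ 0 S3), V2, V1 by lia.
      change (32 * ?i + (2 + rnum x)) with (raddr x i). rewrite view_upd_real.
      now rewrite (view_same N N3 Rg G3 0 0), (view_same N N2 Rg Rg 0 0).
  - cbn [stable] in Hst. apply andb_prop in Hst. destruct Hst as [Hs1 Hs2].
    apply code_at_app in Hc. destruct Hc as [Hc1 Hc2].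
    destruct (IH1 Hs1 p h m Hc1 HB) as (m1 & R1 & V1).
    destruct (IH2 Hs2 _ h m1 Hc2) as (m2 & R2 & V2).
    { intros x Hx. rewrite V1, (run_stable F) by easy. now apply HB. }
    exists m2. split; [|now rewrite V2, V1].
    rewrite length_app, Nat.add_assoc. eapply simulates_trans; [|exact R1|exact R2]; lia.
  - cbn [stable] in Hst. apply andb_prop in Hst. destruct Hst as [Hs1 Hs2].
    set (p2 := p + length (condcode b) + 1) in *. set (k2 := ccode c2 p2 h) in *.
    set (p1 := p2 + length k2 + 1) in *. set (k1 := ccode c1 p1 h) in *.
    apply code_at_app in Hc. destruct Hc as [Hcb Hc].
    pose proof (code_at_head _ _ _ _ Hc) as Hj1. apply code_at_app in Hc. destruct Hc as [_ Hc].
    cbn [length] in Hc. fold p2 in Hc. apply code_at_app in Hc. destruct Hc as [Hc2 Hc].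
    pose proof (code_at_head _ _ _ _ Hc) as Hj2. apply code_at_app in Hc. destruct Hc as [_ Hc1].
    cbn [length] in Hc1. fold p1 in Hc1.
    destruct (condcode_ok b m) as (mb & Eb & Vb & Kb & Jb).
    assert (Rb : simulates P p (p + length (condcode b)) h (length (condcode b)) m mb).
    { rewrite <- Eb. apply simulates_straight; [easy|apply condcode_straight|].
      intros; rewrite Eb; apply Kb. }
    assert (Lj : forall q, step P (conf (p + length (condcode b)) mb) = Some (conf q mb) ->
               simulates P (p + length (condcode b)) q h 1 mb mb).
    { intros q Hq. exists 1. split; [lia|split; [|easy]]. eexists. split; [exact Hq|reflexivity]. }
    pose proof (Lj _ (Jb P _ _ Hj1)) as Rj. clear Lj.
    assert (HBb : forall x, F x = true -> nat_at (view mb) x 0 = B x) by (rewrite Vb; exact HB).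
    rewrite !length_app. cbn [length].
    replace (p + (length (condcode b) + (1 + (length k2 + (1 + length k1))))) with (p1 + length k1)
      by (unfold p1, p2; lia).
    destruct (ceval b (view m)).
    + destruct (IH1 Hs1 p1 h mb Hc1 HBb) as (m' & R' & V').
      exists m'. split; [|now rewrite V', Vb].
      eapply simulates_weaken; [|eapply simulates_trans; [apply Nat.le_refl|exact Rb|
        eapply simulates_trans; [apply Nat.le_refl|exact Rj|exact R']]]. lia.
    + replace (S (p + length (condcode b))) with p2 in Rj by (unfold p2; lia).
      destruct (IH2 Hs2 p2 h mb Hc2 HBb) as (m' & R' & V').
      exists m'. split; [|now rewrite V', Vb].
      pose proof (fun N Rg => simulates_jump P _ h N Rg _ _ _ Hj2) as Rl.
      destruct m' as [N' G']. specialize (Rl N' G'). rewrite Nat.leb_refl in Rl.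
      eapply simulates_weaken; [|eapply simulates_trans; [apply Nat.le_refl|exact Rb|
        eapply simulates_trans; [apply Nat.le_refl|exact Rj|
          eapply simulates_trans; [apply Nat.le_refl|exact R'|exact Rl]]]]. lia.
  - cbn [stable] in Hst. apply andb_prop in Hst. destruct Hst as [Hst Hsc].
    apply andb_prop in Hst. destruct Hst as [Hsx Hsb].
    set (init := ncode (NVar b) 0 ++ _) in *. set (test := p + length init) in *.
    set (k := ccode c (test + 3) (S (S h))) in *.
    apply code_at_app in Hc. destruct Hc as [Hci Hc]. fold test in Hc.
    pose proof (code_at_head _ _ _ _ Hc) as Hj1. apply code_at_app in Hc. destruct Hc as [_ Hc].
    cbn [length] in Hc. apply code_at_app in Hc. destruct Hc as [Hcx Hc].
    cbn [length] in Hc. replace (test + 1 + 2) with (test + 3) in Hc by lia.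
    apply code_at_app in Hc. destruct Hc as [Hcc Hce].
    set (last := test + 3 + length k + 3) in *.
    assert (Hinit : exists N0 Rg0, acts init m = (N0, Rg0) /\ N0 (hid h) = B b /\ N0 (hid (S h)) = 0 /\
       view (N0, Rg0) = view m /\ forall j, j < h -> N0 (hid j) = fst m (hid j)).
    { destruct m as [N Rg]. unfold init. rewrite acts_app.
      destruct (ncode_ok (NVar b) 0 N Rg) as (N1 & E1 & V1 & S1). rewrite E1.
      do 2 eexists. split; [reflexivity|].
      repeat split.
      - rewrite upd_other by (unfold hid; lia). rewrite upd_same.
        rewrite upd_same, upd_other by (unfold tmp; lia). rewrite V1. cbn. rewrite Nat.add_0_r.
        exact (HB b Hsb).
      - now rewrite upd_same.
      - rewrite !view_upd_hid, view_upd_tmp. now apply view_same with (t := 0) (r := 0).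
      - intros j Hj. rewrite !upd_other by (unfold hid, tmp; lia).
        symmetry. apply S1. intros; apply hid_not_tmp. }
    destruct Hinit as (N0 & Rg0 & Ei & Hb0 & Hc0 & V0 & K0).
    assert (Ri : simulates P p test h (length init) m (N0, Rg0)).
    { rewrite <- Ei. apply simulates_straight; [easy| |intros j Hj; rewrite Ei; now apply K0].
      apply forallb_cat; [apply ncode_straight|reflexivity]. }
    set (f := fun i s' => run c (set_nat s' x 0 i)).
    (* After [n] rounds control is back at the test. Besides the body, a round takes 6 steps: the
       test, two to copy the counter into the loop variable, two to increment it, and the jump
       back. *)
    assert (Hloop : forall n, n <= B b -> exists N Rg,
      simulates P test test h (n * (ctime B c + 6)) (N0, Rg0) (N, Rg) /\
      N (hid h) = B b /\ N (hid (S h)) = n /\ view (N, Rg) = for_loop f n (view m)).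
    { induction n as [|n IHn]; intros Hn.
      - exists N0, Rg0. split; [|now split]. exists 0. split; [lia|now split].
      - destruct (IHn ltac:(lia)) as (N & Rg & R1 & Hb1 & Hc1 & V1).
        pose proof (simulates_jump P _ h N Rg _ _ _ Hj1) as R2. rewrite Hb1, Hc1 in R2.
        destruct (Nat.leb_spec (B b) n) as [Hle|_]; [lia|].
        pose (m2 := acts [NConst (tmp 0) 0; NAdd (naddr x 0) (hid (S h)) (tmp 0)] (N, Rg)).
        assert (E2 : m2 = (upd (upd N (tmp 0) 0) (naddr x 0) n, Rg)).
        { unfold m2. cbn [acts fold_left act]. rewrite upd_same, upd_other by apply hid_not_tmp.
          now rewrite Hc1, Nat.add_0_r. }
        assert (K2 : forall j, fst m2 (hid j) = N (hid j)).
        { intros j. rewrite E2. cbn [fst]. rewrite !upd_other; [easy|apply hid_not_tmp|].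
          intros E; symmetry in E; now apply naddr_not_hid in E. }
        assert (R3 : simulates P (S test) (S test + 2) h 2 (N, Rg) m2).
        { apply (simulates_straight P _ h [NConst (tmp 0) 0; NAdd (naddr x 0) (hid (S h)) (tmp 0)] (N, Rg)); [now rewrite Nat.add_1_r in Hcx|reflexivity|].
          intros j _. apply K2. }
        replace (S test + 2) with (test + 3) in R3 by lia.
        assert (V2 : view m2 = set_nat (view (N, Rg)) x 0 n)
          by (now rewrite E2, view_upd_name, view_upd_tmp).
        destruct (IH Hsc (test + 3) (S (S h)) m2 Hcc) as (m3 & R4 & V3).
        { intros y Hy. rewrite V2, set_nat_other by (intros ->; now rewrite Hy in Hsx).
          rewrite V1. rewrite (for_loop_inv (fun _ s' => nat_at s' y = nat_at (view m) y)); auto.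
          intros i s' _ E. unfold f. rewrite (run_stable F) by easy.
          rewrite set_nat_other; [easy|]. intros ->. now rewrite Hy in Hsx. }
        fold k in R4.
        destruct m3 as [N3 G3].
        assert (K3 : forall j, j < S (S h) -> N3 (hid j) = N (hid j)).
        { destruct R4 as (t & _ & _ & HK). intros j Hj. cbn [fst] in HK. rewrite HK by easy. apply K2. }
        pose (m4 := acts [NConst (tmp 0) 1; NAdd (hid (S h)) (hid (S h)) (tmp 0)] (N3, G3)).
        assert (E4 : m4 = (upd (upd N3 (tmp 0) 1) (hid (S h)) (S n), G3)).
        { unfold m4. cbn [acts fold_left act]. rewrite upd_same, upd_other by apply hid_not_tmp.
          now rewrite K3, Hc1, Nat.add_1_r by lia. }
        assert (R5 : simulates P (test + 3 + length k) (test + 3 + length k + 2) h 2 (N3, G3) m4).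
        { apply (simulates_straight P _ h [NConst (tmp 0) 1; NAdd (hid (S h)) (hid (S h)) (tmp 0)] (N3, G3)); [|reflexivity|].
          - intros i ins Hi. apply Hce. destruct i as [|[|i]]; [easy|easy|]. now destruct i.
          - intros j Hj. fold m4. rewrite E4. cbn [fst].
            rewrite !upd_other; [easy|apply hid_not_tmp|unfold hid; lia]. }
        destruct m4 as [N4 G4]. injection E4 as -> ->.
        assert (Hj3 : nth_error P (test + 3 + length k + 2) = Some (JmpNLe (tmp 0) (tmp 0) test))
          by (now apply Hce).
        pose proof (simulates_jump P _ h (upd (upd N3 (tmp 0) 1) (hid (S h)) (S n)) G3 _ _ _ Hj3) as R6.
        rewrite Nat.leb_refl in R6.
        do 2 eexists. split; [|split; [|split]].
        + eapply simulates_weaken; [|eapply simulates_trans; [apply Nat.le_refl|exact R1|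
            eapply simulates_trans; [apply Nat.le_refl|exact R2|
            eapply simulates_trans; [apply Nat.le_refl|exact R3|
            eapply simulates_trans; [|
               eapply simulates_trans; [|destruct R4 as (t4 & T4 & Q4 & K4); exists t4; split; [exact T4|split; [exact Q4|]]|exact R5]|exact R6]]]]].
          * lia.
          * apply Nat.le_refl.
          * apply Nat.le_refl.
          * intros j Hj. apply K4. lia.
        + rewrite !upd_other; [|apply hid_not_tmp|unfold hid; lia]. rewrite K3 by lia. easy.
        + apply upd_same.
        + rewrite view_upd_hid, view_upd_tmp, V3, V2, V1. reflexivity. }
    destruct (Hloop (B b) (Nat.le_refl _)) as (N & Rg & R1 & Hb1 & Hc1 & V1).
    exists (N, Rg). split.
    + pose proof (simulates_jump P _ h N Rg _ _ _ Hj1) as R2.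
      rewrite Hb1, Hc1, Nat.leb_refl in R2.
      eapply simulates_eq; [|eapply simulates_weaken; [|eapply simulates_trans; [apply Nat.le_refl|exact Ri|
         eapply simulates_trans; [apply Nat.le_refl|exact R1|exact R2]]]].
      * unfold last, test. rewrite !length_app. cbn [length]. fold k. lia.
      * unfold init. rewrite length_app. cbn [length]. lia.
    + rewrite V1. unfold f. now rewrite (HB b Hsb).
Qed.

(** * Candidate orders and subset codes *)

Definition bits (k m : nat) : list nat := filter (Nat.testbit m) (seq 0 k).

Definition members (ds : list nat) (m : nat) : list nat :=
  map (fun d => nth d ds 0) (bits (length ds) m).

(* The orders built from an interval [l] of the angular order, peeled at both ends, and the
   decreasing functions whose positions in [ds] are the binary digits of [m]. *)
Inductive candidate (ds : list nat) : list nat -> nat -> list nat -> Prop :=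
| candidate_nil : candidate ds [] 0 []
| candidate_front x l m s : candidate ds l m s -> candidate ds (x :: l) m (x :: s)
| candidate_back x l m s : candidate ds l m s -> candidate ds (l ++ [x]) m (x :: s)
| candidate_dec d l m s : d < length ds -> Nat.testbit m d = true ->
    candidate ds l (m - 2 ^ d) s -> candidate ds l m (nth d ds 0 :: s).

Lemma mod_pow2_S m d :
  m mod 2 ^ S d = m mod 2 ^ d + (if Nat.testbit m d then 2 ^ d else 0).
Proof.
  rewrite Nat.pow_succ_r', Nat.mul_comm, Nat.Div0.mod_mul_r. f_equal.
  rewrite <- Nat.testbit_spec'. destruct (Nat.testbit m d); cbn [Nat.b2n]; lia.
Qed.

(** This is how the program reads binary digits. Having neither division nor bit operations on
    naturals, it goes down from the highest digit, comparing the remainder with a power of 2 and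
    subtracting. *)
Lemma testbit_le_mod m d : Nat.testbit m d = (2 ^ d <=? m mod 2 ^ S d).
Proof.
  rewrite mod_pow2_S.
  pose proof (Nat.mod_upper_bound m (2 ^ d) ltac:(apply Nat.pow_nonzero; lia)).
  destruct (Nat.testbit m d); symmetry; [apply Nat.leb_le|apply Nat.leb_gt]; lia.
Qed.

Lemma testbit_pow_le m d : Nat.testbit m d = true -> 2 ^ d <= m.
Proof.
  rewrite testbit_le_mod. intros H. apply Nat.leb_le in H.
  pose proof (Nat.Div0.mod_le m (2 ^ S d)). lia.
Qed.

Lemma testbit_sub_pow m d e :
  Nat.testbit m d = true -> Nat.testbit (m - 2 ^ d) e = Nat.testbit m e && negb (e =? d).
Proof.
  intros H. rewrite Nat.sub_nocarry_ldiff.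
  - rewrite Nat.ldiff_spec, Nat.pow2_bits_eqb. now rewrite (Nat.eqb_sym d e).
  - apply Nat.bits_inj_0. intros i. rewrite Nat.ldiff_spec, Nat.pow2_bits_eqb.
    destruct (Nat.eqb_spec d i) as [<-|]; [now rewrite H|reflexivity].
Qed.

Lemma bits_remove k m d :
  d < k -> Nat.testbit m d = true -> Permutation (bits k m) (d :: bits k (m - 2 ^ d)).
Proof.
  intros Hd Hb. apply NoDup_Permutation.
  - apply NoDup_filter, seq_NoDup.
  - constructor; [|apply NoDup_filter, seq_NoDup]. unfold bits. rewrite filter_In.
    rewrite testbit_sub_pow, Nat.eqb_refl, andb_false_r by easy. now intros [_ ?].
  - intros e. unfold bits. cbn [In]. rewrite !filter_In, !in_seq, testbit_sub_pow by easy.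
    destruct (Nat.eqb_spec e d) as [->|Hn].
    + rewrite Hb. cbn. split; [now left|]. intros _. split; [lia|reflexivity].
    + cbn. rewrite andb_true_r. split; [now right|]. intros [|]; [congruence|easy].
Qed.

Lemma members_remove ds m d :
  d < length ds -> Nat.testbit m d = true ->
  Permutation (members ds m) (nth d ds 0 :: members ds (m - 2 ^ d)).
Proof. intros Hd Hb. unfold members. now rewrite (bits_remove _ m d Hd Hb). Qed.

Lemma bits_zero k : bits k 0 = [].
Proof.
  unfold bits. induction (seq 0 k) as [|d l IH]; cbn [filter]; [easy|].
  now rewrite Nat.bits_0.
Qed.

Lemma bits_nil k m : m < 2 ^ k -> bits k m = [] -> m = 0.
Proof.
  intros Hm H. apply Nat.bits_inj_0. intros i. destruct (Nat.lt_ge_cases i k) as [Hi|Hi].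
  - destruct (Nat.testbit m i) eqn:E; [|easy]. exfalso.
    apply (in_nil (a := i)). rewrite <- H. apply filter_In. split; [apply in_seq; lia|easy].
  - destruct (Nat.testbit m i) eqn:E; [|easy]. exfalso. apply testbit_pow_le in E.
    pose proof (Nat.pow_le_mono_r 2 k i ltac:(lia) Hi). lia.
Qed.

Lemma bits_full k : bits k (2 ^ k - 1) = seq 0 k.
Proof.
  unfold bits. rewrite Nat.sub_1_r, <- Nat.ones_equiv.
  assert (H : forall l, (forall x, In x l -> x < k) -> filter (Nat.testbit (Nat.ones k)) l = l).
  { induction l as [|x l IH]; intros Hl; cbn [filter]; [easy|].
    rewrite Nat.ones_spec_low by (apply Hl; now left). f_equal. apply IH.
    intros y Hy. apply Hl. now right. }
  apply H. intros x Hx. apply in_seq in Hx. lia.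
Qed.

Lemma map_nth_seq {T} (l : list T) d : map (fun i => nth i l d) (seq 0 (length l)) = l.
Proof.
  induction l as [|x l IH]; cbn; [easy|]. f_equal. rewrite <- seq_shift, map_map. exact IH.
Qed.

Lemma members_full ds : members ds (2 ^ length ds - 1) = ds.
Proof. unfold members. rewrite bits_full. apply map_nth_seq. Qed.

Lemma candidate_perm ds l m s : candidate ds l m s -> Permutation s (l ++ members ds m).
Proof.
  induction 1 as [|x l m s _ IH|x l m s _ IH|d l m s Hd Hb _ IH].
  - unfold members. now rewrite bits_zero.
  - cbn. now rewrite IH.
  - rewrite IH, <- app_assoc. cbn. apply Permutation_middle.
  - rewrite IH, (members_remove ds m d Hd Hb). apply Permutation_middle.
Qed.

Lemma peels_candidate dec ds l s :
  peels dec l s -> forall m, m < 2 ^ length ds ->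
  Permutation (filter dec s) (members ds m) -> candidate ds l m s.
Proof.
  induction 1 as [|l x s E _ IH|l x s E _ IH|l x s E _ IH]; intros m Hm Hp; cbn in Hp;
    rewrite ?E in Hp.
  - apply Permutation_nil in Hp. unfold members in Hp. apply map_eq_nil, bits_nil in Hp; [|easy].
    subst m. constructor.
  - assert (Hx : In x (members ds m)) by (apply (Permutation_in _ Hp); now left).
    unfold members, bits in Hx. apply in_map_iff in Hx. destruct Hx as (d & <- & Hd).
    apply filter_In in Hd. destruct Hd as [Hd Hb]. apply in_seq in Hd.
    apply candidate_dec; [lia|easy|]. apply IH; [lia|].
    apply (Permutation_cons_inv (a := nth d ds 0)).
    rewrite Hp. apply members_remove; [lia|easy].
  - apply candidate_front. now apply IH.
  - apply candidate_back. now apply IH.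
Qed.

(** Ensures that a state of the table without any transition can only be the one of the empty
    order. *)
Lemma candidate_exists ds l m : m < 2 ^ length ds -> exists s, candidate ds l m s.
Proof.
  intros Hm. induction l as [|x l [s Hs]]; [|eexists; apply candidate_front; exact Hs].
  induction m as [m IH] using lt_wf_ind. destruct (bits (length ds) m) as [|d t] eqn:E.
  - apply bits_nil in E; [|easy]. subst. eexists. constructor.
  - assert (Hd : In d (bits (length ds) m)) by (rewrite E; now left).
    apply filter_In in Hd. destruct Hd as [Hd Hb]. apply in_seq in Hd.
    pose proof (testbit_pow_le m d Hb). pose proof (Nat.pow_nonzero 2 d ltac:(lia)).
    destruct (IH (m - 2 ^ d)) as [s Hs]; [lia|lia|].
    eexists. apply (candidate_dec ds d); [lia|easy|exact Hs].
Qed.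

(** * The algorithm *)

Definition coef_a (e : nexp) : rexp := RCell Input (NTimes (NLit 2) e).
Definition coef_b (e : nexp) : rexp := RCell Input (NPlus (NTimes (NLit 2) e) (NLit 1)).
Definition assign (x : nname) (v : nexp) : cmd := NSet x (NLit 0) v.
Definition rassign (x : rname) (v : rexp) : cmd := RSet x (NLit 0) v.
Definition increment (x : nname) : cmd := assign x (NPlus (NVar x) (NLit 1)).

Definition compute_angle : cmd :=
  Seq (If (RLe (RLit 0) (coef_b (NVar I)))
         (rassign Sum (coef_b (NVar I)))
         (rassign Sum (RMinus (RLit 0) (coef_b (NVar I)))))
  (Seq (rassign Value (RMinus (coef_a (NVar I)) (RLit 1)))
  (If (RLe (RLit 0) (RVar Value))
     (RSet Angle (NVar I) (RQuot (coef_b (NVar I)) (RPlus (RVar Sum) (RVar Value))))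
     (RSet Angle (NVar I) (RMinus (RLit 2)
        (RQuot (coef_b (NVar I)) (RPlus (RVar Sum) (RMinus (RLit 0) (RVar Value)))))))).

Definition classify_body : cmd :=
  Seq compute_angle
  (If (RLe (RLit 0) (coef_a (NVar I)))
     (Seq (NSet Inc (NVar NumInc) (NVar I)) (increment NumInc))
     (Seq (NSet Dec (NVar NumDec) (NVar I)) (increment NumDec))).

Definition classify : cmd :=
  Seq (assign NumInc (NLit 0)) (Seq (assign NumDec (NLit 0)) (For I Size classify_body)).

Definition count_body : cmd :=
  If (RLe (RCell Angle (NCell Inc (NVar I))) (RCell Angle (NCell Inc (NVar J))))
     (If (RLe (RCell Angle (NCell Inc (NVar J))) (RCell Angle (NCell Inc (NVar I))))
         (If (NLe (NVar I) (NVar J)) Skip (increment Place))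
         Skip)
     (increment Place).

(* The sorted list is written twice in a row, so that its rotations are intervals. *)
Definition arrange : cmd :=
  For I NumInc
    (Seq (assign Place (NLit 0))
    (Seq (For J NumInc count_body)
    (Seq (NSet Order (NVar Place) (NCell Inc (NVar I)))
         (NSet Order (NPlus (NVar Place) (NVar NumInc)) (NCell Inc (NVar I)))))).

Definition powers : cmd :=
  Seq (NSet Pow (NLit 0) (NLit 1))
      (For D NumDec
         (NSet Pow (NPlus (NVar D) (NLit 1)) (NTimes (NCell Pow (NVar D)) (NLit 2)))).

(** The first three are loop bounds, one more than the largest subset code, interval length and
    starting point. [Width] is the radix of [state_index], larger than all lengths and starting
    points, so that distinct states get distinct indices. *)
Definition bounds : cmd :=
  Seq (assign Subsets (NCell Pow (NVar NumDec)))
  (Seq (assign Lengths (NPlus (NVar NumInc) (NLit 1)))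
  (Seq (assign Starts (NPlus (NTimes (NLit 2) (NVar NumInc)) (NLit 1)))
       (assign Width (NPlus (NTimes (NLit 2) (NVar Size)) (NLit 1))))).

Definition state_index (m l i : nexp) : nexp :=
  NPlus (NTimes (NPlus (NTimes m (NVar Width)) l) (NVar Width)) i.

Definition record : cmd :=
  Seq (NSet Choice (NVar Here) (NVar Elem))
  (Seq (NSet Next (NVar Here) (NVar Prev))
  (Seq (RSet Slope (NVar Here) (RTimes (RCell Slope (NVar Prev)) (coef_a (NVar Elem))))
  (Seq (RSet Offset (NVar Here) (RVar Value))
       (assign Found (NLit 1))))).

(** [Found] tells whether a transition has been recorded for the current state: no real number could
    serve as an infinite initial value. *)
Definition consider (prev elem : nexp) : cmd :=
  Seq (assign Prev prev)
  (Seq (assign Elem elem)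
  (Seq (rassign Value (RPlus (RTimes (RCell Slope (NVar Prev)) (coef_b (NVar Elem)))
                             (RCell Offset (NVar Prev))))
  (If (NLe (NVar Found) (NLit 0)) record
     (If (RLe (RCell Offset (NVar Here)) (RVar Value)) Skip record)))).

Definition digit_body : cmd :=
  Seq (assign Place (NMinus (NMinus (NVar NumDec) (NLit 1)) (NVar D)))
  (If (NLe (NCell Pow (NVar Place)) (NVar Rest))
     (Seq (assign Rest (NMinus (NVar Rest) (NCell Pow (NVar Place))))
          (consider (state_index (NMinus (NVar K) (NCell Pow (NVar Place))) (NVar J) (NVar I))
                    (NCell Dec (NVar Place))))
     Skip).

(** The outer test amounts to [i + l <= 2 * u], where [u] is the value of [NumInc]: the interval
    must lie within the doubled list. Slope 1 and offset 0 are those of the empty order, and any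
    transition overwrites them. *)
Definition state_body : cmd :=
  If (NLe (NPlus (NPlus (NVar I) (NVar J)) (NLit 1)) (NVar Starts))
  (Seq (assign Here (state_index (NVar K) (NVar J) (NVar I)))
  (Seq (RSet Slope (NVar Here) (RLit 1))
  (Seq (RSet Offset (NVar Here) (RLit 0))
  (Seq (assign Found (NLit 0))
  (Seq (If (NLe (NLit 1) (NVar J))
          (Seq (consider (state_index (NVar K) (NMinus (NVar J) (NLit 1)) (NPlus (NVar I) (NLit 1)))
                         (NCell Order (NVar I)))
               (consider (state_index (NVar K) (NMinus (NVar J) (NLit 1)) (NVar I))
                         (NCell Order (NMinus (NPlus (NVar I) (NVar J)) (NLit 1)))))
          Skip)
  (Seq (assign Rest (NVar K))
       (For D NumDec digit_body)))))))
  Skip.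

(** States are visited in increasing order of their indices. A transition leads to a smaller index:
    it either removes a digit from the subset, or shortens the interval, whose start then grows by
    at most one, less than the radix. *)
Definition fill : cmd := For K Subsets (For J Lengths (For I Starts state_body)).

Definition full (i : nexp) : nexp := state_index (NMinus (NVar Subsets) (NLit 1)) (NVar NumInc) i.

Definition select : cmd :=
  Seq (assign Cursor (full (NLit 0)))
      (For I Lengths
         (Seq (assign Here (full (NVar I)))
              (If (RLe (RCell Offset (NVar Cursor)) (RCell Offset (NVar Here)))
                 Skip (assign Cursor (NVar Here))))).

(* The answer is written beyond the output registers, for [Out] is interleaved with other arrays. *)
Definition emit : cmd :=
  For I Size
    (Seq (NSet Out (NPlus (NPlus (NVar Size) (NLit 32)) (NVar I)) (NCell Choice (NVar Cursor)))
         (assign Cursor (NCell Next (NVar Cursor)))).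

(** Negating the offsets negates the constant term of every order and keeps the slopes, so a minimum
    permutation of the mirrored functions is a maximum permutation of the given ones. *)
Definition mirror : cmd :=
  For I Size (RSet Input (NPlus (NTimes (NLit 2) (NVar I)) (NLit 1))
                (RMinus (RLit 0) (coef_b (NVar I)))).

(** * Program logic and classification of the functions *)

Definition vec {T} (f : nat -> T) (n : nat) : list T := map f (seq 0 n).

Lemma vec_upd_last {T} (f : nat -> T) n v : vec (upd f n v) (S n) = vec f n ++ [v].
Proof.
  unfold vec. rewrite seq_S, map_app. cbn. rewrite upd_same. f_equal.
  apply map_ext_in. intros i Hi. apply in_seq in Hi. apply upd_other. lia.
Qed.

Lemma nth_vec {T} (f : nat -> T) n i d : i < n -> nth i (vec f n) d = f i.
Proof.
  intros H. unfold vec. rewrite nth_indep with (d' := f 0) by (now rewrite length_map, length_seq).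
  rewrite map_nth, seq_nth by easy. reflexivity.
Qed.

Definition slopes (s : store) (x : nat) : R := real_at s Input (2 * x).
Definition offsets (s : store) (x : nat) : R := real_at s Input (2 * x + 1).

Definition nondecb (a : nat -> R) (x : nat) : bool := if Rle_dec 0 (a x) then true else false.

(** A weakest precondition. Stating it as a predicate keeps [run] folded, so the rules [holds_seq],
    [holds_nset], ... can execute a program symbolically, one command at a time. *)
Definition holds (c : cmd) (Q : store -> Prop) (s : store) : Prop := Q (run c s).

Lemma holds_seq c1 c2 Q s : holds c1 (holds c2 Q) s -> holds (Seq c1 c2) Q s.
Proof. easy. Qed.

Lemma holds_skip (Q : store -> Prop) s : Q s -> holds Skip Q s.
Proof. easy. Qed.

Lemma holds_nset x e v (Q : store -> Prop) s i u :
  neval e s = i -> neval v s = u -> Q (set_nat s x i u) -> holds (NSet x e v) Q s.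
Proof. now intros <- <-. Qed.

Lemma holds_rset x e v (Q : store -> Prop) s i u :
  neval e s = i -> reval v s = u -> Q (set_real s x i u) -> holds (RSet x e v) Q s.
Proof. now intros <- <-. Qed.

Lemma holds_if_nat e1 e2 c1 c2 Q s u v :
  neval e1 s = u -> neval e2 s = v -> (u <= v -> holds c1 Q s) -> (v < u -> holds c2 Q s) ->
  holds (If (NLe e1 e2) c1 c2) Q s.
Proof.
  intros <- <- H1 H2. unfold holds in *. cbn [run ceval].
  destruct (Nat.leb_spec (neval e1 s) (neval e2 s)); auto.
Qed.

Lemma holds_if_real e1 e2 c1 c2 Q s u v :
  reval e1 s = u -> reval e2 s = v ->
  ((u <= v)%R -> holds c1 Q s) -> (~ (u <= v)%R -> holds c2 Q s) ->
  holds (If (RLe e1 e2) c1 c2) Q s.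
Proof.
  intros <- <- H1 H2. unfold holds in *. cbn [run ceval].
  destruct (Rle_dec (reval e1 s) (reval e2 s)); auto.
Qed.

Lemma holds_for (Inv : nat -> store -> Prop) x b c (Q : store -> Prop) s n :
  nat_at s b 0 = n -> Inv 0 s ->
  (forall i s', i < n -> Inv i s' -> holds c (Inv (S i)) (set_nat s' x 0 i)) ->
  (forall s', Inv n s' -> Q s') -> holds (For x b c) Q s.
Proof. intros <- H0 HS HQ. apply HQ. apply (for_loop_inv Inv); auto. Qed.

Lemma holds_weaken c (Q Q' : store -> Prop) s :
  holds c Q s -> (forall s', Q s' -> Q' s') -> holds c Q' s.
Proof. unfold holds. auto. Qed.

Ltac value := cbn -[Nat.add Nat.mul Nat.sub Nat.pow]; reflexivity.

Ltac read := cbn [nat_at real_at set_nat set_real nname_beq rname_beq].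

Ltac step :=
  lazymatch goal with
  | |- holds (Seq _ _) _ _ => apply holds_seq
  | |- holds Skip _ _ => apply holds_skip
  | |- holds (NSet _ _ _) _ _ => eapply holds_nset; [value|value|]
  | |- holds (RSet _ _ _) _ _ => eapply holds_rset; [value|value|]
  | |- holds (If (NLe _ _) _ _) _ _ => eapply holds_if_nat; [value|value|intros ?|intros ?]
  | |- holds (If (RLe _ _) _ _) _ _ => eapply holds_if_real; [value|value|intros ?|intros ?]
  | |- holds ?c _ _ => let c' := eval hnf in c in change c with c'
  end.

Lemma compute_angle_ok s (Q : store -> Prop) :
  (forall s', nat_at s' = nat_at s -> real_at s' Input = real_at s Input ->
     real_at s' Angle = upd (real_at s Angle) (nat_at s I 0)
       (pseudo_angle (offsets s (nat_at s I 0)) (slopes s (nat_at s I 0) - 1)) -> Q s') ->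
  holds compute_angle Q s.
Proof.
  intros HQ. unfold compute_angle. repeat step; apply HQ; try reflexivity;
    cbn -[Nat.add Nat.mul]; f_equal; unfold pseudo_angle, slopes, offsets;
    destruct (Rle_dec 0 (real_at s Input (2 * nat_at s I 0) - 1)); try contradiction;
    repeat f_equal; unfold Rabs;
    repeat match goal with |- context [Rcase_abs ?x] => destruct (Rcase_abs x) end; lra.
Qed.

Lemma filter_snoc {T} (f : T -> bool) l x :
  filter f (l ++ [x]) = filter f l ++ if f x then [x] else [].
Proof. now rewrite filter_app. Qed.

Lemma classify_ok s (Q : store -> Prop) n a b :
  nat_at s Size 0 = n -> slopes s = a -> offsets s = b ->
  (forall s',
     nat_at s' Size 0 = n -> real_at s' Input = real_at s Input ->
     vec (nat_at s' Inc) (nat_at s' NumInc 0) = filter (nondecb a) (seq 0 n) ->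
     vec (nat_at s' Dec) (nat_at s' NumDec 0) = filter (fun x => negb (nondecb a x)) (seq 0 n) ->
     (forall x, x < n -> real_at s' Angle x = pseudo_angle (b x) (a x - 1)) -> Q s') ->
  holds classify Q s.
Proof.
  intros Hn Ha Hb HQ. unfold classify, assign. repeat step.
  apply (holds_for (fun i s' =>
     nat_at s' Size 0 = n /\ real_at s' Input = real_at s Input /\
     vec (nat_at s' Inc) (nat_at s' NumInc 0) = filter (nondecb a) (seq 0 i) /\
     vec (nat_at s' Dec) (nat_at s' NumDec 0) = filter (fun x => negb (nondecb a x)) (seq 0 i) /\
     forall x, x < i -> real_at s' Angle x = pseudo_angle (b x) (a x - 1))) with (n := n).
  - cbn. exact Hn.
  - cbn. repeat split; try easy; try lia.
  - intros i s' Hi (I1 & I2 & I3 & I4 & I5). unfold classify_body. step.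
    apply compute_angle_ok. intros s2 E1 E2 E3.
    assert (Ea : forall t, real_at t Input = real_at s Input -> slopes t = a)
      by (intros t Et; unfold slopes in *; now rewrite Et).
    assert (Eb : forall t, real_at t Input = real_at s Input -> offsets t = b)
      by (intros t Et; unfold offsets in *; now rewrite Et).
    rewrite (Ea (set_nat s' I 0 i)), (Eb (set_nat s' I 0 i)) in E3 by exact I2.
    cbn -[Nat.mul Nat.add] in E1, E2, E3.
    assert (E5 : forall x, x < S i -> real_at s2 Angle x = pseudo_angle (b x) (a x - 1)).
    { intros x Hx. rewrite E3. destruct (Nat.eq_dec x i) as [->|Hx'].
      - apply upd_same.
      - rewrite upd_other by easy. apply I5. lia. }
    assert (Ei : nat_at s2 I 0 = i) by now rewrite E1.
    assert (Eai : real_at s2 Input (2 * nat_at s2 I 0) = a i)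
      by (rewrite Ei, E2, I2, <- Ha; reflexivity).
    assert (Ni : nat_at s2 Size = nat_at s' Size /\ nat_at s2 Inc = nat_at s' Inc /\
       nat_at s2 NumInc = nat_at s' NumInc /\ nat_at s2 Dec = nat_at s' Dec /\
       nat_at s2 NumDec = nat_at s' NumDec) by now rewrite E1.
    destruct Ni as (N1 & N2 & N3 & N4 & N5). clear E1.
    unfold coef_a. eapply holds_if_real; [value|value|intros Hc|intros Hc];
      cbn -[Nat.mul] in Hc; rewrite Eai in Hc; unfold increment, assign; repeat step;
      read; rewrite N1, E2, seq_S, !filter_snoc; cbn [Nat.add];
      unfold nondecb at 2 4; destruct (Rle_dec 0 (a i)) as [Hd|Hd]; try contradiction; cbn [negb];
      rewrite ?app_nil_r.
    + repeat split; auto; [|now rewrite N4, N5].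
      rewrite N2, N3, Ei. rewrite upd_same, Nat.add_1_r, vec_upd_last. now rewrite I3.
    + repeat split; auto; [now rewrite N2, N3|].
      rewrite N4, N5, Ei. rewrite upd_same, Nat.add_1_r, vec_upd_last. now rewrite I4.
  - intros s' (I1 & I2 & I3 & I4 & I5). now apply HQ.
Qed.

(** * Sorting by counting predecessors *)

Definition precb (f : nat -> R) (i j : nat) : bool :=
  if Rle_dec (f j) (f i) then if Rle_dec (f i) (f j) then i <? j else false else true.

(** The rank of [i] in the sorted list. Since [precb] breaks ties by position, it is a strict total
    order and distinct indices get distinct ranks. *)
Definition place (f : nat -> R) (n i : nat) : nat :=
  length (filter (fun j => precb f j i) (seq 0 n)).

Lemma precb_irrefl f i : precb f i i = false.
Proof. unfold precb. destruct (Rle_dec (f i) (f i)); [apply Nat.ltb_irrefl|lra]. Qed.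

Lemma precb_trans f i j l : precb f i j = true -> precb f j l = true -> precb f i l = true.
Proof.
  unfold precb. destruct (Rle_dec (f j) (f i)), (Rle_dec (f i) (f j)), (Rle_dec (f l) (f j)),
    (Rle_dec (f j) (f l)), (Rle_dec (f l) (f i)), (Rle_dec (f i) (f l)); try lra; try discriminate;
    rewrite ?Nat.ltb_lt; lia || auto.
Qed.

Lemma precb_total f i j : i <> j -> precb f i j = false -> precb f j i = true.
Proof.
  unfold precb. intros Hn. destruct (Rle_dec (f j) (f i)), (Rle_dec (f i) (f j)); try lra;
    try discriminate; auto. rewrite Nat.ltb_ge, Nat.ltb_lt. lia.
Qed.

Lemma precb_le f i j : precb f i j = true -> (f i <= f j)%R.
Proof.
  unfold precb. destruct (Rle_dec (f j) (f i)), (Rle_dec (f i) (f j)); try lra; discriminate.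
Qed.

Lemma place_mono f n i j : i < n -> precb f i j = true -> place f n i < place f n j.
Proof.
  intros Hi Hp. unfold place.
  apply (Nat.lt_le_trans _ (length (i :: filter (fun l => precb f l i) (seq 0 n)))); [cbn; lia|].
  apply NoDup_incl_length.
  - constructor; [|apply NoDup_filter, seq_NoDup]. rewrite filter_In, precb_irrefl. now intros [_ ?].
  - intros l [<-|Hl]; apply filter_In.
    + split; [apply in_seq; lia|easy].
    + apply filter_In in Hl. destruct Hl as [Hl Hb]. split; [easy|].
      now apply (precb_trans f l i j).
Qed.

Lemma place_lt f n i : i < n -> place f n i < n.
Proof.
  intros Hi. unfold place.
  apply (Nat.lt_le_trans _ (length (i :: filter (fun l => precb f l i) (seq 0 n)))); [cbn; lia|].
  rewrite <- (length_seq n 0) at 2. apply NoDup_incl_length.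
  - constructor; [|apply NoDup_filter, seq_NoDup]. rewrite filter_In, precb_irrefl. now intros [_ ?].
  - intros l [<-|Hl]; [apply in_seq; lia|]. now apply filter_In in Hl.
Qed.

Lemma place_inj f n : bInjective n (place f n).
Proof.
  intros i j Hi Hj E. destruct (Nat.eq_dec i j) as [|Hn]; [easy|exfalso].
  destruct (precb f i j) eqn:Eb.
  - apply (place_mono f n) in Eb; lia.
  - apply precb_total in Eb; [|easy]. apply (place_mono f n) in Eb; lia.
Qed.

Lemma vec_length {T} (f : nat -> T) n : length (vec f n) = n.
Proof. unfold vec. now rewrite length_map, length_seq. Qed.

Lemma vec_S {T} (f : nat -> T) n : vec f (S n) = vec f n ++ [f n].
Proof. unfold vec. now rewrite seq_S, map_app. Qed.

Lemma vec_sorted {T} (P : T -> T -> Prop) (f : nat -> T) n :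
  (forall p q, p < q -> q < n -> P (f p) (f q)) -> StronglySorted P (vec f n).
Proof.
  induction n as [|n IH]; intros H; [constructor|]. rewrite vec_S. apply sorted_app.
  - apply IH. intros; apply H; lia.
  - repeat constructor.
  - intros x y Hx [<-|[]]. unfold vec in Hx. apply in_map_iff in Hx.
    destruct Hx as (p & <- & Hp). apply in_seq in Hp. apply H; lia.
Qed.

(** [place] is an injection of the indices below [n] into themselves, hence a bijection. So every
    cell of [o] below [n] is described by the hypothesis, and the order of the cells is that of
    [precb]. *)
Lemma placed_sorted (F : nat -> R) (g o : nat -> nat) n :
  (forall i, i < n -> o (place (fun i => F (g i)) n i) = g i) ->
  Permutation (vec o n) (vec g n) /\ StronglySorted (fun x y => F x <= F y)%R (vec o n).
Proof.
  intros H. set (f := fun i => F (g i)) in *. split.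
  - apply (Permutation_nth (vec o n) (vec g n) 0). cbv zeta. rewrite !vec_length.
    split; [easy|]. exists (place f n). split; [intros i Hi; now apply place_lt|].
    split; [apply place_inj|]. intros i Hi. rewrite !nth_vec; [|now apply place_lt|easy].
    symmetry. now apply H.
  - apply vec_sorted. intros p q Hpq Hq.
    assert (Hs : bSurjective n (place f n)).
    { apply bInjective_bSurjective; [intros i Hi; now apply place_lt|apply place_inj]. }
    destruct (Hs p ltac:(lia)) as (i & Hi & Ei). destruct (Hs q Hq) as (j & Hj & Ej).
    rewrite <- Ei, <- Ej, !H by easy. apply (precb_le f).
    destruct (precb f i j) eqn:Eb; [easy|exfalso].
    apply precb_total in Eb; [|intros ->; lia]. apply (place_mono f n) in Eb; lia.
Qed.

Lemma arrange_ok s (Q : store -> Prop) u :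
  nat_at s NumInc 0 = u ->
  (forall s', nat_at s' Size = nat_at s Size -> nat_at s' NumDec = nat_at s NumDec ->
     nat_at s' NumInc = nat_at s NumInc -> nat_at s' Dec = nat_at s Dec ->
     real_at s' = real_at s ->
     Permutation (vec (nat_at s' Order) u) (vec (nat_at s Inc) u) ->
     StronglySorted (fun x y => real_at s Angle x <= real_at s Angle y)%R (vec (nat_at s' Order) u) ->
     (forall i, i < u -> nat_at s' Order (i + u) = nat_at s' Order i) -> Q s') ->
  holds arrange Q s.
Proof.
  intros Hu HQ. unfold arrange.
  set (f := fun i => real_at s Angle (nat_at s Inc i)).
  apply (holds_for (fun i s' =>
    nat_at s' Size = nat_at s Size /\ nat_at s' NumDec = nat_at s NumDec /\
    nat_at s' NumInc = nat_at s NumInc /\ nat_at s' Dec = nat_at s Dec /\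
    nat_at s' Inc = nat_at s Inc /\ real_at s' = real_at s /\
    forall j, j < i -> nat_at s' Order (place f u j) = nat_at s Inc j /\
                       nat_at s' Order (place f u j + u) = nat_at s Inc j)) with (n := u).
  - exact Hu.
  - repeat split; auto; lia.
  - intros i s' Hi (I1 & I2 & I3 & I4 & I5 & I6 & I7). unfold assign. do 3 step.
    apply (holds_for (fun j s2 => nat_at s2 Size = nat_at s Size /\ nat_at s2 NumDec = nat_at s NumDec /\
       nat_at s2 NumInc = nat_at s NumInc /\ nat_at s2 Dec = nat_at s Dec /\
       nat_at s2 Inc = nat_at s Inc /\ real_at s2 = real_at s /\
       nat_at s2 Order = nat_at s' Order /\ nat_at s2 I 0 = i /\
       nat_at s2 Place 0 = length (filter (fun j => precb f j i) (seq 0 j)))) with (n := u).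
    + read. now rewrite I3.
    + read. repeat split; auto.
    + intros j s2 Hj (J1 & J2 & J3 & J4 & J5 & J6 & J7 & J8 & J9).
      assert (E : forall b : bool, precb f j i = b ->
         length (filter (fun j => precb f j i) (seq 0 (S j)))
         = length (filter (fun j => precb f j i) (seq 0 j)) + if b then 1 else 0).
      { intros b <-. rewrite seq_S, filter_snoc, length_app. cbn [Nat.add].
        now destruct (precb f j i). }
      assert (F : forall l, real_at s2 Angle (nat_at s2 Inc l) = f l)
        by (intros l; unfold f; now rewrite J5, J6).
      assert (G : forall s3, nat_at s3 Size = nat_at s2 Size -> nat_at s3 NumDec = nat_at s2 NumDec ->
         nat_at s3 NumInc = nat_at s2 NumInc -> nat_at s3 Dec = nat_at s2 Dec ->
         nat_at s3 Inc = nat_at s2 Inc -> real_at s3 = real_at s2 ->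
         nat_at s3 Order = nat_at s2 Order -> nat_at s3 I = nat_at s2 I ->
         nat_at s3 Place 0 = nat_at s2 Place 0 + (if precb f j i then 1 else 0) ->
         nat_at s3 Size = nat_at s Size /\ nat_at s3 NumDec = nat_at s NumDec /\
         nat_at s3 NumInc = nat_at s NumInc /\ nat_at s3 Dec = nat_at s Dec /\
         nat_at s3 Inc = nat_at s Inc /\ real_at s3 = real_at s /\
         nat_at s3 Order = nat_at s' Order /\ nat_at s3 I 0 = i /\
         nat_at s3 Place 0 = length (filter (fun j => precb f j i) (seq 0 (S j)))).
      { intros s3 G1 G2 G3 G4 G5 G6 G7 G8 G9. rewrite (E _ eq_refl), <- J9.
        repeat split; try congruence. }
      unfold count_body, increment, assign.
      eapply holds_if_real; [value|value|intros H1|intros H1]; read; idtac;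
        cbn [nat_at real_at set_nat nname_beq] in H1; rewrite J8, !F in H1.
      * eapply holds_if_real; [value|value|intros H2|intros H2]; read; 
        cbn [nat_at real_at set_nat nname_beq] in H2; rewrite ?upd_same, J8, !F in H2.
        -- step; cbn [nat_at real_at set_nat nname_beq] in H; rewrite ?upd_same, J8 in H; step; apply G; try reflexivity; read;
           unfold precb; destruct (Rle_dec (f i) (f j)), (Rle_dec (f j) (f i)); try contradiction.
           ++ destruct (Nat.ltb_spec j i); lia.
           ++ rewrite upd_same. destruct (Nat.ltb_spec j i); lia.
        -- step. apply G; try reflexivity; read. unfold precb.
           destruct (Rle_dec (f i) (f j)), (Rle_dec (f j) (f i)); try contradiction. lia.
      * step. apply G; try reflexivity; read. rewrite ?upd_same. unfold precb.
        destruct (Rle_dec (f i) (f j)); try contradiction. lia.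
    + intros s2 (J1 & J2 & J3 & J4 & J5 & J6 & J7 & J8 & J9). fold (place f u i) in J9.
      do 3 step. read. rewrite J8, J9, J5, J7, J3, Hu. repeat split; auto.
      all: destruct (Nat.eq_dec j i) as [->|Hj]; [|destruct (I7 j ltac:(lia)) as [A1 A2]].
      all: pose proof (place_lt f u i Hi) as Li.
      * unfold upd. rewrite Nat.eqb_refl. now destruct (_ =? _).
      * assert (place f u j <> place f u i) by (intros E; apply place_inj in E; lia).
        pose proof (place_lt f u j ltac:(lia)). rewrite !upd_other by lia. exact A1.
      * apply upd_same.
      * assert (place f u j <> place f u i) by (intros E; apply place_inj in E; lia).
        pose proof (place_lt f u j ltac:(lia)). rewrite !upd_other by lia. exact A2.
  - intros s' (I1 & I2 & I3 & I4 & I5 & I6 & I7).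
    destruct (placed_sorted (real_at s Angle) (nat_at s Inc) (nat_at s' Order) u) as [P1 P2].
    { intros i Hi. now apply I7. }
    apply HQ; auto. intros p Hp.
    assert (Hs : bSurjective u (place f u)).
    { apply bInjective_bSurjective; [intros i Hi; now apply place_lt|apply place_inj]. }
    destruct (Hs p Hp) as (i & Hi & <-). destruct (I7 i Hi) as [-> ->]. reflexivity.
Qed.

Lemma powers_ok s (Q : store -> Prop) k :
  nat_at s NumDec 0 = k ->
  (forall s', nat_at s' Size = nat_at s Size -> nat_at s' NumDec = nat_at s NumDec ->
     nat_at s' NumInc = nat_at s NumInc -> nat_at s' Dec = nat_at s Dec ->
     nat_at s' Order = nat_at s Order -> real_at s' = real_at s ->
     (forall d, d <= k -> nat_at s' Pow d = 2 ^ d) -> Q s') ->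
  holds powers Q s.
Proof.
  intros Hk HQ. unfold powers. do 2 step.
  apply (holds_for (fun i s' =>
    nat_at s' Size = nat_at s Size /\ nat_at s' NumDec = nat_at s NumDec /\
    nat_at s' NumInc = nat_at s NumInc /\ nat_at s' Dec = nat_at s Dec /\
    nat_at s' Order = nat_at s Order /\ real_at s' = real_at s /\
    forall d, d <= i -> nat_at s' Pow d = 2 ^ d)) with (n := k).
  - exact Hk.
  - repeat split; auto. intros d Hd. now replace d with 0 by lia.
  - intros i s' Hi (I1 & I2 & I3 & I4 & I5 & I6 & I7). step. read. repeat split; auto.
    intros d Hd. destruct (Nat.eq_dec d (S i)) as [->|].
    + rewrite Nat.add_1_r, upd_same, I7, Nat.pow_succ_r' by lia. lia.
    + rewrite upd_other by lia. apply I7. lia.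
  - intros s' (I1 & I2 & I3 & I4 & I5 & I6 & I7). now apply HQ.
Qed.

(** * Correctness of the dynamic program *)

Fixpoint inputfree (c : cmd) : bool :=
  match c with
  | Skip | NSet _ _ _ => true
  | RSet x _ _ => negb (rname_beq x Input)
  | Seq c1 c2 | If _ c1 c2 => inputfree c1 && inputfree c2
  | For _ _ c => inputfree c
  end.

Definition kept (F : nname -> bool) (s s' : store) : Prop :=
  (forall y, F y = true -> nat_at s' y = nat_at s y) /\ real_at s' Input = real_at s Input.

Lemma kept_trans F s1 s2 s3 : kept F s1 s2 -> kept F s2 s3 -> kept F s1 s3.
Proof.
  intros [H1 H2] [H3 H4]. split; [|congruence]. intros y Hy. now rewrite H3, H1.
Qed.

Lemma kept_weaken (F G : nname -> bool) s s' :
  (forall y, G y = true -> F y = true) -> kept F s s' -> kept G s s'.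
Proof. intros H [H1 H2]. split; auto. Qed.

Lemma kept_set_nat F s x i v : F x = false -> kept F s (set_nat s x i v).
Proof.
  intros H. split; [|reflexivity]. intros y Hy. apply set_nat_other. congruence.
Qed.

Lemma run_kept F c s : stable F c = true -> inputfree c = true -> kept F s (run c s).
Proof.
  intros Hs Hi. split; [intros y Hy; now apply (run_stable F)|]. clear Hs.
  revert s. induction c as [|x e v|x e v|c1 IH1 c2 IH2|b c1 IH1 c2 IH2|x b c IH];
    intros s; cbn [inputfree run] in *; try reflexivity.
  - cbn. destruct x; try reflexivity. discriminate.
  - apply andb_prop in Hi. destruct Hi. rewrite IH2, IH1; auto.
  - apply andb_prop in Hi. destruct Hi. destruct (ceval b s); auto.
  - apply (for_loop_inv (fun _ s' => real_at s' Input = real_at s Input)); [reflexivity|].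
    intros i s' _ H. rewrite IH; auto.
Qed.

(** A frame rule: what a command leaves unchanged is decided by its syntax, so the invariants need
    only mention what changes. *)
Lemma holds_kept F c (Q : store -> Prop) s :
  stable F c = true -> inputfree c = true ->
  holds c (fun s' => kept F s s' -> Q s') s -> holds c Q s.
Proof. intros Hs Hi H. apply H. now apply run_kept. Qed.

Lemma holds_for_kept F (Inv : nat -> store -> Prop) x b c (Q : store -> Prop) s n :
  stable F (For x b c) = true -> inputfree c = true ->
  nat_at s b 0 = n -> Inv 0 s ->
  (forall i s', i < n -> kept F s s' -> Inv i s' -> holds c (Inv (S i)) (set_nat s' x 0 i)) ->
  (forall s', kept F s s' -> Inv n s' -> Q s') -> holds (For x b c) Q s.
Proof.
  intros Hs Hi Hn H0 HS HQ.
  apply (holds_for (fun i s' => kept F s s' /\ Inv i s')) with (n := n); auto.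
  - split; [split; auto|easy].
  - intros i s' Hlt [Hk HI]. cbn [stable] in Hs. apply andb_prop in Hs. destruct Hs as [Hs Hc].
    apply andb_prop in Hs. destruct Hs as [Hx _]. split; [|now apply HS].
    apply (kept_trans F s (set_nat s' x 0 i)).
    + apply (kept_trans F s s'); [easy|]. apply kept_set_nat. now destruct (F x).
    + now apply run_kept.
  - intros s' [Hk HI]. now apply HQ.
Qed.

Definition interval (ord : nat -> nat) (i l : nat) : list nat := vec (fun j => ord (i + j)) l.

Lemma interval_front ord i l : interval ord i (S l) = ord i :: interval ord (i + 1) l.
Proof.
  unfold interval, vec. cbn [seq map]. rewrite Nat.add_0_r. f_equal.
  rewrite <- seq_shift, map_map. apply map_ext. intros j. f_equal. lia.
Qed.

Lemma interval_back ord i l : interval ord i (S l) = interval ord i l ++ [ord (i + l)].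
Proof. exact (vec_S (fun j => ord (i + j)) l). Qed.

Lemma candidate_inv ds l m t : candidate ds l m t ->
  (l = [] /\ m = 0 /\ t = []) \/
  (exists x l' t', l = x :: l' /\ t = x :: t' /\ candidate ds l' m t') \/
  (exists x l' t', l = l' ++ [x] /\ t = x :: t' /\ candidate ds l' m t') \/
  (exists d t', d < length ds /\ Nat.testbit m d = true /\ t = nth d ds 0 :: t' /\
                candidate ds l (m - 2 ^ d) t').
Proof.
  intros [|x l' m' t' H|x l' m' t' H|d l' m' t' Hd Hb H].
  - left. auto.
  - right; left. exists x, l', t'. auto.
  - right; right; left. exists x, l', t'. auto.
  - right; right; right. exists d, t'. auto.
Qed.

(** The links from state [x] spell the order [t]. As they strictly decrease, the trace depends only
    on the cells up to [x] and survives all later writes. *)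
Fixpoint traced (ch nx : nat -> nat) (x : nat) (t : list nat) : Prop :=
  match t with
  | [] => True
  | y :: t' => ch x = y /\ nx x < x /\ traced ch nx (nx x) t'
  end.

Lemma traced_ext ch nx ch' nx' x t :
  (forall y, y <= x -> ch' y = ch y /\ nx' y = nx y) -> traced ch nx x t -> traced ch' nx' x t.
Proof.
  revert x. induction t as [|y t IH]; cbn; intros x H; [easy|]. intros (H1 & H2 & H3).
  destruct (H x (Nat.le_refl x)) as [-> ->]. repeat split; auto.
  apply IH; [|easy]. intros z Hz. apply H. lia.
Qed.

Record setting : Type := Setting {
  width : nat;
  incs : nat;
  decs : list nat;
  order : nat -> nat;
  coefa : nat -> R;
  coefb : nat -> R }.

Definition is_static (y : nname) : bool :=
  match y with
  | Size | NumDec | NumInc | Starts | Lengths | Subsets | Width | Dec | Order | Pow => true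
  | _ => false
  end.

Definition env (g : setting) (s : store) : Prop :=
  nat_at s Width 0 = width g /\ nat_at s NumInc 0 = incs g /\
  nat_at s NumDec 0 = length (decs g) /\
  (forall d, d < length (decs g) -> nat_at s Dec d = nth d (decs g) 0) /\
  nat_at s Order = order g /\ (forall d, d <= length (decs g) -> nat_at s Pow d = 2 ^ d) /\
  nat_at s Subsets 0 = 2 ^ length (decs g) /\ nat_at s Lengths 0 = S (incs g) /\
  nat_at s Starts 0 = S (2 * incs g) /\
  slopes s = coefa g /\ offsets s = coefb g.

Lemma env_kept F g s s' :
  (forall y, is_static y = true -> F y = true) -> kept F s s' -> env g s -> env g s'.
Proof.
  intros HF [H1 H2] (E1 & E2 & E3 & E4 & E5 & E6 & E7 & E8 & E9 & E10 & E11).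
  unfold env, slopes, offsets in *. rewrite H2.
  repeat match goal with |- context [nat_at s' ?y] => rewrite (H1 y) by (now apply HF) end.
  repeat split; auto.
Qed.

(** The table is filled in increasing order of indices, so the rows below the current state [x] are
    final. *)
Definition same_below (x : nat) (s s' : store) : Prop :=
  forall y, y < x -> nat_at s' Choice y = nat_at s Choice y /\ nat_at s' Next y = nat_at s Next y /\
    real_at s' Slope y = real_at s Slope y /\ real_at s' Offset y = real_at s Offset y.

Definition traces (g : setting) (s : store) (x : nat) (t : list nat) : Prop :=
  real_at s Slope x = slope (coefa g) t /\ real_at s Offset x = const (coefa g) (coefb g) t /\
  traced (nat_at s Choice) (nat_at s Next) x t.

Lemma traces_below g s s' x y t : same_below x s s' -> y < x -> traces g s y t -> traces g s' y t.
Proof.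
  intros H Hy (T1 & T2 & T3). unfold traces. destruct (H y Hy) as (_ & _ & -> & ->).
  repeat split; auto. apply (traced_ext (nat_at s Choice) (nat_at s Next)); [|easy].
  intros z Hz. destruct (H z ltac:(lia)) as (-> & -> & _). auto.
Qed.

Definition optimal_in (g : setting) (Q : list nat -> Prop) (t : list nat) : Prop :=
  Q t /\ forall t', Q t' -> (const (coefa g) (coefb g) t <= const (coefa g) (coefb g) t')%R.

Definition entry (g : setting) (s : store) (l : list nat) (m x : nat) : Prop :=
  exists t, optimal_in g (candidate (decs g) l m) t /\ traces g s x t.

(** [Q] is the set of orders covered by the transitions tried so far at state [x]. While it is
    empty, the cell describes the empty order. *)
Definition best (g : setting) (s : store) (Q : list nat -> Prop) (x : nat) : Prop :=
  (nat_at s Found 0 = 0 /\ (forall t, ~ Q t) /\ traces g s x []) \/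
  (nat_at s Found 0 = 1 /\ exists t, optimal_in g Q t /\ traces g s x t).

Lemma best_ext g s Q Q' x : (forall t, Q t <-> Q' t) -> best g s Q x -> best g s Q' x.
Proof.
  intros H [(H1 & H2 & H3)|(H1 & t & [H2 H3] & H4)].
  - left. repeat split; auto; try apply H3. intros t Ht. apply (H2 t). now apply H.
  - right. split; [easy|]. exists t. split; [|easy]. split; [now apply H|].
    intros t' Ht'. apply H3. now apply H.
Qed.

Definition considered (y : nname) : bool :=
  match y with Prev | Elem | Found | Choice | Next => false | _ => true end.

(** Optimal substructure: all candidates of the state [y] are permutations of each other and share
    one slope. Hence the constants of [z :: t'] differ among them only through the constant of the
    tail [t'], and the best tail stays best after prepending [z], whatever the sign of the slope. *)
Lemma consider_ok g s p e Q x y z l m :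
  env g s -> neval p s = y -> neval e (set_nat s Prev 0 y) = z -> nat_at s Here 0 = x -> y < x ->
  entry g s l m y -> best g s Q x ->
  holds (consider p e) (fun s' => kept considered s s' /\ same_below x s s' /\
     best g s' (fun t => Q t \/ exists t', candidate (decs g) l m t' /\ t = z :: t') x) s.
Proof.
  intros He Hp Hz Hx Hlt (t0 & [C0 M0] & (T1 & T2 & T3)) Hb.
  apply (holds_kept considered); [reflexivity|reflexivity|].
  destruct He as (_ & _ & _ & _ & _ & _ & _ & _ & _ & Ea & Eb).
  assert (Ea' : forall w, real_at s Input (2 * w) = coefa g w) by (intros w; rewrite <- Ea; reflexivity).
  assert (Eb' : forall w, real_at s Input (2 * w + 1) = coefb g w) by (intros w; rewrite <- Eb; reflexivity).
  clear Ea Eb.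
  unfold consider, assign, rassign. step.
  eapply holds_nset; [value|exact Hp|]. step. eapply holds_nset; [value|exact Hz|].
  do 2 step.
  set (v := (real_at s Slope y * real_at s Input (2 * z + 1) + real_at s Offset y)%R).
  assert (Ev : v = const (coefa g) (coefb g) (z :: t0)).
  { unfold v. rewrite Eb', T1, T2. reflexivity. }
  assert (Hrec : forall s4, nat_at s4 Here = nat_at s Here -> nat_at s4 Elem 0 = z ->
     nat_at s4 Prev 0 = y -> nat_at s4 Choice = nat_at s Choice -> nat_at s4 Next = nat_at s Next ->
     real_at s4 Slope = real_at s Slope -> real_at s4 Offset = real_at s Offset ->
     real_at s4 Value 0 = v -> real_at s4 Input = real_at s Input ->
     (forall t, Q t -> (v <= const (coefa g) (coefb g) t)%R) ->
     holds record (fun s' => kept considered s s' -> kept considered s s' /\ same_below x s s' /\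
       best g s' (fun t => Q t \/ exists t', candidate (decs g) l m t' /\ t = z :: t') x) s4).
  { intros s4 R1 R2 R3 R4 R5 R6 R7 R8 R9 Rm. unfold record, assign, coef_a. repeat step.
    intros Hk. split; [exact Hk|]. rewrite R1, Hx, R2, R3. split.
    - intros w Hw. read. rewrite !upd_other, R4, R5, R6, R7 by lia. auto.
    - right. split; [reflexivity|]. exists (z :: t0). split.
      + split; [right; eauto|]. intros t [Ht|(t' & Ht & ->)]; [rewrite <- Ev; auto|].
        rewrite <- Ev. unfold v. rewrite Eb', T1, T2. cbn [const].
        specialize (M0 t' Ht).
        rewrite (slope_perm (coefa g) t' t0).
        2: { rewrite (candidate_perm _ _ _ _ Ht). now rewrite (candidate_perm _ _ _ _ C0). }
        lra.
      + unfold traces. read. rewrite !upd_same, R6, R8, R9, Ea', T1.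
        split; [rewrite slope_cons; ring|]. split; [exact Ev|].
        cbn [traced]. rewrite !upd_same. repeat split; auto.
        apply (traced_ext (nat_at s Choice) (nat_at s Next)); [|easy].
        intros w Hw. rewrite !upd_other, R4, R5 by lia. auto. }
  destruct Hb as [(F0 & Hn & Ht)|(F1 & tb & [Cb Mb] & Ht)].
  - eapply holds_if_nat; [value|value|intros _|intros H].
    + apply Hrec; try reflexivity. intros t Hq. now apply Hn in Hq.
    + exfalso. rewrite F0 in H. lia.
  - eapply holds_if_nat; [value|value|intros H|intros _].
    + exfalso. rewrite F1 in H. lia.
    + destruct Ht as (B1 & B2 & B3).
      eapply holds_if_real; [value|value|intros H|intros H]; read; rewrite Hx, B2 in H;
        change (_ + _)%R with v in H.
      * step. intros Hk. split; [exact Hk|]. split; [intros w Hw; auto|].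
        right. split; [exact F1|]. exists tb. split; [|repeat split; auto].
        split; [now left|]. intros t [Hq|(t' & Hq & ->)]; [auto|].
        specialize (M0 t' Hq). rewrite Ev in H. cbn [const] in *.
        rewrite (slope_perm (coefa g) t' t0).
        2: { rewrite (candidate_perm _ _ _ _ Hq). now rewrite (candidate_perm _ _ _ _ C0). }
        lra.
      * apply Hrec; try reflexivity. intros t Hq. specialize (Mb t Hq). lra.
Qed.

Lemma same_below_trans x s1 s2 s3 : same_below x s1 s2 -> same_below x s2 s3 -> same_below x s1 s3.
Proof.
  intros H1 H2 y Hy. destruct (H1 y Hy) as (A & B & C & E), (H2 y Hy) as (A' & B' & C' & E').
  repeat split; congruence.
Qed.

Lemma entry_below g s s' x y l m : same_below x s s' -> y < x -> entry g s l m y -> entry g s' l m y.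
Proof.
  intros H Hy (t & Ht & Htr). exists t. split; [easy|]. now apply (traces_below g s s' x).
Qed.

Definition code (g : setting) (m l i : nat) : nat := (m * width g + l) * width g + i.

Definition digit_kept (y : nname) : bool :=
  match y with
  | Prev | Elem | Found | Choice | Next | D | Place | Rest => false
  | _ => true
  end.

Definition digit_steps (g : setting) (m l i lo : nat) (t : list nat) : Prop :=
  exists d t', lo <= d < length (decs g) /\ Nat.testbit m d = true /\
    t = nth d (decs g) 0 :: t' /\ candidate (decs g) (interval (order g) i l) (m - 2 ^ d) t'.

Lemma digits_ok g s m l i Q (P : store -> Prop) :
  env g s -> nat_at s K 0 = m -> nat_at s J 0 = l -> nat_at s I 0 = i ->
  nat_at s Here 0 = code g m l i -> nat_at s Rest 0 = m -> m < 2 ^ length (decs g) -> 0 < width g ->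
  (forall m', m' < m -> entry g s (interval (order g) i l) m' (code g m' l i)) ->
  best g s Q (code g m l i) ->
  (forall s', same_below (code g m l i) s s' ->
     best g s' (fun t => Q t \/ digit_steps g m l i 0 t) (code g m l i) -> P s') ->
  holds (For D NumDec digit_body) P s.
Proof.
  intros He Hm Hl Hi Hx Hr Hlt Hw Hent Hb HP. set (x := code g m l i) in *.
  set (k := length (decs g)) in *.
  (* After [e] rounds the digits from [k - e] upwards have been tried and [Rest] holds the number
     formed by the lower ones. *)
  apply (holds_for_kept digit_kept (fun e s' => same_below x s s' /\
     nat_at s' Rest 0 = m mod 2 ^ (k - e) /\
     best g s' (fun t => Q t \/ digit_steps g m l i (k - e) t) x)) with (n := k).
  - reflexivity.
  - reflexivity.
  - apply He.
  - split; [intros y Hy; auto|]. split; [rewrite Nat.sub_0_r, Hr; symmetry; now apply Nat.mod_small|].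
    revert Hb. apply best_ext. intros t. split; [now left|].
    intros [H|(d & t' & Hd & _)]; [easy|]. unfold k in Hd. lia.
  - intros e s' He' Hk (B & R & Bst).
    assert (E' : env g s') by (apply (env_kept digit_kept g s); [now intros []|easy|easy]).
    pose (d := k - 1 - e). replace (k - e) with (S d) in * by (unfold d; lia).
    replace (k - S e) with d by (unfold d; lia).
    destruct (Hk) as [Hn _].
    pose proof E' as (W1 & W2 & W3 & W4 & W5 & W6 & _). fold k in W3, W4, W6.
    assert (Hd : d < k) by (unfold d; lia).
    unfold digit_body, assign. do 2 step.
    eapply holds_if_nat; [value|value|intros H|intros H]; read; rewrite W3 in H;
      fold d in H; rewrite ?upd_same, W6, R in H by lia.
    + assert (Hbit : Nat.testbit m d = true) by (rewrite testbit_le_mod; now apply Nat.leb_le).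
      pose proof (testbit_pow_le m d Hbit) as Hle.
      pose proof (Nat.pow_nonzero 2 d ltac:(lia)) as Hp0.
      do 2 step. read. rewrite W3, R. fold d.
      match goal with |- holds (consider ?p ?e) _ ?s3 => set (s4 := s3) end.
      assert (K4 : kept digit_kept s' s4).
      { split; [|reflexivity]. intros y Hy. destruct y; try reflexivity; discriminate. }
      assert (Nv : forall y, digit_kept y = true -> nat_at s4 y = nat_at s y)
        by (intros y Hy; destruct K4 as [K4 _]; now rewrite K4, Hn).
      assert (P4 : nat_at s4 Place 0 = d) by reflexivity.
      assert (Pw4 : nat_at s4 Pow d = 2 ^ d) by (cbn; apply W6; lia).
      assert (R4 : nat_at s4 Rest 0 = m mod 2 ^ d).
      { change (m mod 2 ^ S d - nat_at s' Pow d = m mod 2 ^ d). rewrite W6, mod_pow2_S, Hbit by lia. lia. }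
      assert (E4 : env g s4) by (apply (env_kept digit_kept g s'); [now intros []|easy|easy]).
      assert (Lt : code g (m - 2 ^ d) l i < x) by (unfold x, code; nia).
      eapply holds_weaken.
      * apply (consider_ok g s4 _ _ (fun t => Q t \/ digit_steps g m l i (S d) t) x
                 (code g (m - 2 ^ d) l i) (nth d (decs g) 0)
                 (interval (order g) i l) (m - 2 ^ d)).
        -- exact E4.
        -- cbn -[Nat.add Nat.mul Nat.sub nat_at]. rewrite P4, Pw4, !Nv by reflexivity.
           destruct He as (-> & _). rewrite Hm, Hl, Hi. reflexivity.
        -- cbn -[Nat.add Nat.mul Nat.sub s4]. rewrite P4.
           change (nat_at s' Dec d = nth d (decs g) 0). now apply W4.
        -- rewrite Nv by reflexivity. exact Hx.
        -- exact Lt.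
        -- apply (entry_below g s s4 x); [exact B|exact Lt|]. apply Hent. lia.
        -- exact Bst.
      * intros s5 (K5 & B5 & Bst5). split; [|split].
        -- apply (same_below_trans x s s4); [exact B|exact B5].
        -- destruct K5 as [K5 _]. now rewrite K5.
        -- revert Bst5. apply best_ext. intros t. split.
           ++ intros [[Ht|(e' & t' & Hd' & Ht)]|(t' & Hc & ->)]; [now left| |].
              ** right. exists e', t'. split; [lia|easy].
              ** right. exists d, t'. repeat split; auto.
           ++ intros [Ht|(e' & t' & Hd' & Hb' & -> & Hc)]; [now left; left|].
              destruct (Nat.eq_dec e' d) as [->|Hne].
              ** right. eauto.
              ** left. right. exists e', t'. repeat split; auto; lia.
    + assert (Hbit : Nat.testbit m d = false) by (rewrite testbit_le_mod; now apply Nat.leb_gt).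
      step. split; [exact B|]. split.
      * change (nat_at s' Rest 0 = m mod 2 ^ d). rewrite R, mod_pow2_S, Hbit. lia.
      * enough (Bst' : best g s' (fun t => Q t \/ digit_steps g m l i d t) x) by exact Bst'.
        revert Bst. apply best_ext. intros t. split.
        -- intros [Ht|(e' & t' & Hd' & Ht)]; [now left|]. right. exists e', t'. split; [lia|easy].
        -- intros [Ht|(e' & t' & Hd' & Hb' & Ht)]; [now left|]. right. exists e', t'.
           destruct (Nat.eq_dec e' d) as [->|Hne]; [congruence|]. repeat split; auto; try lia; apply Ht.
  - intros s' _ (B & _ & Bst). rewrite Nat.sub_diag in Bst. now apply HP.
Qed.

Definition below (g : setting) (s : store) (x : nat) : Prop :=
  forall m l i, m < 2 ^ length (decs g) -> l <= incs g -> i + l <= 2 * incs g -> code g m l i < x ->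
  entry g s (interval (order g) i l) m (code g m l i).

Lemma below_same g s s' x : same_below x s s' -> below g s x -> below g s' x.
Proof.
  intros H Hb m l i Hm Hl Hi Hx. apply (entry_below g s s' x); auto.
Qed.

(** The recurrence of the dynamic program: an order is the empty one, or its first function is the
    front of the interval, its back, or a decreasing function of the subset. *)
Lemma first_steps g m l i t :
  m < 2 ^ length (decs g) ->
  candidate (decs g) (interval (order g) i l) m t <->
  (l = 0 /\ m = 0 /\ t = []) \/
  (exists t', 0 < l /\ candidate (decs g) (interval (order g) (i + 1) (l - 1)) m t' /\
              t = order g i :: t') \/
  (exists t', 0 < l /\ candidate (decs g) (interval (order g) i (l - 1)) m t' /\
              t = order g (i + l - 1) :: t') \/
  digit_steps g m l i 0 t.
Proof.
  intros Hm. split.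
  - intros H. apply candidate_inv in H.
    destruct H as [(El & Em & Et)|[(x & l' & t' & El & Et & Hc)|[(x & l' & t' & El & Et & Hc)|H]]].
    + left. destruct l; [auto|]. now rewrite interval_front in El.
    + right; left. destruct l as [|l]; [discriminate|]. rewrite interval_front in El.
      injection El as <- <-. exists t'. replace (S l - 1) with l by lia. auto with arith.
    + right; right; left. destruct l as [|l]; [now destruct l'|]. rewrite interval_back in El.
      apply app_inj_tail in El. destruct El as [<- <-]. exists t'.
      replace (S l - 1) with l by lia. replace (i + S l - 1) with (i + l) by lia. auto with arith.
    + right; right; right. destruct H as (d & t' & Hd & Hb & Et & Hc).
      exists d, t'. repeat split; auto; lia.
  - intros [(-> & -> & ->)|[(t' & Hl & Hc & ->)|[(t' & Hl & Hc & ->)|(d & t' & Hd & Hb & -> & Hc)]]].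
    + apply candidate_nil.
    + destruct l as [|l]; [lia|]. replace (S l - 1) with l in Hc by lia.
      rewrite interval_front. now apply candidate_front.
    + destruct l as [|l]; [lia|]. replace (S l - 1) with l in Hc by lia.
      rewrite interval_back. replace (i + S l - 1) with (i + l) by lia. now apply candidate_back.
    + apply candidate_dec; [lia|easy|easy].
Qed.

(** The state with empty interval and empty subset has no transition, and its only candidate is the
    empty order already in the cell. Any other state has a candidate, which is not empty, so that
    some transition has been recorded. *)
Lemma best_entry g s m l i x Q :
  m < 2 ^ length (decs g) ->
  (forall t, Q t <->
    (exists t', 0 < l /\ candidate (decs g) (interval (order g) (i + 1) (l - 1)) m t' /\
                t = order g i :: t') \/
    (exists t', 0 < l /\ candidate (decs g) (interval (order g) i (l - 1)) m t' /\
                t = order g (i + l - 1) :: t') \/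
    digit_steps g m l i 0 t) ->
  best g s Q x -> entry g s (interval (order g) i l) m x.
Proof.
  intros Hm HQ Hb.
  assert (Hc : forall t, candidate (decs g) (interval (order g) i l) m t <->
             (l = 0 /\ m = 0 /\ t = []) \/ Q t) by (intros t; rewrite HQ; now apply first_steps).
  assert (Hbase : l = 0 -> m = 0 -> forall t, ~ Q t).
  { intros -> -> t Ht. apply HQ in Ht.
    destruct Ht as [(t' & Ht & _)|[(t' & Ht & _)|(d & t' & _ & Ht & _)]]; try lia.
    now rewrite Nat.bits_0 in Ht. }
  destruct Hb as [(_ & Hn & Ht)|(_ & t & [Ct Mt] & Ht)].
  - exists []. split; [|easy].
    assert (E : l = 0 /\ m = 0).
    { destruct (candidate_exists (decs g) (interval (order g) i l) m Hm) as [t Hct].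
      apply Hc in Hct. destruct Hct as [H|H]; [easy|]. now apply Hn in H. }
    split; [apply Hc; left; tauto|]. intros t' Ht'. apply Hc in Ht'.
    destruct Ht' as [(_ & _ & ->)|H]; [apply Rle_refl|now apply Hn in H].
  - exists t. split; [|easy]. split; [apply Hc; now right|]. intros t' Ht'. apply Hc in Ht'.
    destruct Ht' as [(E1 & E2 & ->)|H]; [|auto]. now apply (Hbase E1 E2) in Ct.
Qed.

Definition state_kept (y : nname) : bool :=
  match y with I | J | K => true | _ => is_static y end.

Lemma code_lt g m l i m' l' i' :
  l < width g -> i < width g -> l' < width g -> i' < width g ->
  code g m' l' i' < code g m l i ->
  m' < m \/ m' = m /\ (l' < l \/ l' = l /\ i' < i).
Proof.
  unfold code. intros. destruct (Nat.lt_trichotomy m' m) as [|[->|Hm]]; [now left| |].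
  - right. split; [easy|]. destruct (Nat.lt_trichotomy l' l) as [|[->|Hl]]; [now left| |].
    + right. split; [easy|]. lia.
    + exfalso. assert (m * width g + l + 1 <= m * width g + l') by lia. nia.
  - exfalso. assert (m * width g + l + 1 <= m' * width g + l') by nia. nia.
Qed.

Lemma state_ok g s m l i (P : store -> Prop) :
  env g s -> nat_at s K 0 = m -> nat_at s J 0 = l -> nat_at s I 0 = i ->
  m < 2 ^ length (decs g) -> l <= incs g -> i <= 2 * incs g -> 2 * incs g < width g ->
  below g s (code g m l i) ->
  (forall s', below g s' (code g m l (S i)) -> P s') ->
  holds state_body P s.
Proof.
  intros He Hm Hl Hi Bm Bl Bi Hw Hbel HP. set (x := code g m l i) in *.
  pose proof He as (W1 & W2 & W3 & W4 & W5 & W6 & W7 & W8 & W9 & _).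
  (* The next index is [x + 1], and as the encoding is injective, the current state is the only new
     one below it. If its interval exceeds the doubled list, nothing is required of it. *)
  assert (Hnext : forall s', below g s' x ->
     (i + l <= 2 * incs g -> entry g s' (interval (order g) i l) m x) ->
     below g s' (code g m l (S i))).
  { intros s' H1 H2 m' l' i' Bm' Bl' Bi' Hx'.
    destruct (Nat.eq_dec (code g m' l' i') x) as [E|E]; [|apply H1; auto; unfold x, code in *; lia].
    rewrite E. assert (Hi1 : S i <= width g) by lia.
    assert (m' = m /\ l' = l /\ i' = i) as (-> & -> & ->); [|now apply H2].
    unfold x, code in E.
    assert (m' = m).
    { destruct (Nat.lt_trichotomy m' m) as [|[->|]]; [exfalso|easy|exfalso].
      - assert (m' * width g + l' + 1 <= m * width g + l) by nia. nia.
      - assert (m * width g + l + 1 <= m' * width g + l') by nia. nia. }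
    subst m'. assert (l' = l).
    { destruct (Nat.lt_trichotomy l' l) as [|[->|]]; [exfalso|easy|exfalso].
      - assert (m * width g + l' + 1 <= m * width g + l) by nia. nia.
      - assert (m * width g + l + 1 <= m * width g + l') by nia. nia. }
    subst l'. repeat split. lia. }
  unfold state_body.
  eapply holds_if_nat; [value|value|intros H|intros H]; read; rewrite Hl, Hi, W9 in H.
  2: { step. apply HP, Hnext; [easy|lia]. }
  apply (holds_weaken _ (fun s' => same_below x s s' /\ entry g s' (interval (order g) i l) m x)).
  2: { intros s' [H1 H2]. apply HP, Hnext; [|easy]. now apply (below_same g s s'). }
  unfold assign. step. eapply holds_nset; [value|reflexivity|].
  replace (neval (state_index (NVar K) (NVar J) (NVar I)) s) with x
    by (unfold x, code; rewrite <- Hm, <- Hl, <- Hi, <- W1; reflexivity).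
  do 7 step. read. rewrite ?upd_same.
  match goal with |- holds _ _ ?s1 => set (s2 := s1) end.
  assert (B2 : same_below x s s2).
  { intros y Hy. unfold s2. read. rewrite !upd_other by lia. auto. }
  assert (K2 : kept state_kept s s2).
  { split; [|reflexivity]. intros y Hy. destruct y; try reflexivity; discriminate. }
  assert (H2 : nat_at s2 Here 0 = x) by reflexivity.
  assert (Best2 : best g s2 (fun _ => False) x).
  { left. split; [reflexivity|]. split; [auto|]. unfold s2, traces. read. rewrite !upd_same.
    repeat split; auto. }
  clearbody s2.
  pose (Q1 := fun t => (exists t', 0 < l /\ candidate (decs g) (interval (order g) (i + 1) (l - 1)) m t' /\
                t = order g i :: t') \/
      (exists t', 0 < l /\ candidate (decs g) (interval (order g) i (l - 1)) m t' /\
                t = order g (i + l - 1) :: t')).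
  assert (N2 : forall y, state_kept y = true -> nat_at s2 y = nat_at s y) by apply K2.
  assert (E2 : env g s2) by (apply (env_kept state_kept g s); [now intros []|easy|easy]).
  apply (holds_weaken _ (fun s3 => kept considered s2 s3 /\ same_below x s2 s3 /\ best g s3 Q1 x)).
  { eapply holds_if_nat; [value|value|intros H3|intros H3]; read; rewrite N2, Hl in H3 by reflexivity.
    - assert (A1 : code g m (l - 1) (i + 1) < x) by (unfold x, code; nia).
      assert (A2 : code g m (l - 1) i < x) by (unfold x, code; nia).
      step.
      eapply holds_weaken; [apply (consider_ok g s2 _ _ (fun _ => False) x
        (code g m (l - 1) (i + 1)) (order g i) (interval (order g) (i + 1) (l - 1)) m E2)|].
      + cbn -[Nat.add Nat.mul Nat.sub]. rewrite !N2 by reflexivity. now rewrite Hm, Hl, Hi, W1.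
      + cbn -[Nat.add Nat.mul Nat.sub]. rewrite !N2 by reflexivity. now rewrite Hi, W5.
      + exact H2.
      + exact A1.
      + apply (entry_below g s s2 x); [easy|easy|]. apply Hbel; lia || exact A1.
      + exact Best2.
      + intros s3 (K3 & B3 & Best3).
        assert (N3 : forall y, state_kept y = true -> nat_at s3 y = nat_at s y).
        { intros y Hy. rewrite <- N2 by easy. apply K3. now destruct y. }
        assert (E3 : env g s3) by (apply (env_kept considered g s2); [now intros []|easy|easy]).
        eapply holds_weaken; [eapply (consider_ok g s3 _ _ _ x
          (code g m (l - 1) i) (order g (i + l - 1)) (interval (order g) i (l - 1)) m E3)|].
        * cbn -[Nat.add Nat.mul Nat.sub]. rewrite !N3 by reflexivity. now rewrite Hm, Hl, Hi, W1.
        * cbn -[Nat.add Nat.mul Nat.sub]. rewrite !N3 by reflexivity. now rewrite Hi, Hl, W5.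
        * destruct K3 as [K3 _]. rewrite K3 by reflexivity. exact H2.
        * exact A2.
        * apply (entry_below g s2 s3 x); [easy|easy|]. apply (entry_below g s s2 x); [easy|easy|].
          apply Hbel; lia || exact A2.
        * exact Best3.
        * intros s4 (K4 & B4 & Best4). split; [now apply (kept_trans _ s2 s3)|].
          split; [now apply (same_below_trans x s2 s3)|].
          revert Best4. apply best_ext. intros t. unfold Q1. split.
          -- intros [[[]|(t' & Hc & ->)]|(t' & Hc & ->)]; [left|right]; exists t'; auto with arith.
          -- intros [(t' & _ & Hc & ->)|(t' & _ & Hc & ->)]; [left; right|right]; eauto.
    - step. split; [split; auto|]. split; [intros y Hy; auto|]. revert Best2. apply best_ext.
      intros t. unfold Q1. split; [easy|]. intros [(t' & Ht & _)|(t' & Ht & _)]; lia. }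
  intros s3 (K3 & B3 & Best3).
  assert (N3 : forall y, state_kept y = true -> nat_at s3 y = nat_at s y).
  { intros y Hy. rewrite <- N2 by easy. apply K3. now destruct y. }
  assert (E3 : env g s3) by (apply (env_kept considered g s2); [now intros []|easy|easy]).
  do 2 step. read. rewrite N3, Hm by reflexivity.
  match goal with |- holds _ _ ?s5 => set (s4 := s5) end.
  assert (B4 : same_below x s s4).
  { apply (same_below_trans x s s2); [easy|]. apply (same_below_trans x s2 s3); [easy|].
    intros y Hy. auto. }
  apply (digits_ok g s4 m l i Q1).
  - apply (env_kept state_kept g s3); [now intros []| |easy]. now apply kept_set_nat.
  - change (nat_at s3 K 0 = m). now rewrite N3.
  - change (nat_at s3 J 0 = l). now rewrite N3.
  - change (nat_at s3 I 0 = i). now rewrite N3.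
  - change (nat_at s3 Here 0 = x). destruct K3 as [K3 _]. now rewrite K3.
  - reflexivity.
  - exact Bm.
  - lia.
  - intros m' Hm'. assert (A : code g m' l i < x) by (unfold x, code; nia).
    apply (entry_below g s s4 x); [easy|easy|]. apply Hbel; lia || exact A.
  - exact Best3.
  - intros s5 B5 Best5. split; [now apply (same_below_trans x s s4)|].
    refine (best_entry g s5 m l i x _ Bm _ Best5). intros t. unfold Q1. tauto.
Qed.

Lemma fill_ok g s (P : store -> Prop) :
  env g s -> 2 * incs g + 1 < width g ->
  (forall s', kept is_static s s' -> below g s' (code g (2 ^ length (decs g)) 0 0) -> P s') ->
  holds fill P s.
Proof.
  intros He Hw HP. unfold fill.
  assert (Hst : forall y, is_static y = true -> is_static y = true) by auto.
  apply (holds_for_kept is_static (fun m s' => below g s' (code g m 0 0)))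
    with (n := 2 ^ length (decs g)).
  - reflexivity.
  - reflexivity.
  - apply He.
  - intros m l i _ _ _ H. unfold code in H. lia.
  - intros m s1 Hm K1 B1.
    apply (holds_for_kept (fun y => match y with K => true | _ => is_static y end)
      (fun l s' => below g s' (code g m l 0))) with (n := S (incs g)).
    + reflexivity.
    + reflexivity.
    + destruct K1 as [K1 _]. cbn. rewrite K1 by reflexivity. apply He.
    + exact B1.
    + intros l s2 Hl K2 B2.
      apply (holds_for_kept (fun y => match y with J | K => true | _ => is_static y end)
        (fun i s' => below g s' (code g m l i))) with (n := S (2 * incs g)).
      * reflexivity.
      * reflexivity.
      * destruct K1 as [K1 _], K2 as [K2 _]. cbn. rewrite K2 by reflexivity. cbn.
        rewrite K1 by reflexivity. apply He.
      * exact B2.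
      * intros i s3 Hi K3 B3.
        apply (state_ok g _ m l i); try reflexivity; try lia; auto.
        -- apply (env_kept is_static g s); [easy| |easy].
           apply (kept_trans _ s s1); [easy|]. apply (kept_trans _ s1 s2).
           { apply (kept_trans _ s1 (set_nat s1 K 0 m)); [now apply kept_set_nat|].
             revert K2. apply kept_weaken. now intros []. }
           apply (kept_trans _ s2 s3); [|now apply kept_set_nat].
           apply (kept_trans _ s2 (set_nat s2 J 0 l)); [now apply kept_set_nat|].
           revert K3. apply kept_weaken. now intros [].
        -- cbn. destruct K3 as [K3 _]. rewrite K3 by reflexivity. cbn.
           destruct K2 as [K2 _]. rewrite K2 by reflexivity. reflexivity.
        -- cbn. destruct K3 as [K3 _]. rewrite K3 by reflexivity. reflexivity.
      (* The indices between the end of this row and the start of the next one belong to no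
         admissible state. *)
      * intros s3 K3 B3 m' l' i' Bm Bl Bi Hx. apply B3; auto.
        apply code_lt in Hx; try lia. unfold code. nia.
    + intros s2 K2 B2 m' l' i' Bm Bl Bi Hx. apply B2; auto.
      apply code_lt in Hx; try lia. unfold code. nia.
  - intros s1 K1 B1. now apply HP.
Qed.

(** * Choosing the rotation and reading off the order *)

Definition tables_kept (y : nname) : bool :=
  match y with Choice | Next => true | _ => is_static y end.

Lemma select_ok g s (P : store -> Prop) :
  env g s ->
  let x i := code g (2 ^ length (decs g) - 1) (incs g) i in
  (forall s' i, kept tables_kept s s' -> real_at s' = real_at s -> i <= incs g ->
     nat_at s' Cursor 0 = x i ->
     (forall j, j <= incs g -> (real_at s Offset (x i) <= real_at s Offset (x j))%R) -> P s') ->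
  holds select P s.
Proof.
  intros He x HP. pose proof He as (W1 & W2 & W3 & W4 & W5 & W6 & W7 & W8 & W9 & _).
  assert (Hfull : forall s' e, kept tables_kept s s' -> neval (full e) s' = x (neval e s')).
  { intros s' e [Hk _]. unfold full, state_index, NVar. cbn [neval].
    rewrite !Hk by reflexivity. now rewrite W1, W2, W7. }
  assert (K0 : kept tables_kept s s) by (split; auto).
  unfold select, assign. step. eapply holds_nset; [value|exact (Hfull s (NLit 0) K0)|].
  cbn [neval].
  apply (holds_for_kept tables_kept (fun j s' => real_at s' = real_at s /\
    exists i, i <= incs g /\ nat_at s' Cursor 0 = x i /\
      forall j', j' < j -> (real_at s Offset (x i) <= real_at s Offset (x j'))%R))
    with (n := S (incs g)).
  - reflexivity.
  - reflexivity.
  - exact W8.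
  - split; [reflexivity|]. exists 0. split; [lia|]. split; [reflexivity|lia].
  - intros j s' Hj K1 (R1 & i & Hi & Ec & Hmin).
    assert (K2 : kept tables_kept s (set_nat s' I 0 j)).
    { apply (kept_trans _ s s'); [|now apply kept_set_nat].
      apply (kept_trans _ s (set_nat s Cursor 0 (x 0))); [now apply kept_set_nat|easy]. }
    step. eapply holds_nset; [value|exact (Hfull _ (NVar I) K2)|].
    cbn [NVar neval]. change (nat_at (set_nat s' I 0 j) I 0) with j.
    eapply holds_if_real; [value|value|intros H|intros H]; read; rewrite R1, Ec in H; step.
    + split; [exact R1|]. exists i. split; [easy|]. split; [exact Ec|].
      intros j' Hj'. destruct (Nat.eq_dec j' j) as [->|]; [exact H|]. apply Hmin. lia.
    + split; [exact R1|]. exists j. split; [lia|]. split; [reflexivity|].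
      intros j' Hj'. destruct (Nat.eq_dec j' j) as [->|]; [apply Rle_refl|].
      specialize (Hmin j' ltac:(lia)). cbn in H. lra.
  - intros s' K1 (R1 & i & Hi & Ec & Hmin). apply (HP s' i); auto.
    + apply (kept_trans _ s (set_nat s Cursor 0 (x 0))); [now apply kept_set_nat|easy].
    + intros j Hj. apply Hmin. lia.
Qed.

Lemma firstn_succ {T} (d : T) t j :
  j < length t -> firstn (S j) t = firstn j t ++ [nth j t d].
Proof.
  revert j. induction t as [|x t IH]; intros [|j] H; cbn in *; try lia; [easy|].
  f_equal. apply IH. lia.
Qed.

Lemma emit_ok s (P : store -> Prop) n t :
  nat_at s Size 0 = n -> length t = n ->
  traced (nat_at s Choice) (nat_at s Next) (nat_at s Cursor 0) t ->
  (forall s', nat_at s' Size = nat_at s Size ->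
     vec (fun i => nat_at s' Out (n + 32 + i)) n = t -> P s') ->
  holds emit P s.
Proof.
  intros Hn Hl Ht HP. unfold emit, assign.
  apply (holds_for_kept tables_kept (fun j s' =>
    traced (nat_at s Choice) (nat_at s Next) (nat_at s' Cursor 0) (skipn j t) /\
    vec (fun i => nat_at s' Out (n + 32 + i)) j = firstn j t)) with (n := n).
  - reflexivity.
  - reflexivity.
  - exact Hn.
  - split; [exact Ht|reflexivity].
  - intros j s' Hj [Hk _] [T V].
    assert (Ej : nth_error t j = Some (nth j t 0)) by (apply nth_error_nth'; lia).
    rewrite (skipn_nth t j _ Ej) in T. destruct T as (T1 & _ & T3).
    repeat step. read.
    rewrite (Hk Choice), (Hk Next), (Hk Size), T1, Hn by reflexivity. split; [exact T3|].
    rewrite vec_S, upd_same.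
    rewrite (firstn_succ 0) by lia.
    f_equal. rewrite <- V. apply map_ext_in. intros i Hi. apply in_seq in Hi.
    apply upd_other. lia.
  - intros s' [Hk _] [_ V]. apply HP; [now apply Hk|]. rewrite V. rewrite <- Hl. apply firstn_all.
Qed.

Lemma mirror_ok s (P : store -> Prop) n :
  nat_at s Size 0 = n ->
  (forall s', nat_at s' Size 0 = n -> (forall x, slopes s' x = slopes s x) ->
     (forall x, x < n -> offsets s' x = (- offsets s x)%R) -> P s') ->
  holds mirror P s.
Proof.
  intros Hn HP. unfold mirror.
  apply (holds_for (fun j s' => nat_at s' Size 0 = n /\ (forall x, slopes s' x = slopes s x) /\
    (forall x, x < j -> offsets s' x = (- offsets s x)%R) /\
    (forall x, j <= x -> offsets s' x = offsets s x))) with (n := n).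
  - exact Hn.
  - repeat split; auto. lia.
  - intros j s' Hj (I1 & I2 & I3 & I4). step. unfold slopes, offsets in *. read.
    split; [exact I1|split; [|split]]; intros x.
    + rewrite upd_other by (cbn; lia). apply I2.
    + intros Hx. cbn. destruct (Nat.eq_dec x j) as [->|].
      * rewrite upd_same. specialize (I4 j (Nat.le_refl j)). cbn in I4. rewrite I4. lra.
      * rewrite upd_other by lia. apply I3. lia.
    + intros Hx. rewrite upd_other by (cbn; lia). apply I4. lia.
  - intros s' (I1 & I2 & I3 & _). now apply HP.
Qed.

Lemma rotation_interval (ord : nat -> nat) u r :
  r <= u -> (forall i, i < u -> ord (i + u) = ord i) ->
  skipn r (vec ord u) ++ firstn r (vec ord u) = interval ord r u.
Proof.
  intros Hr Hp. unfold interval, vec.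
  assert (Hshift : forall q z c, map ord (seq (c + z) q) = map (fun j => ord (c + j)) (seq z q)).
  { induction q as [|q IH]; intros z c; cbn; [easy|]. f_equal. rewrite <- Nat.add_succ_r. apply IH. }
  replace u with (r + (u - r)) at 1 2 by lia. rewrite seq_app, map_app. cbn [Nat.add].
  rewrite skipn_app, firstn_app, length_map, length_seq, Nat.sub_diag. cbn [skipn firstn].
  rewrite skipn_all2, firstn_all2, app_nil_r by (rewrite length_map, length_seq; lia). cbn [app].
  replace (seq 0 u) with (seq 0 ((u - r) + r)) by (f_equal; lia).
  rewrite seq_app, map_app. cbn [Nat.add]. f_equal.
  - rewrite <- Hshift. now rewrite Nat.add_0_r.
  - rewrite <- Hshift. replace (r + (u - r)) with (u + 0) by lia. rewrite Hshift.
    apply map_ext_in. intros i Hi. apply in_seq in Hi. rewrite Nat.add_comm. symmetry. apply Hp. lia.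
Qed.

Lemma filter_perm_split {T} (f : T -> bool) (l : list T) :
  Permutation l (filter f l ++ filter (fun x => negb (f x)) l).
Proof.
  induction l as [|x l IH]; cbn; [easy|]. destruct (f x); cbn; [now constructor|].
  rewrite IH at 1. apply Permutation_middle.
Qed.

Lemma filter_permutation {T} (f : T -> bool) (l l' : list T) :
  Permutation l l' -> Permutation (filter f l) (filter f l').
Proof.
  induction 1 as [|x l l' H IH|x y l|l1 l2 l3 H1 IH1 H2 IH2]; cbn; auto.
  - destruct (f x); auto.
  - destruct (f x), (f y); auto. constructor.
  - now rewrite IH1.
Qed.

(** The two halves of correctness. Candidates with a full rotation and the full subset are
    permutations; conversely, an order that peels a rotation is such a candidate, so being best
    among the candidates is what [peels_rotation_optimal] requires. *)
Lemma candidates_minimal a b n u ds ord t i :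
  let dec x := negb (nondecb a x) in
  u <= n -> ds = filter dec (seq 0 n) ->
  Permutation (vec ord u) (filter (nondecb a) (seq 0 n)) ->
  StronglySorted (fun x y => pseudo_angle (b x) (a x - 1) <= pseudo_angle (b y) (a y - 1))%R
    (vec ord u) ->
  (forall j, j < u -> ord (j + u) = ord j) ->
  i <= u -> candidate ds (interval ord i u) (2 ^ length ds - 1) t ->
  (forall j t', j <= u -> candidate ds (interval ord j u) (2 ^ length ds - 1) t' ->
     (const a b t <= const a b t')%R) ->
  minimal a b n t.
Proof.
  intros dec Hu Eds Hp Hs Hper Hi Hc Hmin.
  assert (Hrot : Permutation (interval ord i u) (vec ord u)).
  { rewrite <- (rotation_interval ord u i) by easy. rewrite Permutation_app_comm.
    now rewrite firstn_skipn. }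
  split.
  - unfold is_perm. rewrite (candidate_perm _ _ _ _ Hc), members_full, Hrot, Hp, Eds.
    apply filter_perm_split.
  - intros r Hr.
    apply (peels_rotation_optimal a b n dec (vec ord u) t); auto.
    + intros x _. unfold dec, nondecb. destruct (Rle_dec 0 (a x)); cbn; lra.
    + rewrite Hp. apply Permutation_refl'. apply filter_ext. intros x. unfold dec.
      now rewrite negb_involutive.
    + intros j t' Hj Ht' Hpe. rewrite vec_length in Hj.
      rewrite rotation_interval in Hpe by easy. apply (Hmin j t' Hj).
      apply (peels_candidate dec); [easy| |].
      * pose proof (Nat.pow_nonzero 2 (length ds) ltac:(lia)). lia.
      * rewrite members_full, Eds. apply filter_permutation. now symmetry.
Qed.

(** * Input and output *)

(* Spreads the input over the cells of [Input], from the last to the first; the register 0 serves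
   as a buffer, so its own content is first saved beyond the input. *)
Definition prelude : program :=
  [NAdd 2 0 7; NAdd 1 0 0; NConst 3 32; NConst 4 2; NMul 5 1 3; NAdd 5 5 4; RStoreInd 5 0;
   NConst 6 1;
   JmpNLe 1 7 15;
   NSub 1 1 6; RLoadInd 0 1; NMul 5 1 3; NAdd 5 5 4; RStoreInd 5 0;
   JmpNLe 7 7 8;
   NAdd 5 0 0; NMul 5 5 3; NAdd 5 5 4; RLoadInd 0 5; RStoreInd 4 0].

Lemma reach_jump P p N Rg i j l :
  nth_error P p = Some (JmpNLe i j l) ->
  reach P 1 (conf p (N, Rg)) (conf (if N i <=? N j then l else S p) (N, Rg)).
Proof. intros H. eexists. split; [exact (view_step_jump _ _ _ _ _ _ _ H)|reflexivity]. Qed.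

Lemma code_at_sub P p l1 l2 l3 : code_at P p (l1 ++ l2 ++ l3) -> code_at P (p + length l1) l2.
Proof. intros H. apply code_at_app in H. destruct H as [_ H]. now apply code_at_app in H. Qed.

Lemma prelude_ok P n (N : nat -> nat) (Rg : nat -> R) :
  code_at P 0 prelude -> N 0 = n -> (forall i, 0 < i -> N i = 0) ->
  exists t m, t <= 14 * n + 14 /\ reach P t (conf 0 (N, Rg)) (conf 20 m) /\
    nat_at (view m) Size 0 = n /\ forall i, i < 2 * n -> real_at (view m) Input i = Rg i.
Proof.
  intros Hc Hn Hz.
  assert (Hj1 : nth_error P 8 = Some (JmpNLe 1 7 15)) by now apply Hc.
  assert (Hj2 : nth_error P 14 = Some (JmpNLe 7 7 8)) by now apply Hc.
  pose proof (code_at_sub P 0 [] (firstn 8 prelude) (skipn 8 prelude) Hc) as C1.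
  pose proof (code_at_sub P 0 (firstn 9 prelude) (firstn 5 (skipn 9 prelude)) (skipn 14 prelude) Hc) as C2.
  pose proof (code_at_sub P 0 (firstn 15 prelude) (skipn 15 prelude) [] Hc) as C3.
  cbn [length firstn skipn prelude Nat.add] in C1, C2, C3.
  pose proof (reach_straight P _ _ (N, Rg) C1 eq_refl) as R1.
  cbn [length Nat.add] in R1.
  match type of R1 with reach _ _ _ (conf _ ?m) => set (m1 := m) in R1 end.
  (* The [q] last inputs have been moved. Going down is safe: the target [32 * j + 2] lies above
     every input still to be moved. Register 0 is the buffer, so input 0 is moved into place at the
     end from its copy at [32 * (2 * n) + 2]. *)
  assert (Hinv : forall q, q <= 2 * n -> exists N' Rg',
    reach P (q * 7) (conf 8 m1) (conf 8 (N', Rg')) /\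
    N' 0 = n /\ N' 1 = 2 * n - q /\ N' 2 = n /\ N' 3 = 32 /\ N' 4 = 2 /\ N' 6 = 1 /\ N' 7 = 0 /\
    Rg' (32 * (2 * n) + 2) = Rg 0 /\
    (forall j, 0 < j -> j < 2 * n -> 2 * n - q <= j -> Rg' (32 * j + 2) = Rg j) /\
    (forall j, 0 < j -> j < 32 * (2 * n - q) + 2 -> Rg' j = Rg j)).
  { induction q as [|q IH]; intros Hq.
    - do 2 eexists. split; [reflexivity|]. cbn [fst snd]. unfold upd.
      cbn -[Nat.mul Nat.add]. rewrite ?(Hz 7), ?Hn by lia.
      repeat split; try lia.
      + destruct (Nat.eqb_spec (32 * (2 * n) + 2) ((n + n) * 32 + 2)); [easy|lia].
      + intros j H1 H2. destruct (Nat.eqb_spec j ((n + n) * 32 + 2)); [lia|easy].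
    - destruct (IH ltac:(lia)) as (N1 & G1 & R & A0 & A1 & A2 & A3 & A4 & A6 & A7 & B1 & B2 & B3).
      pose proof (reach_jump P 8 N1 G1 _ _ _ Hj1) as R2. rewrite A1, A7 in R2.
      destruct (Nat.leb_spec (2 * n - q) 0) as [|_]; [lia|].
      pose proof (reach_straight P _ _ (N1, G1) C2 eq_refl) as R3. cbn [length Nat.add] in R3.
      match type of R3 with reach _ _ _ (conf _ ?m) => set (m2 := m) in R3 end.
      assert (E2 : exists N2 G2, m2 = (N2, G2) /\
         (forall j, j <> 1 -> j <> 5 -> N2 j = N1 j) /\ N2 1 = 2 * n - S q /\
         (forall j, j <> 0 -> j <> 32 * (2 * n - S q) + 2 -> G2 j = G1 j) /\
         (0 < 2 * n - S q -> G2 (32 * (2 * n - S q) + 2) = G1 (2 * n - S q))).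
      { do 2 eexists. split; [reflexivity|]. cbn [fst snd]. unfold upd.
        cbn -[Nat.mul Nat.add Nat.sub]. rewrite A1, A3, A4, A6.
        replace (2 * n - q - 1) with (2 * n - S q) by lia. repeat split.
        - intros j H1 H5. now rewrite (proj2 (Nat.eqb_neq j 5) H5), (proj2 (Nat.eqb_neq j 1) H1).
        - intros j H0 H. destruct (Nat.eqb_spec j ((2 * n - S q) * 32 + 2)); [lia|].
          destruct (Nat.eqb_spec j 0); [lia|easy].
        - intros _. destruct (Nat.eqb_spec (32 * (2 * n - S q) + 2) ((2 * n - S q) * 32 + 2)); [easy|lia]. }
      destruct E2 as (N2 & G2 & E2 & D1 & D2 & D3 & D4). rewrite E2 in R3.
      pose proof (reach_jump P 14 N2 G2 _ _ _ Hj2) as R4. rewrite Nat.leb_refl in R4.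
      exists N2, G2. split.
      { replace (S q * 7) with (q * 7 + (1 + (5 + 1))) by lia.
        eapply reach_trans; [exact R|]. eapply reach_trans; [exact R2|].
        eapply reach_trans; [exact R3|exact R4]. }
      rewrite (D1 0), (D1 2), (D1 3), (D1 4), (D1 6), (D1 7), D2 by lia. repeat split; auto.
      + rewrite D3 by lia. exact B1.
      + intros j H1 H2 H3. destruct (Nat.eq_dec j (2 * n - S q)) as [->|].
        * rewrite D4 by lia. apply B3; lia.
        * rewrite D3 by lia. apply B2; lia.
      + intros j H1 H2. rewrite D3 by lia. apply B3; lia. }
  destruct (Hinv (2 * n) (Nat.le_refl _)) as (N1 & G1 & R & A0 & A1 & A2 & A3 & A4 & A6 & A7 & B1 & B2 & B3).
  pose proof (reach_jump P 8 N1 G1 _ _ _ Hj1) as R2. rewrite A1, A7, Nat.sub_diag in R2.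
  cbn [Nat.leb] in R2.
  pose proof (reach_straight P _ _ (N1, G1) C3 eq_refl) as R3. cbn [length Nat.add] in R3.
  eexists. eexists. split; [|split; [|split]].
  2: { eapply reach_trans; [exact R1|]. eapply reach_trans; [exact R|].
       eapply reach_trans; [exact R2|exact R3]. }
  - lia.
  - cbn. unfold naddr, upd. cbn. exact A2.
  - intros i Hi. change (raddr Input i) with (32 * i + 2).
    unfold upd; cbn -[Nat.mul Nat.add raddr]; change (raddr Input i) with (32 * i + 2).
    rewrite A0, A3, A4. destruct (Nat.eq_dec (32 * i + 2) 2) as [E|E].
    + rewrite E, upd_same. replace i with 0 by lia. rewrite <- B1. f_equal. lia.
    + rewrite !upd_other by lia. apply B2; lia.
Qed.

Definition fetch (d : nat) : list instr := [NConst d (32 * (d - 1)); NAdd d d 0; NLoadInd d d].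

(* The registers below 32 are in use during the loop, hence fetched last; register 0 holds the
   address of the first item of the answer. *)
Definition postlude (p : nat) : program :=
  [NConst 3 32; NConst 4 1; NMul 5 2 3; NConst 6 1050; NAdd 0 5 6; NConst 6 992; NAdd 5 0 6; NConst 6 32;
   JmpNLe 6 2 (p + 10);
   JmpNLe 3 3 (p + 15);
   NLoadInd 7 5; NStoreInd 6 7; NAdd 6 6 4; NAdd 5 5 3;
   JmpNLe 3 3 (p + 8)] ++ flat_map fetch (seq 1 31).

(** All sources lie at or above the base address in register 0. When this address exceeds [q], no
    fetch overwrites the source of a later one. *)
Lemma fetch_ok q N (Rg : nat -> R) :
  exists N', acts (flat_map fetch (seq 1 q)) (N, Rg) = (N', Rg) /\
    (forall j, j = 0 \/ q < j -> N' j = N j) /\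
    (q < N 0 -> forall d, 0 < d <= q -> N' d = N (N 0 + 32 * (d - 1))).
Proof.
  induction q as [|q IH].
  - exists N. split; [reflexivity|]. split; [easy|lia].
  - destruct IH as (N1 & E & H1 & H2). rewrite seq_S, flat_map_app, acts_app, E.
    cbn [flat_map app]. eexists. split; [reflexivity|]. unfold upd.
    cbn -[Nat.mul Nat.add Nat.sub Nat.eqb]. rewrite !Nat.eqb_refl.
    replace (0 =? 1 + q) with false by (symmetry; apply Nat.eqb_neq; lia). split.
    + intros j Hj. rewrite (proj2 (Nat.eqb_neq j (1 + q))) by lia. apply H1. lia.
    + intros H0 d Hd. destruct (Nat.eqb_spec d (1 + q)) as [->|Hn].
      * rewrite (H1 0) by lia. rewrite (proj2 (Nat.eqb_neq _ (1 + q))) by lia.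
        rewrite H1 by lia. f_equal. lia.
      * apply H2; lia.
Qed.

Lemma postlude_ok P p n m t :
  code_at P p (postlude p) -> nat_at (view m) Size 0 = n ->
  vec (fun i => nat_at (view m) Out (n + 32 + i)) n = t ->
  exists T m', T <= 6 * n + 110 /\ reach P T (conf p m) (conf (p + 108) m') /\
    vec (fun i => fst m' (S i)) n = t.
Proof.
  intros Hc Hn Ht. destruct m as [N Rg].
  assert (Hj1 : nth_error P (p + 8) = Some (JmpNLe 6 2 (p + 10))) by now apply Hc.
  assert (Hj2 : nth_error P (p + 9) = Some (JmpNLe 3 3 (p + 15))) by now apply Hc.
  assert (Hj3 : nth_error P (p + 14) = Some (JmpNLe 3 3 (p + 8))) by now apply Hc.
  pose proof (code_at_sub P p [] (firstn 8 (postlude p)) (skipn 8 (postlude p)) Hc) as C1.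
  pose proof (code_at_sub P p (firstn 10 (postlude p)) (firstn 4 (skipn 10 (postlude p)))
    (skipn 14 (postlude p)) Hc) as C2.
  pose proof (code_at_sub P p (firstn 15 (postlude p)) (flat_map fetch (seq 1 31)) [] Hc) as C3.
  set (tail := flat_map fetch (seq 1 31)) in *.
  cbn [length firstn skipn postlude app] in C1, C2, C3. rewrite Nat.add_0_r in C1.
  change (N 2 = n) in Hn.
  pose proof (reach_straight P _ _ (N, Rg) C1 eq_refl) as R1. cbn [length] in R1.
  match type of R1 with reach _ _ _ (conf _ ?m) => set (m1 := m) in R1 end.
  (* The [q] items following the first 31 have been copied. [1050] is [32 * 32 + 26], so that
     [32 * n + 1050] is the address of the cell [n + 32] of [Out]; the offset [992 = 32 * 31] skips
     the items meant for registers 1 to 31. *)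
  assert (Hinv : forall q, q <= n - 31 -> exists N',
    reach P (q * 6) (conf (p + 8) m1) (conf (p + 8) (N', Rg)) /\
    N' 0 = 32 * n + 1050 /\ N' 2 = n /\ N' 3 = 32 /\ N' 4 = 1 /\
    N' 5 = 32 * n + 1050 + 32 * (31 + q) /\ N' 6 = 32 + q /\
    (forall j, 32 <= j < 32 + q -> N' j = N (32 * n + 1050 + 32 * (j - 1))) /\
    (forall j, 8 <= j -> 32 + q <= j -> N' j = N j)).
  { induction q as [|q IH]; intros Hq.
    - eexists. split; [reflexivity|]. unfold upd. cbn -[Nat.mul Nat.add]. rewrite Hn.
      repeat split; try lia.
      intros j H1 H2. do 8 (destruct j as [|j]; [lia|]). reflexivity.
    - destruct (IH ltac:(lia)) as (N1 & R & A0 & A2 & A3 & A4 & A5 & A6 & B1 & B2).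
      pose proof (reach_jump P _ N1 Rg _ _ _ Hj1) as R2. rewrite A2, A6 in R2.
      destruct (Nat.leb_spec (32 + q) n) as [_|]; [|lia].
      pose proof (reach_straight P _ _ (N1, Rg) C2 eq_refl) as R3. cbn [length] in R3.
      match type of R3 with reach _ _ _ (conf _ ?m) => set (m2 := m) in R3 end.
      assert (E2 : exists N2, m2 = (N2, Rg) /\
         (forall j, j <> 5 -> j <> 6 -> j <> 7 -> j <> 32 + q -> N2 j = N1 j) /\
         N2 5 = 32 * n + 1050 + 32 * (31 + S q) /\ N2 6 = 32 + S q /\
         N2 (32 + q) = N1 (32 * n + 1050 + 32 * (31 + q))).
      { eexists. split; [reflexivity|]. unfold upd.
        cbn -[Nat.mul Nat.add Nat.sub].
        rewrite A6. change (4 =? 32 + q) with false. change (3 =? 32 + q) with false.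
        change (5 =? 32 + q) with false. change (6 =? 32 + q) with false.
        rewrite Nat.eqb_refl, A4, A5, A3, ?A6. repeat split; try lia.
        - intros j H5 H6 H7 Hq'.
          now rewrite (proj2 (Nat.eqb_neq j 5) H5), (proj2 (Nat.eqb_neq j 6) H6),
            (proj2 (Nat.eqb_neq j 7) H7), (proj2 (Nat.eqb_neq j (32 + q)) Hq').
        - cbn -[Nat.mul]. lia.
        - cbn. lia. }
      destruct E2 as (N2 & E2 & D1 & D2 & D3 & D4). rewrite E2 in R3.
      pose proof (reach_jump P _ N2 Rg _ _ _ Hj3) as R4. rewrite Nat.leb_refl in R4.
      exists N2. split.
      { replace (S q * 6) with (q * 6 + (1 + (4 + 1))) by lia.
        eapply reach_trans; [exact R|]. eapply reach_trans; [exact R2|].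
        eapply reach_trans; [exact R3|]. replace (p + 10 + 4) with (p + 14) by lia. exact R4. }
      rewrite (D1 0), (D1 2), (D1 3), (D1 4) by lia. repeat split; auto.
      + intros j Hj. destruct (Nat.eq_dec j (32 + q)) as [->|].
        * rewrite D4, B2 by lia. f_equal. all: lia.
        * rewrite D1 by lia. apply B1. lia.
      + intros j H1 H2. rewrite D1 by lia. apply B2; lia. }
  destruct (Hinv (n - 31) (Nat.le_refl _)) as (N1 & R & A0 & A2 & A3 & A4 & A5 & A6 & B1 & B2).
  pose proof (reach_jump P _ N1 Rg _ _ _ Hj1) as R2. rewrite A2, A6 in R2.
  destruct (Nat.leb_spec (32 + (n - 31)) n) as [|_]; [lia|].
  pose proof (reach_jump P _ N1 Rg _ _ _ Hj2) as R3. rewrite Nat.leb_refl in R3.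
  pose proof (reach_straight P _ _ (N1, Rg) C3 eq_refl) as R4.
  replace (p + 15 + length tail) with (p + 108) in R4 by (cbn [tail length]; cbn; lia).
  destruct (fetch_ok 31 N1 Rg) as (N2 & E2 & F1 & F2). fold tail in E2. rewrite E2 in R4.
  exists (8 + ((n - 31) * 6 + (1 + (1 + length tail)))), (N2, Rg). split; [|split].
  - change (length tail) with 93. lia.
  - eapply reach_trans; [exact R1|]. eapply reach_trans; [exact R|]. eapply reach_trans; [exact R2|].
    replace (p + 9) with (S (p + 8)) in R3 by lia. eapply reach_trans; [exact R3|exact R4].
  - rewrite <- Ht. apply map_ext_in. intros i Hi. apply in_seq in Hi.
    change (N2 (S i) = N (32 * (n + 32 + i) + 26)).
    destruct (Nat.le_gt_cases (S i) 31) as [Hs|Hs].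
    + rewrite F2 by lia. rewrite A0, B2 by lia. f_equal. lia.
    + rewrite F1 by lia. rewrite B1 by lia. f_equal. lia.
Qed.

(** * Running time and the two programs *)

Definition prepare : cmd := Seq arrange (Seq powers bounds).
Definition answer : cmd := Seq select emit.
Definition solve : cmd := Seq classify (Seq prepare (Seq fill answer)).

(** For a fixed command [ctime] computes to a polynomial in the loop bounds; the constants here and
    in the next bounds are round numbers that dominate its coefficients. *)
Lemma classify_time B : ctime B classify <= 24 + 300 * B Size.
Proof. cbn -[Nat.mul]. lia. Qed.

Lemma prepare_time B :
  ctime B prepare <= 500 + 500 * B NumDec + 500 * B NumInc + 500 * (B NumInc * B NumInc).
Proof. cbn -[Nat.mul]. lia. Qed.

Lemma fill_time B :
  ctime B fill <= 100 + B Subsets * (100 + B Lengths * (100 + B Starts * (1000 + 1000 * B NumDec))).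
Proof.
  assert (E : ctime B state_body <= 900 + 900 * B NumDec) by (cbn -[Nat.mul]; lia).
  unfold fill. cbn [ctime]. set (c := ctime B state_body) in *. clearbody c.
  cbn -[Nat.mul Nat.add].
  assert (H1 : B Starts * (c + 6) <= B Starts * (1000 + 1000 * B NumDec))
    by (apply Nat.mul_le_mono_l; lia).
  apply Nat.add_le_mono; [lia|]. apply Nat.mul_le_mono_l.
  match goal with |- ?u + ?v * ?w + 6 <= 100 + ?v * ?z =>
    assert (H2 : v * w <= v * z) by (apply Nat.mul_le_mono_l; lia) end.
  lia.
Qed.

Lemma answer_time B : ctime B answer <= 200 + 200 * B Lengths + 200 * B Size.
Proof. cbn -[Nat.mul]. lia. Qed.

Lemma mirror_time B : ctime B mirror <= 100 + 100 * B Size.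
Proof. cbn -[Nat.mul]. lia. Qed.

(** Every monomial of the cost has the form [x * y * z] with [x <= k], [y <= 2 ^ k] and
    [z <= n ^ 6]. That [k] is positive makes [n] positive too, and so covers the monomials in which
    a factor is 1. *)
Lemma total_time n k u :
  0 < k -> k + u = n ->
  n <= k * 2 ^ k * n ^ 6 /\
  (24 + 300 * n) + (500 + 500 * k + 500 * u + 500 * (u * u)) +
  (100 + 2 ^ k * (100 + S u * (100 + S (2 * u) * (1000 + 1000 * k)))) +
  (200 + 200 * S u + 200 * n) <= 1000 * (8 * (k * 2 ^ k * n ^ 6)).
Proof.
  intros Hk Hu. set (p := 2 ^ k). set (q := n ^ 6).
  assert (Hp : 1 <= p) by (apply Nat.neq_0_lt_0, Nat.pow_nonzero; lia).
  assert (Hq2 : n * n <= q).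
  { unfold q. rewrite <- Nat.pow_2_r. apply Nat.pow_le_mono_r; lia. }
  assert (Hq1 : n <= q) by (apply (Nat.le_trans _ (n * n)); [apply Nat.le_mul_l|]; lia). assert (Hq0 : 1 <= q) by lia.
  assert (M : forall x y z, x <= k -> y <= p -> z <= q -> x * y * z <= k * p * q)
    by (intros; repeat apply Nat.mul_le_mono; easy).
  pose proof (M 1 1 1 ltac:(lia) ltac:(lia) ltac:(lia)) as M1.
  pose proof (M 1 1 n ltac:(lia) ltac:(lia) ltac:(lia)) as M2.
  pose proof (M 1 1 (n * n) ltac:(lia) ltac:(lia) ltac:(lia)) as M3.
  pose proof (M 1 p 1 ltac:(lia) ltac:(lia) ltac:(lia)) as M4.
  pose proof (M 1 p n ltac:(lia) ltac:(lia) ltac:(lia)) as M5.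
  pose proof (M 1 p (n * n) ltac:(lia) ltac:(lia) ltac:(lia)) as M6.
  pose proof (M k p (n * n) ltac:(lia) ltac:(lia) ltac:(lia)) as M7.
  pose proof (M k 1 1 ltac:(lia) ltac:(lia) ltac:(lia)) as M8.
  set (X := k * p * q) in *. clearbody X. split; [lia|].
  assert (F1 : u * u <= n * n) by (apply Nat.mul_le_mono; lia).
  assert (F2 : S u * (100 + S (2 * u) * (1000 + 1000 * k))
               <= n * (100 + 2 * n * (1000 + 1000 * k))).
  { apply Nat.mul_le_mono; [lia|]. apply Nat.add_le_mono_l, Nat.mul_le_mono_r. lia. }
  assert (F3 : p * (100 + S u * (100 + S (2 * u) * (1000 + 1000 * k)))
               <= p * (100 + n * (100 + 2 * n * (1000 + 1000 * k))))
    by (apply Nat.mul_le_mono_l; lia).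
  assert (F4 : forall c d, p * (c + n * (c + 2 * n * (d + d * k)))
    = c * (1 * p * 1) + c * (1 * p * n) + 2 * d * (1 * p * (n * n)) + 2 * d * (k * p * (n * n)))
    by (intros; ring).
  rewrite F4 in F3. clear F4.
  clear M F2 Hq2.
  set (y1 := 1 * p * 1) in *. set (y2 := 1 * p * n) in *. set (y3 := 1 * p * (n * n)) in *.
  set (y4 := k * p * (n * n)) in *. set (y5 := p * (100 + _)) in *. set (y6 := u * u) in *.
  clearbody y1 y2 y3 y4 y5 y6. set (y7 := n * n) in *. clearbody y7. lia.
Qed.

Lemma code_at_seq P p h c1 c2 :
  code_at P p (ccode (Seq c1 c2) p h) ->
  code_at P p (ccode c1 p h) /\
  code_at P (p + length (ccode c1 p h)) (ccode c2 (p + length (ccode c1 p h)) h).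
Proof. apply code_at_app. Qed.

Lemma length_ccode_seq c1 c2 p h :
  length (ccode (Seq c1 c2) p h)
  = length (ccode c1 p h) + length (ccode c2 (p + length (ccode c1 p h)) h).
Proof. apply length_app. Qed.

Lemma ccode_run F P p m c :
  code_at P p (ccode c p 0) -> stable F c = true ->
  exists T m', T <= ctime (fun y => nat_at (view m) y 0) c /\
    reach P T (conf p m) (conf (p + length (ccode c p 0)) m') /\ view m' = run c (view m).
Proof.
  intros Hc Hs.
  destruct (ccode_ok F (fun y => nat_at (view m) y 0) P c Hs p 0 m Hc) as (m' & (T & H1 & H2 & _) & H3);
    [easy|]. now exists T, m'.
Qed.

Lemma solve_ok P p m n :
  let a := slopes (view m) in
  let b := offsets (view m) in
  let k := length (filter (fun x => negb (nondecb a x)) (seq 0 n)) in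
  code_at P p (ccode solve p 0) -> nat_at (view m) Size 0 = n -> 0 < k ->
  exists T m' t, T <= 1000 * (8 * (k * 2 ^ k * n ^ 6)) /\
    reach P T (conf p m) (conf (p + length (ccode solve p 0)) m') /\
    nat_at (view m') Size 0 = n /\
    vec (fun i => nat_at (view m') Out (n + 32 + i)) n = t /\ minimal a b n t.
Proof.
  intros a b k Hc Hn Hk. unfold solve in Hc.
  destruct (code_at_seq _ _ _ _ _ Hc) as [C1 Hc1]. set (p1 := p + _) in Hc1.
  destruct (code_at_seq _ _ _ _ _ Hc1) as [C2 Hc2]. set (p2 := p1 + _) in Hc2.
  destruct (code_at_seq _ _ _ _ _ Hc2) as [C3 C4]. set (p3 := p2 + _) in C4.
  destruct (ccode_run (fun y => nname_beq y Size) P p m _ C1 eq_refl) as (T1 & m1 & L1 & R1 & V1).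
  assert (Q1 : nat_at (view m1) Size 0 = n /\ real_at (view m1) Input = real_at (view m) Input /\
    vec (nat_at (view m1) Inc) (nat_at (view m1) NumInc 0) = filter (nondecb a) (seq 0 n) /\
    vec (nat_at (view m1) Dec) (nat_at (view m1) NumDec 0)
      = filter (fun x => negb (nondecb a x)) (seq 0 n) /\
    forall x, x < n -> real_at (view m1) Angle x = pseudo_angle (b x) (a x - 1)).
  { rewrite V1. pattern (run classify (view m)). apply (classify_ok (view m) _ n a b); auto. }
  destruct Q1 as (N1 & I1 & Inc1 & Dec1 & A1).
  set (ds := filter (fun x => negb (nondecb a x)) (seq 0 n)) in *.
  assert (K1 : nat_at (view m1) NumDec 0 = k) by (rewrite <- (vec_length (nat_at (view m1) Dec) (nat_at _ _ _)), Dec1; reflexivity).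
  set (u := length (filter (nondecb a) (seq 0 n))).
  assert (U1 : nat_at (view m1) NumInc 0 = u) by (rewrite <- (vec_length (nat_at (view m1) Inc) (nat_at _ _ _)), Inc1; reflexivity).
  assert (Hku : k + u = n).
  { pose proof (Permutation_length (filter_perm_split (nondecb a) (seq 0 n))) as E.
    rewrite length_app, length_seq in E. fold ds in E. unfold k, u. lia. }
  destruct (ccode_run (fun y => match y with NumInc | NumDec => true | _ => false end) P p1 m1 _ C2 eq_refl)
    as (T2 & m2 & L2 & R2 & V2).
  assert (Q2 : exists ord, nat_at (view m2) Size 0 = n /\
     env (Setting (2 * n + 1) u ds ord a b) (view m2) /\
     Permutation (vec ord u) (filter (nondecb a) (seq 0 n)) /\
     StronglySorted (fun x y => real_at (view m1) Angle x <= real_at (view m1) Angle y)%R (vec ord u) /\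
     forall i, i < u -> ord (i + u) = ord i).
  { rewrite V2. pattern (run prepare (view m1)). apply holds_seq. apply (arrange_ok _ _ u U1).
    intros s1 S1 S2 S3 S4 S5 S6 S7 S8. apply holds_seq. apply (powers_ok _ _ k); [congruence|].
    intros s2 P1 P2 P3 P4 P5 P6 P7. unfold bounds, assign. repeat step.
    exists (nat_at s1 Order).
    assert (Eu : nat_at s2 NumInc 0 = u) by congruence.
    assert (Ek : nat_at s2 NumDec 0 = k) by congruence.
    assert (En : nat_at s2 Size 0 = n) by congruence.
    split; [exact En|]. split; [|split; [|split]]; auto.
    - unfold env, slopes, offsets. read. cbn [width incs decs order coefa coefb].
      rewrite ?upd_same. rewrite Eu, Ek, En. fold k.
      repeat split; auto; try lia.
      + intros d Hd. rewrite P4, S4, <- Dec1, nth_vec; [reflexivity|]. now rewrite K1.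
      + rewrite P6, S5. unfold a, slopes. now rewrite I1.
      + rewrite P6, S5. unfold b, offsets. now rewrite I1.
    - rewrite S6, <- Inc1, U1. reflexivity. }
  destruct Q2 as (ord & N2 & E2 & Pe2 & So2 & Pr2). set (g := Setting _ _ _ _ _ _) in E2.
  destruct (ccode_run is_static P p2 m2 _ C3 eq_refl) as (T3 & m3 & L3 & R3 & V3).
  assert (Q3 : kept is_static (view m2) (view m3) /\ below g (view m3) (code g (2 ^ length (decs g)) 0 0)).
  { rewrite V3. apply (fill_ok g (view m2) (fun s => kept is_static (view m2) s /\ below g s _));
      [exact E2|cbn [g width incs]; lia|auto]. }
  destruct Q3 as [K3 B3].
  assert (E3 : env g (view m3)) by (now apply (env_kept is_static g (view m2))).
  assert (N3 : nat_at (view m3) Size 0 = n) by (destruct K3 as [K3 _]; now rewrite K3).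
  destruct (ccode_run (fun y => match y with Lengths | Size => true | _ => false end) P p3 m3 _ C4 eq_refl)
    as (T4 & m4 & L4 & R4 & V4).
  assert (Q4 : exists t, nat_at (view m4) Size 0 = n /\
     vec (fun i => nat_at (view m4) Out (n + 32 + i)) n = t /\ minimal a b n t).
  { rewrite V4. pattern (run answer (view m3)). apply holds_seq. apply (select_ok g); [exact E3|].
    intros s1 i [Hk1 _] Hr Hi Hcur Hmin. set (full := 2 ^ length (decs g) - 1) in *.
    pose proof (Nat.pow_nonzero 2 (length (decs g)) ltac:(lia)) as Hp0.
    assert (Hent : forall j, j <= u -> entry g (view m3) (interval ord j u) full (code g full u j)).
    { intros j Hj. apply B3; cbn [g incs decs]; unfold full; cbn [g decs] in *; try lia.
      unfold code. cbn [g width]. nia. }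
    cbn [g incs] in Hi, Hcur, Hmin.
    destruct (Hent i Hi) as (t & [Ct Mt] & (T1' & T2' & T3')).
    cbn [g decs coefa coefb] in Ct, Mt, T2'.
    assert (Hmint : minimal a b n t).
    { apply (candidates_minimal a b n u ds ord t i); auto; try lia.
      - apply (sorted_mono (fun x y => real_at (view m1) Angle x <= real_at (view m1) Angle y)%R); [|easy].
        intros x y Hx Hy. apply (Permutation_in _ Pe2), filter_In in Hx, Hy.
        destruct Hx as [Hx _], Hy as [Hy _]. apply in_seq in Hx, Hy. rewrite !A1 by lia. auto.
      - intros j t' Hj Ht'. destruct (Hent j Hj) as (t2 & [Ct2 Mt2] & (_ & T2'' & _)).
        specialize (Mt2 t' Ht'). specialize (Hmin j Hj). cbn [g coefa coefb] in Mt2, T2''.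
        rewrite T2', T2'' in Hmin. lra. }
    apply (emit_ok s1 _ n t).
    - rewrite Hk1 by reflexivity. exact N3.
    - destruct Hmint as [Hp _]. unfold is_perm in Hp.
      now rewrite <- (Permutation_length Hp), length_seq.
    - rewrite Hcur, !Hk1 by reflexivity. exact T3'.
    - intros s2 Es2 Ev. exists t. split; [|split; [exact Ev|exact Hmint]].
      rewrite Es2, Hk1 by reflexivity. exact N3. }
  destruct Q4 as (t & N4 & Ev & Hmint).
  exists (T1 + (T2 + (T3 + T4))), m4, t. split; [|split; [|auto]].
  - destruct (total_time n k u Hk Hku) as [_ Ht].
    pose proof (classify_time (fun y => nat_at (view m) y 0)) as D1.
    pose proof (prepare_time (fun y => nat_at (view m1) y 0)) as D2.
    pose proof (fill_time (fun y => nat_at (view m2) y 0)) as D3.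
    pose proof (answer_time (fun y => nat_at (view m3) y 0)) as D4.
    destruct E2 as (_ & _ & F3 & _ & _ & _ & F7 & F8 & F9 & _).
    destruct E3 as (_ & _ & _ & _ & _ & _ & _ & G8 & _).
    cbn [g incs decs] in F3, F7, F8, F9, G8. fold k in F3, F7.
    cbv beta in D1, D2, D3, D4. rewrite Hn in D1. rewrite K1, U1 in D2.
    rewrite F3, F7, F8, F9 in D3. rewrite G8, N3 in D4. lia.
  - replace (p + length (ccode solve p 0)) with (p3 + length (ccode answer p3 0)).
    { eapply reach_trans; [exact R1|]. eapply reach_trans; [exact R2|].
      eapply reach_trans; [exact R3|]. exact R4. }
    unfold solve. rewrite length_ccode_seq. fold p1. rewrite length_ccode_seq. fold p2.
    rewrite length_ccode_seq. fold p3. unfold p3, p2, p1. rewrite !Nat.add_assoc. reflexivity.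
Qed.

Lemma filter_map_length {S T} (f : T -> bool) (g : S -> T) l :
  length (filter f (map g l)) = length (filter (fun x => f (g x)) l).
Proof. induction l as [|x l IH]; cbn; [easy|]. destruct (f (g x)); cbn; now rewrite IH. Qed.

Lemma const_opp a b s : const a (fun x => (- b x)%R) s = (- const a b s)%R.
Proof. induction s as [|x s IH]; cbn [const]; [ring|]. rewrite IH. ring. Qed.

Definition linkage (c : cmd) : program :=
  prelude ++ ccode c 20 0 ++ postlude (20 + length (ccode c 20 0)).

Definition slope_at (fs : list linfun) (x : nat) : R := fst (nth x fs (0%R, 0%R)).
Definition offset_at (fs : list linfun) (x : nat) : R := snd (nth x fs (0%R, 0%R)).

Lemma init_input fs x :
  x < length fs ->
  rreg (init_config fs) (2 * x) = slope_at fs x /\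
  rreg (init_config fs) (2 * x + 1) = offset_at fs x.
Proof.
  intros Hx. unfold init_config, slope_at, offset_at. cbn [rreg]. cbv zeta.
  rewrite Nat.add_1_r, Nat.div2_succ_double, Nat.div2_double.
  rewrite (proj2 (Nat.ltb_lt x (length fs)) Hx).
  now rewrite Nat.even_succ, Nat.odd_mul, Nat.even_mul.
Qed.

(** Reduces a claim on the whole program to one on the compiled command, started in a memory whose
    view already holds the input. The additional time covers [14 * n + 14] steps of [prelude] and
    [6 * n + 110] of [postlude]. *)
Lemma linkage_ok c fs X (Q : list nat -> Prop) :
  let P := linkage c in
  let n := length fs in
  (forall m, nat_at (view m) Size 0 = n ->
     (forall x, x < n -> slopes (view m) x = slope_at fs x /\ offsets (view m) x = offset_at fs x) ->
     exists T m' t, T <= X /\ reach P T (conf 20 m) (conf (20 + length (ccode c 20 0)) m') /\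
       nat_at (view m') Size 0 = n /\
       vec (fun i => nat_at (view m') Out (n + 32 + i)) n = t /\ Q t) ->
  exists T t, T <= X + (20 * n + 200) /\ computes_within P fs T t /\ Q t.
Proof.
  intros P n Hc. set (p := 20 + length (ccode c 20 0)).
  assert (C1 : code_at P 0 prelude) by (apply (code_at_whole [] prelude)).
  assert (C3 : code_at P p (postlude p)).
  { unfold P, linkage. rewrite app_assoc, <- (app_nil_r (postlude _)).
    replace p with (length (prelude ++ ccode c 20 0)) at 1 by (rewrite length_app; reflexivity).
    apply code_at_whole. }
  destruct (prelude_ok P n (nreg (init_config fs)) (rreg (init_config fs)) C1)
    as (T1 & m1 & L1 & R1 & S1 & I1).
  { reflexivity. }
  { intros i Hi. cbn. destruct (Nat.eqb_spec i 0); [lia|reflexivity]. }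
  destruct (Hc m1 S1) as (T2 & m2 & t & L2 & R2 & S2 & V2 & Ht).
  { intros x Hx. unfold slopes, offsets. rewrite !I1 by lia. now apply init_input. }
  destruct (postlude_ok P p n m2 t C3 S2 V2) as (T3 & m3 & L3 & R3 & V3).
  exists (T1 + (T2 + T3)), t. split; [lia|split; [|exact Ht]].
  assert (E : exec P (T1 + (T2 + T3)) (init_config fs) = conf (p + 108) m3).
  { apply reach_exec. eapply reach_trans; [exact R1|]. eapply reach_trans; [exact R2|exact R3]. }
  unfold computes_within. rewrite E. split; [|exact V3].
  (* The program stops by running off the end of its code. *)
  unfold conf, step. rewrite (proj2 (nth_error_None P (p + 108))); [reflexivity|].
  unfold P, linkage. fold p. rewrite !length_app. change (length (postlude p)) with 108.
  change (length prelude) with 20. unfold p. lia.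
Qed.

Lemma linkage_code c : code_at (linkage c) 20 (ccode c 20 0).
Proof. exact (code_at_whole prelude _ _). Qed.

Lemma count_decreasing fs a :
  (forall x, x < length fs -> a x = slope_at fs x) ->
  length (filter (fun x => negb (nondecb a x)) (seq 0 (length fs))) = num_decreasing fs.
Proof.
  intros H. unfold num_decreasing. rewrite <- (map_nth_seq fs (0%R, 0%R)) at 2.
  rewrite filter_map_length. f_equal. apply filter_ext_in. intros x Hx. apply in_seq in Hx.
  unfold nondecb, decreasingb. rewrite H by lia. fold (slope_at fs x).
  destruct (Rle_dec 0 (slope_at fs x)), (Rlt_dec (slope_at fs x) 0); cbn; try reflexivity; lra.
Qed.

Lemma minimal_ext a b a' b' n t :
  (forall x, x < n -> a x = a' x /\ b x = b' x) -> minimal a b n t -> minimal a' b' n t.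
Proof.
  intros H [Hp Hmin]. split; [easy|]. intros r Hr.
  assert (E : forall s, is_perm n s -> const a b s = const a' b' s).
  { intros s Hs. apply const_ext_in. intros x Hx. apply H.
    apply (Permutation_in _ (Permutation_sym Hs)), in_seq in Hx. lia. }
  rewrite <- !E by easy. auto.
Qed.

Lemma compose_at fs s x :
  compose fs s x = (slope (slope_at fs) s * x + const (slope_at fs) (offset_at fs) s)%R.
Proof. apply compose_eq. Qed.

Lemma slope_perm_eq a n s t : is_perm n s -> is_perm n t -> slope a s = slope a t.
Proof. intros Hs Ht. apply slope_perm. unfold is_perm in *. now rewrite <- Hs. Qed.

Lemma minimal_is_min_perm fs t :
  minimal (slope_at fs) (offset_at fs) (length fs) t -> is_min_perm fs t.
Proof.
  intros [Hp Hmin]. split; [easy|]. intros r Hr x. rewrite !compose_at.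
  rewrite (slope_perm_eq _ _ _ _ Hp Hr). specialize (Hmin r Hr). lra.
Qed.

Lemma minimal_is_max_perm fs t :
  minimal (slope_at fs) (fun x => (- offset_at fs x)%R) (length fs) t -> is_max_perm fs t.
Proof.
  intros [Hp Hmin]. split; [easy|]. intros r Hr x. rewrite !compose_at.
  rewrite (slope_perm_eq _ _ _ _ Hp Hr). specialize (Hmin r Hr).
  rewrite !const_opp in Hmin. lra.
Qed.

Lemma decreasing_size fs : 0 < num_decreasing fs -> 
  length fs <= num_decreasing fs * 2 ^ num_decreasing fs * length fs ^ 6 /\ 0 < length fs.
Proof.
  intros Hk.
  assert (Hle : num_decreasing fs <= length fs) by apply filter_length_le.
  destruct (total_time (length fs) (num_decreasing fs) (length fs - num_decreasing fs) Hk ltac:(lia))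
    as [H _]. split; [exact H|lia].
Qed.

Theorem theorem1p2 :
  exists (Pmin Pmax : program) (C : nat),
    forall fs : list linfun,
      let n := length fs in
      let k := num_decreasing fs in
      (0 < k)%nat ->
      (exists t s, (t <= C * k * 2 ^ k * n ^ 6)%nat /\
                   computes_within Pmin fs t s /\ is_min_perm fs s) /\
      (exists t s, (t <= C * k * 2 ^ k * n ^ 6)%nat /\
                   computes_within Pmax fs t s /\ is_max_perm fs s).
Proof.
  (* With [X = k * 2 ^ k * n ^ 6], [solve] takes at most [1000 * (8 * X)] steps. One more [1000 * X]
     covers mirroring and the transfer of input and output, which are linear in [n], where
     [0 < n <= X]. *)
  exists (linkage solve), (linkage (Seq mirror solve)), (1000 * 9). intros fs n k Hk.
  destruct (decreasing_size fs Hk) as [Hn Hn0]. fold n k in Hn, Hn0.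
  replace (1000 * 9 * k * 2 ^ k * n ^ 6) with (1000 * (9 * (k * 2 ^ k * n ^ 6)))
    by (rewrite !Nat.mul_assoc; reflexivity).
  set (X := k * 2 ^ k * n ^ 6) in *. split.
  - destruct (linkage_ok solve fs (1000 * (8 * X)) (is_min_perm fs)) as (T & t & HT & Hc & Ht).
    + intros m Hs Hin.
      assert (Ek : length (filter (fun x => negb (nondecb (slopes (view m)) x)) (seq 0 n)) = k)
        by (apply count_decreasing; intros x Hx; now apply Hin).
      destruct (solve_ok (linkage solve) 20 m n (linkage_code solve) Hs) as (T & m' & t & H1 & H2 & H3 & H4 & H5).
      { now rewrite Ek. }
      rewrite Ek in H1. exists T, m', t. split; [exact H1|]. split; [exact H2|].
      split; [exact H3|]. split; [exact H4|].
      apply minimal_is_min_perm. now apply (minimal_ext _ _ _ _ _ _ Hin).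
    + exists T, t. split; [|now split]. fold n in HT. lia.
  - destruct (linkage_ok (Seq mirror solve) fs (1000 * (8 * X) + (100 + 100 * n)) (is_max_perm fs))
      as (T & t & HT & Hc & Ht).
    + intros m Hs Hin. set (P := linkage (Seq mirror solve)).
      destruct (code_at_seq _ _ _ _ _ (linkage_code (Seq mirror solve))) as [C1 C2].
      destruct (ccode_run (fun y => nname_beq y Size) P 20 m mirror C1 eq_refl) as (T1 & m1 & L1 & R1 & V1).
      assert (Q1 : nat_at (view m1) Size 0 = n /\
        forall x, x < n -> slopes (view m1) x = slope_at fs x /\
                           offsets (view m1) x = (- offset_at fs x)%R).
      { rewrite V1. pattern (run mirror (view m)). apply (mirror_ok (view m) _ n Hs).
        intros s' E1 E2 E3. split; [exact E1|]. intros x Hx. rewrite E2, E3 by easy.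
        destruct (Hin x Hx) as [-> ->]. easy. }
      destruct Q1 as [N1 Hin1].
      assert (Ek : length (filter (fun x => negb (nondecb (slopes (view m1)) x)) (seq 0 n)) = k)
        by (apply count_decreasing; intros x Hx; now apply Hin1).
      destruct (solve_ok P _ m1 n C2 N1) as (T2 & m' & t & H1 & H2 & H3 & H4 & H5).
      { now rewrite Ek. }
      rewrite Ek in H1. exists (T1 + T2), m', t. split.
      { pose proof (mirror_time (fun y => nat_at (view m) y 0)) as D. cbv beta in D.
        rewrite Hs in D. fold n X in D, H1. lia. }
      split; [|split; [exact H3|split; [exact H4|]]].
      * rewrite length_ccode_seq, Nat.add_assoc. eapply reach_trans; [exact R1|exact H2].
      * apply minimal_is_max_perm. now apply (minimal_ext _ _ _ _ _ _ Hin1).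
    + exists T, t. split; [|now split]. fold n in HT. lia.
Qed.
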